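(* Let $1/2<H<1$, $\xi\in\mathbf R$, let $b,\sigma\in C^\infty_{\mathrm{bdd}}(\mathbf R;\mathbf R)$ with $\inf\sigma>0$, let $B$ be a one-dimensional fractional Brownian motion with Hurst parameter $H$ on $[0,1]$, and let $X$ be the solution of $X_t=\xi+\int_0^t b(X_s)\,ds+\int_0^t\sigma(X_s)\,d^\circ B_s$, $t\in[0,1]$ (in the sense of the context). For $m\in\mathbf N$ let $\bar X^{(m)}$ be the Euler scheme defined by $\bar X^{(m)}_0=\xi$ and $$\bar X^{(m)}_t=\bar X^{(m)}_{\tau^m_{k-1}}+b(\bar X^{(m)}_{\tau^m_{k-1}})(t-\tau^m_{k-1})+\sigma(\bar X^{(m)}_{\tau^m_{k-1}})(B_t-B_{\tau^m_{k-1}}),\qquad \tau^m_{k-1}<t\le\tau^m_k,$$ where $\tau^m_k=k2^{-m}$, $k=0,\dots,2^m$. Put $\mathsf w=\sigma b'-\sigma' b$, $$J_t=\exp\Big(\int_0^t b'(X_u)\,du+\int_0^t\sigma'(X_u)\,d^\circ B_u\Big),\qquad U_t=\int_0^t f_2(X_u)\,du,\quad f_2=-\sigma'/2 .$$ Then $$\lim_{m\to\infty}2^{m(2H-1)}\{\bar X^{(m)}-X\}=\sigma(X)U+J\int_0^{\cdot}J_s^{-1}\mathsf w(X_s)U_s\,ds$$ in probability with respect to the uniform norm on $[0,1]$; the limit is the process $t\mapsto\sigma(X_t)U_t+J_t\int_0^tJ_s^{-1}\mathsf w(X_s)U_s\,ds$.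
   Context: Fractional Brownian motion (fBm) with Hurst parameter $H\in(0,1)$ is the continuous centered Gaussian process $B$ with $B_0=0$ and $E[B_sB_t]=\frac12\{s^{2H}+t^{2H}-|t-s|^{2H}\}$; its paths are almost surely $(H-\epsilon)$-Hölder continuous for every $0<\epsilon<H$. $C^n_{\mathrm{bdd}}(\mathbf R;\mathbf R)$, $n\in\{0,1,2,\dots,\infty\}$, is the set of $n$-times continuously differentiable functions which are bounded together with all their derivatives (up to order $n$). Symmetric integral (Russo–Vallois), understood pathwise: for continuous $f,g:[0,1]\to\mathbf R$, $$\int_0^t f_u\,d^\circ g_u=\lim_{\epsilon\downarrow0}\int_0^t\frac{f_{(u+\epsilon)\wedge t}+f_u}{2}\,\frac{g_{(u+\epsilon)\wedge t}-g_u}{\epsilon}\,du$$ whenever the limit exists. The solution $X$ of the SDE is the one given pathwise by $X_t=\phi(a_t,B_t)$, where $\phi$ solves $\phi(\alpha,\beta)=\alpha+\int_0^\beta\sigma(\phi(\alpha,\eta))\,d\eta$ and $a$ solves $a_t=\xi+\int_0^t f_{\sigma,b}(a_u,B_u)\,du$ with $f_{\sigma,b}(x,y)=\exp\big(-\int_0^y\sigma'(\phi(x,\eta))\,d\eta\big)\,b(\phi(x,y))$. *)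

(* Defs.v *)
From HB Require Import structures.
From mathcomp Require Import all_boot all_order all_algebra.
From mathcomp Require Import all_classical all_reals all_analysis.

Set Implicit Arguments.
Unset Strict Implicit.
Unset Printing Implicit Defensive.

Import Order.TTheory GRing.Theory Num.Theory.
Import numFieldNormedType.Exports.

Local Open Scope classical_set_scope.
Local Open Scope ring_scope.

Definition Cinf_bdd (R : realType) (f : R -> R) : Prop :=
  forall n : nat, (forall x, derivable (derive1n n f) x 1) /\
    exists M : R, forall x, `|derive1n n f x| <= M.

(* The oriented integral over [0, y]; y may be negative. *)
Definition int0 (R : realType) (f : R -> R) (y : R) : R :=
  if 0 <= y then \int[lebesgue_measure]_(x in `[0, y]) f x
  else - \int[lebesgue_measure]_(x in `[y, 0]) f x.

(* Degenerate (Dirac) laws are Gaussian. They are listed separately because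
   the library's [normal_prob m 0] is not the Dirac mass at m. *)
Definition gaussian_rv (d : measure_display) (T : measurableType d)
    (R : realType) (P : probability T R) (Y : T -> R) : Prop :=
  measurable_fun setT Y /\
  exists m s : R, forall A : set R, measurable A ->
    P (Y @^-1` A) = if s == 0 then \d_m A else normal_prob m s A.

(* A process on [0, 1] is a function of a real time; only its values at times
   in [0, 1] are constrained. *)
Definition gaussian_process (d : measure_display) (T : measurableType d)
    (R : realType) (P : probability T R) (B : R -> T -> R) : Prop :=
  forall (n : nat) (t c : 'I_n -> R), (forall i, t i \in `[0, 1]) ->
    gaussian_rv P (fun w => \sum_(i < n) c i * B (t i) w).

Definition fBm (d : measure_display) (T : measurableType d)
    (R : realType) (P : probability T R) (H : R) (B : R -> T -> R) : Prop :=
  [/\ 0 < H < 1,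
      gaussian_process P B,
      forall t, t \in `[0, 1] -> ('E_P[B t] = 0)%E,
      forall s t, s \in `[0, 1] -> t \in `[0, 1] ->
        ('E_P[(fun w => B s w * B t w)%R] =
          (2^-1 * (s `^ (2 * H) + t `^ (2 * H) - `|t - s| `^ (2 * H)))%R%:E)%E &
      {ae P, forall w, B 0 w = 0 /\ {within `[0, 1], continuous (B ^~ w)}}].

(* Russo-Vallois symmetric integral of f against g over [0, t]; as for every
   [lim], the value is meaningful only when the limit exists. *)
Definition symint (R : realType) (f g : R -> R) (t : R) : R :=
  lim ((int0 (fun u => (f (Num.min (u + eps) t) + f u) / 2 *
                       ((g (Num.min (u + eps) t) - g u) / eps)) t)
         @[eps --> 0^'+]).

Definition f_sigma_b (R : realType) (sigma b : R -> R) (phi : R -> R -> R)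
    (x y : R) : R :=
  expR (- int0 (fun eta => derive1 sigma (phi x eta)) y) * b (phi x y).

(* x is the pathwise solution of dx = b(x) dt + sigma(x) d°g, x_0 = xi. *)
Definition sde_solution (R : realType) (b sigma : R -> R) (xi : R)
    (g x : R -> R) : Prop :=
  exists (phi : R -> R -> R) (a : R -> R),
    [/\ forall alpha, continuous (phi alpha),
        forall alpha beta,
          phi alpha beta = alpha + int0 (fun eta => sigma (phi alpha eta)) beta,
        {within `[0, 1], continuous a},
        forall t, t \in `[0, 1] ->
          a t = xi + int0 (fun u => f_sigma_b sigma b phi (a u) (g u)) t &
        forall t, t \in `[0, 1] -> x t = phi (a t) (g t)].

Definition dyadic (R : realType) (m k : nat) : R := k%:R * 2 ^- m.

Definition euler_scheme (R : realType) (b sigma : R -> R) (xi : R)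
    (g : R -> R) (m : nat) (x : R -> R) : Prop :=
  x 0 = xi /\
  forall (k : nat) (t : R), (k < 2 ^ m)%N ->
    dyadic R m k < t <= dyadic R m k.+1 ->
    x t = x (dyadic R m k) + b (x (dyadic R m k)) * (t - dyadic R m k)
          + sigma (x (dyadic R m k)) * (g t - g (dyadic R m k)).

Definition wronskian (R : realType) (b sigma : R -> R) (x : R) : R :=
  sigma x * derive1 b x - derive1 sigma x * b x.

Definition Jpath (R : realType) (b sigma : R -> R) (g x : R -> R) (t : R) : R :=
  expR (int0 (fun u => derive1 b (x u)) t
        + symint (fun u => derive1 sigma (x u)) g t).

Definition Upath (R : realType) (sigma : R -> R) (x : R -> R) (t : R) : R :=
  int0 (fun u => - derive1 sigma (x u) / 2) t.

Definition limit_path (R : realType) (b sigma : R -> R) (g x : R -> R)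
    (t : R) : R :=
  let J := Jpath b sigma g x in
  let U := Upath sigma x in
  sigma (x t) * U t
  + J t * int0 (fun s => (J s)^-1 * wronskian b sigma (x s) * U s) t.

(* Extended-real valued, so that an unbounded f has norm +oo. *)
Definition unif_norm (R : realType) (f : R -> R) : \bar R :=
  ereal_sup [set `|f t|%:E | t in `[0, 1]].

(* Convergence in probability in the uniform norm on [0, 1]. [P^*] is the outer
   measure of P, which coincides with P on measurable events; paths are only
   almost surely continuous and P need not be complete, so the event below is
   in general only measurable up to a null set. *)
Definition cvg_prob_unif (d : measure_display) (T : measurableType d)
    (R : realType) (P : probability T R)
    (Y : nat -> R -> T -> R) (Z : R -> T -> R) : Prop :=
  forall eps : R, 0 < eps ->
    (P^*)%mu [set w | (eps%:E < unif_norm (fun t => Y m t w - Z t w)%R)%E]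
      @[m --> \oo] --> 0%E.

(* Main.v *)
Require Import Defs.
From HB Require Import structures.
From mathcomp Require Import all_boot all_order all_algebra.
From mathcomp Require Import all_classical all_reals all_analysis.
From mathcomp Require Import measurable_realfun.
From mathcomp Require Import ring lra.

Set Implicit Arguments.
Unset Strict Implicit.
Unset Printing Implicit Defensive.

Import Order.TTheory GRing.Theory Num.Theory.
Import numFieldNormedType.Exports.

Local Open Scope classical_set_scope.
Local Open Scope ring_scope.

(** With S' = 1 / sigma, the transform S(X) solves an equation with additive noise:
    S(X_t) = S(xi) + int_0^t (b / sigma)(X_u) du + B_t. Since the symmetric integral obeys the
    ordinary chain rule, J = sigma(X) E / sigma(xi) with E = exp(int (w / sigma)(X)), so the
    claimed limit is sigma(X) Z where Z solves the linear equation Z' = (w / sigma)(X) Z + f_2(X).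
    One Euler step changes S(Xbar) by (b / sigma) h + D - (sigma' / 2) D^2 up to third order terms,
    D being the increment of B. Hence the error 2^(m(2H - 1)) (S(Xbar) - S(X)) satisfies a
    discrete version of the equation of Z, with source -(sigma' / 2)(X) 2^(m(2H - 1)) D^2 in place
    of -(sigma' / 2)(X) 2^(-m), and a discrete Gronwall inequality compares the two.
    The sums of 2^(m(2H - 1)) D^2 - 2^(-m) over dyadic blocks tend to 0 in L^2: for H > 1/2 the
    increments are nonnegatively correlated, which bounds the sum of the squared covariances.
    On a path this is a deterministic statement, given a Hölder bound of exponent close to H; such
    a bound holds with probability close to 1 by chaining and Gaussian tails. *)

(** * Increments, integrals, and functions with bounded derivatives *)

(** The normalization comes from [E[D^2] = 2^(-2 H m)]: the [2^m] squared increments add up to about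
    [2^(-m (2 H - 1))], and this sum survives as the source of the error. Its weight [sigma'(X)] is
    random and depends on the whole path, so it cannot enter a variance computation. It is therefore
    frozen on [2^p] blocks: Hölder continuity pays for the freezing, and on a block only the
    unweighted sum is left, whose variance is explicit. Hence the order of choices: [p] from [eps],
    then the tolerance [delta] of the block sums from [p], then [m]. The other errors are powers of
    the mesh. With [d = 2^(-m gamma)] the critical ones are [2^(m (2 H - 1)) d] and [2^(2 H m) d^3];
    both tend to 0 for [gamma < H] close to [H], since [H < 1]. Every constant depends on the path
    only through its Hölder constant, so the deterministic estimate is uniform over an event of
    probability close to 1. Integrals and differential equations along a path are handled by
    increment bounds, of order larger than one in the length of the interval. *)

Lemma eq_of_quadratic_increments {R : realType} (F : R -> R) (x y C : R) : x <= y ->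
  (forall u v, x <= u -> u <= v -> v <= y ->
    `|F v - F u| <= C * (v - u) ^+ 2) -> F x = F y.
Proof.
move=> xy FC.
(* Cut [[x, y]] into [n + 1] equal pieces: the squared lengths add up to [(y - x)^2 / (n + 1)],
   which tends to 0. This replaces differentiation in the identities for the flow and the
   solution. *)
have FCn n : `|F y - F x| <= C * (y - x) ^+ 2 * n.+1%:R^-1.
  pose d := (y - x) / n.+1%:R.
  have d0 : 0 <= d by rewrite divr_ge0 ?subr_ge0.
  have dE : d * n.+1%:R = y - x by rewrite divfK// pnatr_eq0.
  pose p (i : nat) := x + i%:R * d.
  have -> : F y - F x = \sum_(0 <= i < n.+1) (F (p i.+1) - F (p i)).
    have pn : p n.+1 = y by rewrite /p mulrC dE; ring.
    have p0 : p 0 = x by rewrite /p mul0r addr0.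
    by rewrite (telescope_sumr (fun i => F (p i)))// p0 pn.
  apply: le_trans (ler_norm_sum _ _ _) _.
  have -> : C * (y - x) ^+ 2 / n.+1%:R = \sum_(0 <= i < n.+1) C * d ^+ 2.
    rewrite sumr_const_nat subn0 -[RHS]mulr_natr -dE; have: n.+1%:R != 0 :> R by rewrite pnatr_eq0.
    by move: (n.+1%:R : R) => k k0; field.
  rewrite !big_nat; apply: ler_sum => i /= ilt.
  have := FC (p i) (p i.+1).
  have -> : p i.+1 - p i = d by rewrite /p -natr1; ring.
  apply.
  - by rewrite lerDl mulr_ge0.
  - by rewrite lerD2l ler_wpM2r// ler_nat.
  - by rewrite /p -lerBrDl -dE mulrC ler_wpM2l// ler_nat.
apply/eqP; rewrite eq_sym -subr_eq0 -normr_eq0; apply/eqP/le_anti/andP; split => //.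
have := @cvgMl_tmp _ _ _ eventually_filter harmonic (C * (y - x) ^+ 2) 0 (@cvg_harmonic R); rewrite mulr0 => h.
rewrite -(cvg_lim (@Rhausdorff R) h); apply: limr_ge; first by apply/cvg_ex; eexists; exact: h.
near=> n; exact: FCn.
Unshelve. all: by end_near. Qed.

Lemma Rintegral_cst_itv {R : realType} (c u v : R) : u <= v ->
  \int[lebesgue_measure]_(x in `[u, v]) c = c * (v - u).
Proof.
move=> uv; rewrite /Rintegral integral_cst//= lebesgue_measure_itv/= lte_fin.
case: ltP => // vu.
have -> : u = v by apply/le_anti/andP; split.
by rewrite subrr mule0 mulr0.
Qed.

Lemma Rintegral_itv_near_cst {R : realType} (f : R -> R) (c L u v : R) : u <= v ->
  lebesgue_measure.-integrable `[u, v] (EFin \o f) ->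
  (forall r, u <= r -> r <= v -> `|f r - c| <= L) ->
  `|\int[lebesgue_measure]_(x in `[u, v]) f x - c * (v - u)| <= L * (v - u).
Proof.
move=> uv intf fL.
have intc (k : R) : lebesgue_measure.-integrable `[u, v] (EFin \o (fun=> k)).
  apply: continuous_compact_integrable; first exact: segment_compact.
  by apply: continuous_subspaceT => x; exact: cvg_cst.
rewrite ler_distl; apply/andP; split.
- rewrite -mulrBl -Rintegral_cst_itv//; apply: le_Rintegral => //= x.
  rewrite in_itv/= => /andP[ux xv]; have := fL _ ux xv.
  by rewrite ler_distl => /andP[].
- rewrite -mulrDl -Rintegral_cst_itv//; apply: le_Rintegral => //= x.
  rewrite in_itv/= => /andP[ux xv]; have := fL _ ux xv.
  by rewrite ler_distl => /andP[].
Qed.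

Lemma Rintegral_itv_split {R : realType} (f : R -> R) (a x b : R) : a <= x -> x <= b ->
  lebesgue_measure.-integrable `[a, b] (EFin \o f) ->
  \int[lebesgue_measure]_(t in `[a, b]) f t - \int[lebesgue_measure]_(t in `[a, x]) f t =
  \int[lebesgue_measure]_(t in `[x, b]) f t.
Proof.
move=> ax xb intf; rewrite Rintegral_itvB ?bnd_simp//.
apply: Rintegral_itv_obnd_cbnd; apply: integrableS intf => //=.
by apply: subset_itvr; rewrite bnd_simp.
Qed.

(** The form in which pathwise integrals are estimated: an increment against a frozen value of the
    integrand. As [int0] starts from 0, integrability is asked on the hull of [u], [v] and 0. *)
Lemma int0_increment {R : realType} (f : R -> R) (c L u v : R) : u <= v ->
  lebesgue_measure.-integrable `[Num.min u 0, Num.max v 0] (EFin \o f) ->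
  (forall r, u <= r -> r <= v -> `|f r - c| <= L) ->
  `|int0 f v - int0 f u - c * (v - u)| <= L * (v - u).
Proof.
move=> uv intf fL.
have sub p q : Num.min u 0 <= p -> q <= Num.max v 0 ->
    lebesgue_measure.-integrable `[p, q] (EFin \o f).
  move=> h1 h2; apply: integrableS intf => //= x; rewrite /= !in_itv/= => /andP[h3 h4].
  by rewrite (le_trans h1)//= (le_trans h4).
have -> : int0 f v - int0 f u = \int[lebesgue_measure]_(t in `[u, v]) f t.
  rewrite /int0; have [u0|u0] := leP 0 u.
    rewrite (le_trans u0 uv) Rintegral_itv_split//; apply: sub.
      by rewrite ge_min lexx orbT.
    by rewrite le_max lexx.
  have [v0|v0] := leP 0 v.
    rewrite opprK addrC -(@Rintegral_itv_split _ f u 0 v) ?(ltW u0)//.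
      by ring.
    apply: sub; first by rewrite ge_min lexx.
    by rewrite le_max lexx.
  rewrite opprK addrC -(@Rintegral_itv_split _ f u v 0) ?(ltW v0)//.
    by ring.
  apply: sub; first by rewrite ge_min lexx.
  by rewrite le_max lexx orbT.
apply: Rintegral_itv_near_cst => //; apply: sub; rewrite ?ge_min ?le_max ?lexx//.
Qed.

Lemma int0_increment_continuous {R : realType} (f : R -> R) (c L u v : R) :
  continuous f -> u <= v ->
  (forall r, u <= r -> r <= v -> `|f r - c| <= L) ->
  `|int0 f v - int0 f u - c * (v - u)| <= L * (v - u).
Proof.
move=> cf uv; apply: int0_increment => //.
apply: continuous_compact_integrable; first exact: segment_compact.
exact: continuous_subspaceT.
Qed.

Lemma int0_increment01 {R : realType} (f : R -> R) (c L u v : R) :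
  {within `[0, 1], continuous f} -> 0 <= u -> u <= v -> v <= 1 ->
  (forall r, u <= r -> r <= v -> `|f r - c| <= L) ->
  `|int0 f v - int0 f u - c * (v - u)| <= L * (v - u).
Proof.
move=> cf u0 uv v1; apply: int0_increment => //.
have: lebesgue_measure.-integrable `[0, 1] (EFin \o f).
  by apply: continuous_compact_integrable => //; exact: segment_compact.
rewrite min_r// max_l ?(le_trans u0)//; apply: integrableS => //= x.
by rewrite /= !in_itv/= => /andP[-> xv]; rewrite (le_trans xv).
Qed.

Lemma int00 {R : realType} (f : R -> R) : int0 f 0 = 0.
Proof. by rewrite /int0 lexx set_itv1 Rintegral_set1. Qed.

(** By the mean value theorem a bound of order [n] on the derivative becomes one of order [n + 1] on
    the function. The ball around [a] serves both orders of [a] and [y]. Successive applications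
    produce Taylor remainders. *)
Lemma increment_le_pow {R : realType} (f df : R -> R) (C a y : R) (n : nat) :
  (forall x : R, is_derive x 1 f (df x)) ->
  (forall x, `|x - a| <= `|y - a| -> `|df x| <= C * `|x - a| ^+ n) -> 0 <= C ->
  `|f y - f a| <= C * `|y - a| ^+ n.+1.
Proof.
move=> fdf dfC C0.
have cf : continuous f.
  by move=> x; apply: differentiable_continuous; apply/derivable1_diffP; have [] := fdf x.
have main c : `|c - a| <= `|y - a| -> `|df c| * `|y - a| <= C * `|y - a| ^+ n.+1.
  move=> ca; rewrite exprSr mulrA ler_wpM2r//; apply: le_trans (dfC _ ca) _.
  by rewrite ler_wpM2l// lerXn2r ?nnegrE.
have [ay|ya] := leP a y.
- have [c] := @MVT_segment _ f df a y ay (fun x _ => fdf x) (continuous_subspaceT cf).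
  rewrite in_itv/= => /andP[ac cy] ->; rewrite normrM; apply: main.
  by rewrite !ger0_norm ?subr_ge0 // lerD2r.
- have [c] := @MVT_segment _ f df y a (ltW ya) (fun x _ => fdf x) (continuous_subspaceT cf).
  rewrite in_itv/= => /andP[yc ca]; rewrite distrC => ->.
  rewrite normrM (distrC a); apply: main.
  by rewrite !ler0_norm ?subr_le0 ?(ltW ya)// lerN2 lerD2r.
Qed.

(** Functions are mostly controlled through quadratic remainders; this recovers a derivative from
    one, in particular for the antiderivative [S]. *)
Lemma is_derive_quadratic {R : realType} (f : R -> R) (x l C : R) :
  (forall y, `|f y - f x - l * (y - x)| <= C * (y - x) ^+ 2) -> is_derive x 1 f l.
Proof.
move=> fC.
have C0 : 0 <= C.
  have := fC (x + 1); have -> : x + 1 - x = 1 by ring.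
  by rewrite expr1n [C * 1]mulr1; exact: le_trans.
have h : (fun h : R => h^-1 *: ((f \o shift x) (h *: (1:R)) - f x)) @ 0^' --> (l : R^o).
  apply/cvgrPdist_le => e e0.
  near=> h0.
  have hn0 : h0 != 0 by near: h0; exact: nbhs_dnbhs_neq.
  have hs : `|h0| <= e / (C + 1).
    near: h0; apply: dnbhs0_le; rewrite divr_gt0// ltr_pwDr//.
  rewrite /= /GRing.scale/= mulr1.
  have := fC (h0 + x); rewrite addrK => H1.
  have -> : l - h0^-1 * (f (h0 + x) - f x) = - (h0^-1 * (f (h0 + x) - f x - l * h0)).
    by field.
  rewrite normrN normrM normfV ler_pdivrMl ?normr_gt0//.
  apply: le_trans H1 _; rewrite -real_normK ?num_real// expr2 mulrCA ler_wpM2l//.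
  rewrite ler_pdivlMr in hs; last by rewrite ltr_pwDr.
  by apply: le_trans hs; rewrite mulrC ler_wpM2l// lerDl.
apply: DeriveDef; first by apply/cvg_ex; exists l; exact: h.
by apply: (cvg_lim (@Rhausdorff R)); exact: h.
Unshelve. all: by end_near. Qed.

Ltac nonneg := do ?[by [] | exact: sqr_ge0 | exact: ltW | apply: mulr_ge0 | apply: addr_ge0
  | apply: exprn_ge0 | rewrite invr_ge0].

(** * Taylor bounds and the Lamperti coordinate *)

Definition C2_bounds {R : realType} (f : R -> R) (M : R) : Prop :=
  [/\ forall x, `|f x| <= M,
      forall x, `|derive1 f x| <= M,
      forall x y, `|f y - f x| <= M * `|y - x|,
      forall x y, `|derive1 f y - derive1 f x| <= M * `|y - x| &
      forall x y, `|f y - f x - derive1 f x * (y - x)| <= M * (y - x) ^+ 2].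

(** The bounds are given for all large constants so that [b] and [sigma] can share one. *)
Lemma Cinf_bdd_C2_bounds {R : realType} (f : R -> R) :
  Cinf_bdd f -> exists2 M0, 1 <= M0 & forall M, M0 <= M -> C2_bounds f M.
Proof.
move=> ff; have [d0 [M0 fM0]] := ff 0; have [d1 [M1 fM1]] := ff 1; have [d2 [M2 fM2]] := ff 2.
move: d0 d1 d2 fM0 fM1 fM2; rewrite !derive1nS/= => d0 d1 d2 fM0 fM1 fM2.
have fd : forall x : R, is_derive x 1 f (derive1 f x).
  by move=> x; rewrite derive1E; apply: DeriveDef.
have fd1 : forall x : R, is_derive x 1 (derive1 f) (derive1 (derive1 f) x).
  by move=> x; rewrite [X in is_derive _ _ _ X]derive1E; apply: DeriveDef.
have p0 : 0 <= M0 by apply: le_trans (fM0 0).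
have p1 : 0 <= M1 by apply: le_trans (fM1 0).
have p2 : 0 <= M2 by apply: le_trans (fM2 0).
exists (1 + M0 + M1 + M2); first by rewrite -!addrA lerDl !addr_ge0.
move=> M hM.
have h0 : M0 <= M by lra.
have h1 : M1 <= M by lra.
have h2 : M2 <= M by lra.
have l1 x y : `|derive1 f y - derive1 f x| <= M * `|y - x|.
  rewrite -[`|y - x|]expr1; apply: increment_le_pow fd1 _ _; last by lra.
  by move=> r _; rewrite expr0 mulr1; apply: le_trans (fM2 _) _.
split => //.
- by move=> x; exact: le_trans (fM0 x) _.
- by move=> x; exact: le_trans (fM1 x) _.
- move=> x y; rewrite -[`|y - x|]expr1; apply: increment_le_pow fd _ _; last by lra.
  by move=> r _; rewrite expr0 mulr1; apply: le_trans (fM1 _) _.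
- move=> x y; rewrite -real_normK ?num_real//.
  have -> : f y - f x - derive1 f x * (y - x) =
    (fun t => f t - derive1 f x * t) y - (fun t => f t - derive1 f x * t) x by rewrite /=; ring.
  apply: (@increment_le_pow _ (fun t => f t - derive1 f x * t)
    (fun t => derive1 f t - derive1 f x) _ _ _ 1); last by lra.
    move=> t; apply: is_deriveB => //.
    by rewrite -[X in is_derive _ _ _ X]mulr1; apply: is_deriveZ.
  by move=> t _; rewrite expr1.
Qed.

Lemma normM_le {R : realType} (a b A B : R) : `|a| <= A -> `|b| <= B -> `|a * b| <= A * B.
Proof. by move=> aA bB; rewrite normrM ler_pM. Qed.

(** Over the denominator [g x * g x * g y], which is at least [s ^+ 3], the numerator combines the
    Taylor remainders of [f] and [g] with one product of two increments. Their weights 1, 1 and 2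
    give the factor 4. *)
Lemma quotient_taylor {R : realType} (f g : R -> R) (M s : R) : 0 < s ->
  C2_bounds f M -> C2_bounds g M -> (forall x, s <= g x) -> forall x y,
  `|f y / g y - f x / g x
    - (derive1 f x * g x - f x * derive1 g x) / g x ^+ 2 * (y - x)|
  <= 4 * M ^+ 3 / s ^+ 3 * (y - x) ^+ 2.
Proof.
move=> s0 [f0 f1 fl _ ft] [g0 g1 gl _ gt] gs x y.
have gp z : 0 < g z := lt_le_trans s0 (gs z).
have M0 : 0 <= M := le_trans (normr_ge0 _) (f0 x).
have -> : f y / g y - f x / g x
    - (derive1 f x * g x - f x * derive1 g x) / g x ^+ 2 * (y - x) =
  (g x * g x * (f y - f x - derive1 f x * (y - x))
   - f x * g x * (g y - g x - derive1 g x * (y - x))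
   - (derive1 f x * g x - f x * derive1 g x) * (y - x) * (g y - g x))
   / (g x * g x * g y).
  by have := gp x; have := gp y => /gt_eqF/negbT h1 /gt_eqF/negbT h2; field; rewrite h1.
have -> : 4 * M ^+ 3 / s ^+ 3 * (y - x) ^+ 2 =
  (4 * M ^+ 3 * (y - x) ^+ 2) / s ^+ 3 by rewrite mulrAC.
apply: normM_le; last first.
  have gg : 0 < g x * g x * g y by rewrite !mulr_gt0.
  rewrite gtr0_norm ?invr_gt0// lef_pV2 ?posrE ?exprn_gt0//.
  by rewrite !exprS expr0 mulr1 mulrA !ler_pM ?mulr_ge0// ltW.
have -> : 4 * M ^+ 3 * (y - x) ^+ 2 =
  M * M * (M * (y - x) ^+ 2) + M * M * (M * (y - x) ^+ 2)
  + (M * M + M * M) * `|y - x| * (M * `|y - x|).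
  by rewrite -(real_normK (num_real (y - x))); ring.
apply: le_trans (ler_normB _ _) _; apply: lerD.
  by apply: le_trans (ler_normB _ _) _; apply: lerD; rewrite !normM_le.
rewrite !normM_le//; apply: le_trans (ler_normB _ _) _.
by apply: lerD; rewrite normM_le.
Qed.

(** With a constant numerator the quotient expansion covers [1 / sigma]. *)
Lemma C2_bounds_cst1 {R : realType} (M : R) : 1 <= M -> C2_bounds (fun=> 1 : R) M.
Proof.
move=> M1; have M0 : 0 <= M by apply: le_trans M1.
have d x : derive1 (fun=> 1 : R) x = 0 by rewrite derive1_cst.
by split => *; rewrite ?d ?normr1 ?subrr ?mul0r ?subr0 ?normr0//; apply: mulr_ge0 => //; exact: sqr_ge0.
Qed.

Lemma lipschitzM {R : realType} (F G : R -> R) (A B a b x y d : R) :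
  `|F y| <= A -> `|G x| <= B -> `|F y - F x| <= a * d -> `|G y - G x| <= b * d ->
  `|F y * G y - F x * G x| <= (A * b + a * B) * d.
Proof.
move=> FA GB Fa Gb.
have -> : F y * G y - F x * G x = F y * (G y - G x) + (F y - F x) * G x by ring.
have -> : (A * b + a * B) * d = A * (b * d) + (a * d) * B by ring.
by apply: le_trans (ler_normD _ _) _; apply: lerD; apply: normM_le.
Qed.

(* S is an antiderivative of 1 / sigma, and one constant C serves for all bounds. *)
Record lamperti {R : realType} (b sigma S : R -> R) (C : R) : Prop := Lamperti {
  lamp_C1 : 1 <= C ;
  lamp_sigma_gt0 : forall x, 0 < sigma x ;
  lamp_sigma_le : forall x, sigma x <= C ;
  lamp_sigmaV_le : forall x, (sigma x)^-1 <= C ;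
  lamp_b_le : forall x, `|b x| <= C ;
  lamp_sigma'_le : forall x, `|derive1 sigma x| <= C ;
  lamp_drift_le : forall x, `|b x / sigma x| <= C ;
  lamp_wronskian_le : forall x, `|wronskian b sigma x / sigma x| <= C ;
  lamp_le : forall x y, `|S y - S x| <= C * `|y - x| ;
  lamp_ge : forall x y, `|y - x| <= C * `|S y - S x| ;
  lamp_sigma_lip : forall x y, `|sigma y - sigma x| <= C * `|S y - S x| ;
  lamp_sigma'_lip : forall x y, `|derive1 sigma y - derive1 sigma x| <= C * `|S y - S x| ;
  lamp_drift_lip : forall x y, `|b y / sigma y - b x / sigma x| <= C * `|S y - S x| ;
  lamp_wronskian_lip : forall x y,
    `|wronskian b sigma y / sigma y - wronskian b sigma x / sigma x| <= C * `|S y - S x| ;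
  lamp_taylor3 : forall x y,
    `|S y - S x - (y - x) / sigma x + derive1 sigma x / (2 * sigma x ^+ 2) * (y - x) ^+ 2|
      <= C * `|y - x| ^+ 3 ;
  lamp_taylor2 : forall x y, `|S y - S x - (y - x) / sigma x| <= C * (y - x) ^+ 2 ;
  lamp_inv_taylor2 : forall x y,
    `|y - x - sigma x * (S y - S x)| <= C * (S y - S x) ^+ 2 ;
  lamp_drift_taylor2 : forall x y,
    `|b y / sigma y - b x / sigma x - wronskian b sigma x / sigma x * (S y - S x)|
      <= C * (S y - S x) ^+ 2 ;
  lamp_ln_taylor2 : forall x y,
    `|ln (sigma y) - ln (sigma x) - derive1 sigma x * (S y - S x)| <= C * (S y - S x) ^+ 2
}.

(** The tangent inequality [ln q - ln p <= (q - p) / p] is used in both directions. The remainder is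
    nonpositive, and the two tangent terms add up to [(v - u) ^+ 2 / (u * v)], which bounds its
    size. *)
Lemma ln_taylor2 {R : realType} (s u v : R) : 0 < s -> s <= u -> s <= v ->
  `|ln v - ln u - (v - u) / u| <= s ^- 2 * (v - u) ^+ 2.
Proof.
move=> s0 su sv; have u0 := lt_le_trans s0 su; have v0 := lt_le_trans s0 sv.
have key (p q : R) : 0 < p -> 0 < q -> ln q - ln p <= (q - p) / p.
  move=> p0 q0; rewrite -ln_div ?posrE//.
  have -> : q / p = 1 + (q - p) / p by rewrite mulrBl divff ?gt_eqF//; ring.
  apply: le_ln1Dx; rewrite mulrBl divff ?gt_eqF// ltrBrDr addrC subrr divr_gt0//.
have h1 := key u v u0 v0; have h2 := key v u v0 u0.
rewrite ler0_norm ?subr_le0//.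
have h3 : - (ln v - ln u - (v - u) / u) <= (v - u) ^+ 2 / (u * v).
  have -> : (v - u) ^+ 2 / (u * v) = (v - u) / u + (u - v) / v.
    by field; rewrite !gt_eqF.
  by lra.
apply: le_trans h3 _; rewrite mulrC ler_wpM2r ?sqr_ge0// lef_pV2 ?posrE ?exprn_gt0 ?mulr_gt0//.
by rewrite expr2 ler_pM// ltW.
Qed.

Lemma mem_le_sum {R : realType} (s : seq R) (a : R) :
  (forall c, c \in s -> 0 <= c) -> a \in s -> a <= \sum_(c <- s) c.
Proof.
elim: s => // c s IH s0; rewrite inE big_cons => /orP[/eqP->|/IH h].
  by rewrite lerDl big_seq; apply: sumr_ge0 => i si; rewrite s0// inE si orbT.
rewrite (le_trans (h _))// => [i si|]; first by rewrite s0// inE si orbT.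
by rewrite lerDr s0// inE eqxx.
Qed.

Lemma lamperti_exists {R : realType} (b sigma : R -> R) :
  Cinf_bdd b -> Cinf_bdd sigma -> 0 < inf (range sigma) ->
  exists S C, lamperti b sigma S C.
Proof.
move=> cb cs s0; set s := inf (range sigma) in s0.
have [Mb Mb1 hb] := Cinf_bdd_C2_bounds cb.
have [Ms Ms1 hs] := Cinf_bdd_C2_bounds cs.
pose M := Num.max Mb Ms.
have M1 : 1 <= M by rewrite le_max Mb1.
have hbM : C2_bounds b M by apply: hb; rewrite le_max lexx.
have hsM : C2_bounds sigma M by apply: hs; rewrite le_max lexx orbT.
have h1M := C2_bounds_cst1 M1.
have [b0 b1 bl b1l bt] := hbM; have [g0 g1 gl g1l gt] := hsM.
(* [inf] is a lower bound because the range is bounded below, here by [- M]. *)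
have ssig x : s <= sigma x.
  apply: ge_inf; last by exists x.
  exists (- M) => _ [z _ <-]; have := g0 z; rewrite ler_norml => /andP[]//.
have sp x : 0 < sigma x := lt_le_trans s0 (ssig x).
have M0 : 0 <= M by apply: le_trans M1.
have si0 : 0 < s^-1 by rewrite invr_gt0.
have sigVle x : (sigma x)^-1 <= s^-1 by rewrite lef_pV2 ?posrE.
have sigVn x : `|(sigma x)^-1| <= s^-1 by rewrite gtr0_norm ?invr_gt0.
pose S := int0 (fun x => (sigma x)^-1).
have sVl x y : `|(sigma y)^-1 - (sigma x)^-1| <= s^-1 * s^-1 * M * `|y - x|.
  have -> : (sigma y)^-1 - (sigma x)^-1 = (sigma y)^-1 * (sigma x)^-1 * (- (sigma y - sigma x)).
    by field; rewrite !gt_eqF.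
  rewrite -[X in _ <= X]mulrA; apply: normM_le; first exact: normM_le.
  by rewrite normrN.
have cV : continuous (fun x => (sigma x)^-1).
  move=> x; apply: cvgV; first by rewrite gt_eqF.
  apply: differentiable_continuous; apply/derivable1_diffP; have [] := cs 0; exact.
pose K1 := s^-1 * s^-1 * M.
have K10 : 0 <= K1 by rewrite !mulr_ge0// ltW.
have S2 x y : `|S y - S x - (y - x) / sigma x| <= K1 * (y - x) ^+ 2.
  have [xy|yx] := leP x y.
    rewrite mulrC; apply: le_trans (@int0_increment_continuous _ _ _ (K1 * (y - x)) _ _ cV xy _) _.
      move=> r xr ry; apply: le_trans (sVl _ _) _.
      by rewrite ler_wpM2l// ger0_norm ?subr_ge0// lerD2r.
    by rewrite expr2 mulrA.
  have := @int0_increment_continuous _ _ (sigma x)^-1 (K1 * (x - y)) _ _ cV (ltW yx).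
  have -> : K1 * (x - y) * (x - y) = K1 * (y - x) ^+ 2 by ring.
  have -> : int0 (fun x => (sigma x)^-1) x - int0 (fun x => (sigma x)^-1) y -
    (sigma x)^-1 * (x - y) = - (S y - S x - (y - x) / sigma x) by rewrite /S; ring.
  rewrite normrN; apply => r yr rx; apply: le_trans (sVl _ _) _.
  by rewrite ler_wpM2l// ler0_norm ?subr_le0// opprB lerD2l lerN2.
have dS (x : R) : is_derive x 1 S (sigma x)^-1.
  by apply: (@is_derive_quadratic _ _ _ _ K1) => y; rewrite mulrC; exact: S2.
have Sle x y : `|S y - S x| <= s^-1 * `|y - x|.
  rewrite -[`|y - x|]expr1; apply: increment_le_pow dS _ (ltW si0).
  by move=> z _; rewrite expr0 mulr1.
(* The derivative [1 / sigma] of [S] is at least [1 / M]. *)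
have Sge x y : `|y - x| <= M * `|S y - S x|.
  have cS : continuous S.
    by move=> z; apply: differentiable_continuous; apply/derivable1_diffP; have [] := dS z.
  have main p q : p <= q -> `|q - p| <= M * `|S q - S p|.
    move=> pq.
    have [c _ ->] := @MVT_segment _ S _ p q pq (fun x _ => dS x) (continuous_subspaceT cS).
    rewrite normrM mulrA ler_peMl// gtr0_norm ?invr_gt0// ler_pdivlMr// mul1r.
    by apply: le_trans (g0 c); exact: ler_norm.
  have [|/ltW] := leP x y; first exact: main.
  by rewrite distrC (distrC (S y)); exact: main.
have Sge2 x y : (y - x) ^+ 2 <= M ^+ 2 * (S y - S x) ^+ 2.
  rewrite -!(real_normK (num_real (_ - _))) -exprMn lerXn2r ?nnegrE ?mulr_ge0//.
have lipS F K : 0 <= K -> (forall x y, `|F y - F x| <= K * `|y - x|) ->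
    forall x y : R, `|F y - F x : R| <= K * M * `|S y - S x|.
  move=> K0 FK x y; apply: le_trans (FK _ _) _.
  by rewrite -mulrA ler_wpM2l.
pose K2 := 4 * M ^+ 3 / s ^+ 3.
have K20 : 0 <= K2 by rewrite divr_ge0 ?mulr_ge0 ?exprn_ge0// ltW.
have S3 x y : `|S y - S x - (y - x) / sigma x
    + derive1 sigma x / (2 * sigma x ^+ 2) * (y - x) ^+ 2| <= K2 * `|y - x| ^+ 3.
  (* Up to a constant, [F] is [S] less its quadratic Taylor polynomial at [x]. Its derivative [dF]
     is the second-order remainder of [1 / sigma], so one order is gained. *)
  pose F z := S z - z / sigma x + derive1 sigma x / (2 * sigma x ^+ 2) * (z - x) ^+ 2.
  pose dF z := (sigma z)^-1 - (sigma x)^-1 + derive1 sigma x / (sigma x ^+ 2) * (z - x).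
  have -> : S y - S x - (y - x) / sigma x
    + derive1 sigma x / (2 * sigma x ^+ 2) * (y - x) ^+ 2 = F y - F x by rewrite /F; ring.
  apply: (@increment_le_pow _ F dF) => //.
    move=> z; rewrite /F /dF; apply: is_deriveD.
      apply: is_deriveB.
      apply: (@is_derive_quadratic _ _ _ _ 0) => t /=.
      have -> : t / sigma x - z / sigma x - (sigma x)^-1 * (t - z) = 0 by ring.
      by rewrite normr0 mul0r.
    apply: (@is_derive_quadratic _ _ _ _ `|derive1 sigma x / (2 * sigma x ^+ 2)|) => t /=.
    rewrite -[X in _ <= _ * X](ger0_norm (sqr_ge0 (t - z))) -normrM.
    rewrite le_eqVlt; apply/orP; left; apply/eqP; congr (`| _ |); field.
    by rewrite gt_eqF.
  move=> z _; have := quotient_taylor s0 h1M hsM ssig x z.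
  rewrite !div1r derive1_cst mul0r sub0r mul1r -(real_normK (num_real (z - x))) /dF.
  by rewrite mulNr mulNr opprK.
have c_t x y := quotient_taylor s0 hbM hsM ssig x y.
pose q x := wronskian b sigma x / sigma x.
pose KB := M * M + M * M.
have w0 x : `|wronskian b sigma x| <= KB.
  by apply: le_trans (ler_normB _ _) _; apply: lerD; apply: normM_le.
have q0 x : `|q x| <= KB * s^-1 by apply: normM_le.
have KB0 : 0 <= KB by rewrite addr_ge0 ?mulr_ge0.
have blip x y : `|b y / sigma y - b x / sigma x| <= (M * (s^-1 * s^-1 * M) + M * s^-1) * `|y - x|.
  exact: (@lipschitzM _ b (fun x => (sigma x)^-1)).
have wlip x y : `|wronskian b sigma y - wronskian b sigma x| <= 4 * (M * M) * `|y - x|.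
  have -> : wronskian b sigma y - wronskian b sigma x =
     (sigma y * derive1 b y - sigma x * derive1 b x) -
     (derive1 sigma y * b y - derive1 sigma x * b x) by rewrite /wronskian; ring.
  have -> : 4 * (M * M) * `|y - x| =
    (M * M + M * M) * `|y - x| + (M * M + M * M) * `|y - x| by ring.
  by apply: le_trans (ler_normB _ _) _; apply: lerD;
    [exact: (@lipschitzM _ sigma (derive1 b)) | exact: (@lipschitzM _ (derive1 sigma) b)].
have qlip x y : `|q y - q x| <= (KB * (s^-1 * s^-1 * M) + 4 * (M * M) * s^-1) * `|y - x|.
  exact: (@lipschitzM _ (wronskian b sigma) (fun x => (sigma x)^-1)).
pose C4 := M * (K1 * M ^+ 2).
have C40 : 0 <= C4 by rewrite /C4; nonneg.
(* The second-order expansion of [S] multiplied by [- sigma x], with [(y - x)^2] replaced by a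
   multiple of [(S y - S x)^2]. *)
have inv2 x y : `|y - x - sigma x * (S y - S x)| <= C4 * (S y - S x) ^+ 2.
  have -> : y - x - sigma x * (S y - S x) = - (sigma x * (S y - S x - (y - x) / sigma x)).
    by field; rewrite gt_eqF.
  rewrite normrN -mulrA; apply: normM_le => //; apply: le_trans (S2 _ _) _.
  by rewrite -[X in _ <= X]mulrA ler_wpM2l.
pose C5 := K2 * M ^+ 2 + KB * s^-1 * (K1 * M ^+ 2).
have C50 : 0 <= C5 by rewrite /C5; nonneg.
(* Differentiation with respect to [S] brings a factor [sigma]: the derivative of [b / sigma] times
   [sigma] is the Wronskian over [sigma]. *)
have dt2 x y : `|b y / sigma y - b x / sigma x - q x * (S y - S x)| <= C5 * (S y - S x) ^+ 2.
  have -> : b y / sigma y - b x / sigma x - q x * (S y - S x) =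
    (b y / sigma y - b x / sigma x
    - (derive1 b x * sigma x - b x * derive1 sigma x) / sigma x ^+ 2 * (y - x))
     - q x * (S y - S x - (y - x) / sigma x).
    by rewrite /q /wronskian; field; rewrite !gt_eqF.
  rewrite [X in _ <= X]mulrDl; apply: le_trans (ler_normB _ _) _; apply: lerD.
    by apply: le_trans (c_t _ _) _; rewrite -[X in _ <= X]mulrA ler_wpM2l.
  rewrite -[X in _ <= X]mulrA; apply: normM_le => //; apply: le_trans (S2 _ _) _.
  by rewrite -[X in _ <= X]mulrA ler_wpM2l.
pose C6 := s ^- 2 * (M * M) ^+ 2 + s^-1 * (M * M ^+ 2) + M * s^-1 * C4.
have C60 : 0 <= C6 by rewrite /C6; nonneg.
have ln2 x y : `|ln (sigma y) - ln (sigma x) - derive1 sigma x * (S y - S x)|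
    <= C6 * (S y - S x) ^+ 2.
  have -> : ln (sigma y) - ln (sigma x) - derive1 sigma x * (S y - S x) =
    (ln (sigma y) - ln (sigma x) - (sigma y - sigma x) / sigma x)
    + (sigma x)^-1 * (sigma y - sigma x - derive1 sigma x * (y - x))
    + derive1 sigma x * (sigma x)^-1 * (y - x - sigma x * (S y - S x)).
    by field; rewrite gt_eqF.
  rewrite [X in _ <= X]mulrDl; apply: le_trans (ler_normD _ _) _; apply: lerD.
    rewrite [X in _ <= X]mulrDl; apply: le_trans (ler_normD _ _) _; apply: lerD.
      apply: le_trans (ln_taylor2 s0 (ssig _) (ssig _)) _.
      rewrite -[X in _ <= X]mulrA ler_wpM2l ?invr_ge0 ?exprn_ge0 ?(ltW s0)//.
      rewrite -!(real_normK (num_real (_ - _))) -exprMn lerXn2r ?nnegrE ?mulr_ge0//.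
      exact: lipS.
    rewrite -mulrA; apply: normM_le => //; apply: le_trans (gt _ _) _.
    by rewrite -[X in _ <= X]mulrA ler_wpM2l.
  by rewrite -[X in _ <= X]mulrA; apply: normM_le => //; exact: normM_le.
(* The constants of all the estimates. [C] is their sum, and the entry 1 ensures [1 <= C]. *)
pose L := [:: 1; M; s^-1; M * s^-1; KB * s^-1; M * M;
  (M * (s^-1 * s^-1 * M) + M * s^-1) * M;
  (KB * (s^-1 * s^-1 * M) + 4 * (M * M) * s^-1) * M; K1; K2; C4; C5; C6].
pose C := \sum_(c <- L) c.
have LC c : c \in L -> c <= C.
  apply: mem_le_sum => {}c; rewrite !inE.
  by do ![case/orP]; move/eqP->; nonneg.
have CC a c z : 0 <= c -> a \in L -> z <= a * c -> z <= C * c :> R.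
  by move=> c0 aL /le_trans; apply; rewrite ler_wpM2r// LC.
have bnd (z a : R) : z <= a -> a \in L -> z <= C by move=> za /LC; exact: le_trans.
exists S, C; split.
- by apply: LC; rewrite !inE eqxx.
- by [].
- by move=> x; apply: (bnd _ M); [exact: le_trans (ler_norm _) (g0 x) | rewrite !inE eqxx ?orbT].
- by move=> x; apply: (bnd _ s^-1); [exact: sigVle | rewrite !inE eqxx ?orbT].
- by move=> x; apply: (bnd _ M); [exact: b0 | rewrite !inE eqxx ?orbT].
- by move=> x; apply: (bnd _ M); [exact: g1 | rewrite !inE eqxx ?orbT].
- by move=> x; apply: (bnd _ (M * s^-1)); [exact: normM_le | rewrite !inE eqxx ?orbT].
- by move=> x; apply: (bnd _ (KB * s^-1)); [exact: normM_le | rewrite !inE eqxx ?orbT].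
- by move=> x y; apply: (CC s^-1); [exact: normr_ge0 | rewrite !inE eqxx ?orbT | exact: Sle].
- by move=> x y; apply: (CC M); [exact: normr_ge0 | rewrite !inE eqxx ?orbT | exact: Sge].
- by move=> x y; apply: (CC (M * M)); [exact: normr_ge0 | rewrite !inE eqxx ?orbT | exact: lipS].
- by move=> x y; apply: (CC (M * M)); [exact: normr_ge0 | rewrite !inE eqxx ?orbT | exact: lipS].
- move=> x y; apply: (CC ((M * (s^-1 * s^-1 * M) + M * s^-1) * M));
    [exact: normr_ge0 | by rewrite !inE eqxx ?orbT |].
  by apply: (lipS (fun x => b x / sigma x)); [nonneg | exact: blip].
- move=> x y; apply: (CC ((KB * (s^-1 * s^-1 * M) + 4 * (M * M) * s^-1) * M));
    [exact: normr_ge0 | by rewrite !inE eqxx ?orbT |].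
  by apply: (lipS q); [nonneg | exact: qlip].
- by move=> x y; apply: (CC K2); [exact: exprn_ge0 | rewrite !inE eqxx ?orbT | exact: S3].
- by move=> x y; apply: (CC K1); [exact: sqr_ge0 | rewrite !inE eqxx ?orbT | exact: S2].
- by move=> x y; apply: (CC C4); [exact: sqr_ge0 | rewrite !inE eqxx ?orbT | exact: inv2].
- by move=> x y; apply: (CC C5); [exact: sqr_ge0 | rewrite !inE eqxx ?orbT | exact: dt2].
- by move=> x y; apply: (CC C6); [exact: sqr_ge0 | rewrite !inE eqxx ?orbT | exact: ln2].
Qed.

(** Functions of the path [x] get their continuity from that of [S (x t)], whose oscillation
    dominates theirs by the Lipschitz bounds in [lamperti]. *)
Lemma within_continuous_dominated {R : realType} (A : set R) (f g : R -> R) (C : R) :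
  {within A, continuous g} ->
  (forall u v, A u -> A v -> `|f u - f v| <= C * `|g u - g v|) ->
  {within A, continuous f}.
Proof.
move=> /subspace_continuousP cg fg; apply/subspace_continuousP => x Ax.
apply/cvgrPdist_le => e e0.
have C0 : 0 < `|C| + 1 by rewrite ltr_wpDl.
have /cvgrPdist_le /(_ (e / (`|C| + 1))) := cg x Ax.
rewrite divr_gt0// => /(_ isT); rewrite !near_withinE; apply: filterS => t h At.
apply: le_trans (fg _ _ Ax At) _; have := h At; rewrite ler_pdivlMr// => h1.
apply: le_trans h1; rewrite mulrC ler_wpM2l//.
by apply: le_trans (ler_norm _) _; rewrite lerDl.
Qed.

Lemma continuous_dominated {R : realType} (f g : R -> R) (C : R) :
  continuous g -> (forall u v, `|f u - f v| <= C * `|g u - g v|) -> continuous f.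
Proof.
move=> cg fg; apply/continuous_subspace_setT.
apply: (within_continuous_dominated (g := g) (C := C)) => //.
exact: continuous_subspaceT.
Qed.

Lemma int0_lin01 {R : realType} (f h : R -> R) (s t : R) :
  {within `[0, 1], continuous f} -> {within `[0, 1], continuous h} -> 0 <= t -> t <= 1 ->
  int0 (fun r => s * f r - h r) t = s * int0 f t - int0 h t.
Proof.
move=> cf ch t0 t1; rewrite /int0 t0.
have int (k : R -> R) : {within `[0, 1], continuous k} ->
    lebesgue_measure.-integrable `[0, t] (EFin \o k).
  move=> ck; apply: continuous_compact_integrable; first exact: segment_compact.
  by apply: continuous_subspaceW ck; apply: subset_itvl; rewrite bnd_simp.
rewrite RintegralB//; last exact: int.
  by rewrite RintegralZl//; exact: int.
apply: int => x; apply: cvgMl_tmp; exact: cf.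
Qed.

(** * The pathwise solution in the Lamperti coordinate *)

Section flow.
Context {R : realType} (b sigma S : R -> R) (C : R) (L : lamperti b sigma S C).

Let C0 : 0 <= C := le_trans ler01 (lamp_C1 L).

(** Formally [S (phi beta)] has the derivative [sigma / sigma = 1] in [beta]; rigorously,
    [S (phi t) - t] has quadratic increments. *)
Lemma flow_lamperti (phi : R -> R) (alpha : R) : continuous phi ->
  (forall beta, phi beta = alpha + int0 (fun eta => sigma (phi eta)) beta) ->
  forall beta, S (phi beta) = S alpha + beta.
Proof.
move=> cphi phiE.
have csphi : continuous (fun eta => sigma (phi eta)).
  apply: (continuous_dominated cphi (C := C * C)) => u v.
  apply: le_trans (lamp_sigma_lip L _ _) _; rewrite -mulrA ler_wpM2l//.
  exact: (lamp_le L).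
have phiB u v : phi v - phi u = int0 (fun eta => sigma (phi eta)) v
    - int0 (fun eta => sigma (phi eta)) u by rewrite (phiE v) (phiE u); ring.
have philip u v : u <= v -> `|phi v - phi u| <= C * (v - u).
  move=> uv; have := int0_increment_continuous csphi uv (c := 0) (L := C).
  rewrite phiB mul0r subr0; apply => r _ _; rewrite subr0 gtr0_norm ?(lamp_sigma_gt0 L)//.
  exact: lamp_sigma_le L _.
have main x y : x <= y -> S (phi x) - x = S (phi y) - y.
  move=> xy; apply: (@eq_of_quadratic_increments _ (fun t => S (phi t) - t) _ _ (C * C ^+ 2 + C * (C * (C * C)))) => // u v _ uv _.
  have h1 := lamp_taylor2 L (phi u) (phi v).
  have h2 : `|phi v - phi u - sigma (phi u) * (v - u)| <= C * (C * (C * (v - u))) * (v - u).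
    rewrite phiB; apply: int0_increment_continuous => // r ur rv.
    apply: le_trans (lamp_sigma_lip L _ _) _; rewrite ler_wpM2l//.
    apply: le_trans (lamp_le L _ _) _; rewrite ler_wpM2l//.
    by apply: le_trans (philip _ _ ur) _; rewrite ler_wpM2l// lerD2r.
  have -> : S (phi v) - v - (S (phi u) - u) =
    (S (phi v) - S (phi u) - (phi v - phi u) / sigma (phi u)) +
    (sigma (phi u))^-1 * (phi v - phi u - sigma (phi u) * (v - u)).
    by field; rewrite gt_eqF// (lamp_sigma_gt0 L).
  rewrite [X in _ <= X]mulrDl; apply: le_trans (ler_normD _ _) _; apply: lerD.
    apply: le_trans h1 _; rewrite -mulrA ler_wpM2l// -(real_normK (num_real (phi v - _))) -exprMn.
    by rewrite lerXn2r ?nnegrE ?philip ?mulr_ge0 ?subr_ge0.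
  have -> : C * (C * (C * C)) * (v - u) ^+ 2 = C * (C * (C * (C * (v - u))) * (v - u)) by ring.
  apply: normM_le => //; rewrite gtr0_norm ?invr_gt0 ?(lamp_sigma_gt0 L)//.
  exact: lamp_sigmaV_le L _.
have phi0 : phi 0 = alpha by rewrite phiE int00 addr0.
move=> beta; have [b0|/ltW b0] := leP 0 beta.
  by have := main _ _ b0; rewrite phi0 => h; lra.
by have := main _ _ b0; rewrite phi0 => h; lra.
Qed.

(** Along the flow [ln sigma] has the derivative [sigma'], since the speed [sigma] cancels the
    denominator. The exponential in [f_sigma_b] is therefore
    [sigma alpha / sigma (phi alpha beta)]. *)
Lemma flow_ln_derivative (phi : R -> R) (alpha : R) : continuous phi ->
  (forall beta, phi beta = alpha + int0 (fun eta => sigma (phi eta)) beta) ->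
  forall beta, int0 (fun eta => derive1 sigma (phi eta)) beta = ln (sigma (phi beta)) - ln (sigma alpha).
Proof.
move=> cphi phiE; have SE := flow_lamperti cphi phiE.
have cs : continuous (fun eta => derive1 sigma (phi eta)).
  apply: (continuous_dominated cphi (C := C * C)) => u v.
  apply: le_trans (lamp_sigma'_lip L _ _) _; rewrite -mulrA ler_wpM2l//.
  exact: (lamp_le L).
have SB u v : S (phi v) - S (phi u) = v - u by rewrite !SE; ring.
pose F t := int0 (fun eta => derive1 sigma (phi eta)) t - ln (sigma (phi t)).
have main x y : x <= y -> F x = F y.
  move=> xy; apply: (@eq_of_quadratic_increments _ _ _ _ (C + C)) => // u v _ uv _.
  have h1 := lamp_ln_taylor2 L (phi u) (phi v).
  have h2 : `|int0 (fun eta => derive1 sigma (phi eta)) v - int0 (fun eta => derive1 sigma (phi eta)) u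
     - derive1 sigma (phi u) * (v - u)| <= C * (v - u) * (v - u).
    apply: int0_increment_continuous => // r ur rv.
    apply: le_trans (lamp_sigma'_lip L _ _) _; rewrite ler_wpM2l//.
    by rewrite SB ger0_norm ?subr_ge0// lerD2r.
  move: h1; rewrite SB => h1.
  have -> : F v - F u = (int0 (fun eta => derive1 sigma (phi eta)) v - int0 (fun eta => derive1 sigma (phi eta)) u
     - derive1 sigma (phi u) * (v - u)) - (ln (sigma (phi v)) - ln (sigma (phi u)) - derive1 sigma (phi u) * (v - u)).
    by rewrite /F; ring.
  rewrite [X in _ <= X]mulrDl; apply: le_trans (ler_normB _ _) _; apply: lerD => //.
  by rewrite expr2 mulrA.
have phi0 : phi 0 = alpha by rewrite phiE int00 addr0.
have F0 : F 0 = - ln (sigma alpha) by rewrite /F int00 phi0 sub0r.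
move=> beta; have [b0|/ltW b0] := leP 0 beta.
  by have := main _ _ b0; rewrite F0 /F => h; lra.
by have := main _ _ b0; rewrite F0 /F => h; lra.
Qed.

(** By the two facts on the flow, [a] moves with the speed [sigma (a)] times [(b / sigma) (x)].
    Hence [S (a)] moves with the speed [(b / sigma) (x)], and [S (x) = S (a) + g]. *)
Lemma sde_solution_lamperti (xi : R) (g x : R -> R) :
  {within `[0, 1], continuous g} -> g 0 = 0 -> sde_solution b sigma xi g x ->
  {within `[0, 1], continuous (fun t => S (x t))} /\
  forall t, 0 <= t -> t <= 1 ->
    S (x t) = S xi + int0 (fun u => b (x u) / sigma (x u)) t + g t.
Proof.
move=> cg g0 [phi [a [cphi phiE ca aE xE]]].
have SE al be : S (phi al be) = S al + be := flow_lamperti (cphi al) (phiE al) be.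
have fE al be : f_sigma_b sigma b phi al be = sigma al * (b (phi al be) / sigma (phi al be)).
  rewrite /f_sigma_b (flow_ln_derivative (cphi al) (phiE al)) opprB expRD expRN.
  rewrite !lnK ?posrE ?(lamp_sigma_gt0 L)//; ring.
have Sx t : `[0, 1]%classic t -> S (x t) = S (a t) + g t by move=> t01; rewrite xE// SE.
have cSa : {within `[0, 1], continuous (fun t => S (a t))}.
  by apply: (within_continuous_dominated ca (C := C)) => u v _ _; exact: (lamp_le L).
have csa : {within `[0, 1], continuous (fun t => sigma (a t))}.
  by apply: (within_continuous_dominated cSa (C := C)) => u v _ _; exact: (lamp_sigma_lip L).
have cSx : {within `[0, 1], continuous (fun t => S (x t))}.
  apply: (within_continuous_dominated (C := 1)
    (g := (fun t => S (a t) + g t))) => [t|u v u01 v01].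
    by apply: cvgD; [exact: cSa | exact: cg].
  by rewrite mul1r !Sx.
split=> //.
have cc : {within `[0, 1], continuous (fun t => b (x t) / sigma (x t))}.
  by apply: (within_continuous_dominated cSx (C := C)) => u v _ _; exact: (lamp_drift_lip L).
pose k u := sigma (a u) * (b (x u) / sigma (x u)).
have ck : {within `[0, 1], continuous k} by move=> t; apply: cvgM; [exact: csa | exact: cc].
have aE' t : 0 <= t -> t <= 1 -> a t = xi + int0 k t.
  move=> t0 t1; rewrite aE ?in_itv/= ?t0//; congr (_ + _).
  rewrite /int0 t0; apply: eq_Rintegral => u; rewrite inE/= in_itv/= => /andP[u0 ut].
  by rewrite fE /k xE// in_itv/= u0 (le_trans ut).
have kle u : `|k u| <= C * C.
  apply: normM_le; last exact: (lamp_drift_le L).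
  by rewrite gtr0_norm ?(lamp_sigma_gt0 L)// (lamp_sigma_le L).
have alip u v : 0 <= u -> u <= v -> v <= 1 -> `|a v - a u| <= C * C * (v - u).
  move=> u0 uv v1; have v0 := le_trans u0 uv; have u1 := le_trans uv v1.
  have -> : a v - a u = int0 k v - int0 k u by rewrite !aE'//; ring.
  have := int0_increment01 ck u0 uv v1 (c := 0) (L := C * C).
  by rewrite mul0r subr0; apply => r _ _; rewrite subr0.
pose F t := S (a t) - int0 (fun u => b (x u) / sigma (x u)) t.
have main t : 0 <= t -> t <= 1 -> F 0 = F t.
  move=> t0 t1; apply: (@eq_of_quadratic_increments _ _ _ _ (C * (C * C) ^+ 2 + C * (C * (C * (C * (C * C)))))) => //.
  move=> u v u0 uv vt; have v1 := le_trans vt t1.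
  have v0 := le_trans u0 uv; have u1 := le_trans uv v1.
  have h1 := lamp_taylor2 L (a u) (a v).
  pose G r := (sigma (a u))^-1 * k r - b (x r) / sigma (x r).
  have GE s : 0 <= s -> s <= 1 -> int0 G s = (sigma (a u))^-1 * int0 k s - int0 (fun u => b (x u) / sigma (x u)) s.
    by move=> s0 s1; apply: int0_lin01.
  have cG : {within `[0, 1], continuous G}.
    move=> s; apply: cvgB; last exact: cc.
    by apply: cvgMl_tmp; exact: ck.
  have h2 : `|int0 G v - int0 G u - 0 * (v - u)| <= C * (C * (C * (C * (C * C) * (v - u)))) * (v - u).
    apply: int0_increment01 => // r ur rv; rewrite subr0.
    have -> : G r = (sigma (a u))^-1 * (b (x r) / sigma (x r) * (sigma (a r) - sigma (a u))).
      by rewrite /G /k; field; rewrite !gt_eqF// (lamp_sigma_gt0 L).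
    apply: normM_le.
      by rewrite gtr0_norm ?invr_gt0 ?(lamp_sigma_gt0 L)// (lamp_sigmaV_le L).
    apply: normM_le; first exact: (lamp_drift_le L).
    apply: le_trans (lamp_sigma_lip L _ _) _; rewrite ler_wpM2l//.
    apply: le_trans (lamp_le L _ _) _; rewrite -mulrA ler_wpM2l//.
    apply: le_trans (alip _ _ u0 ur (le_trans rv v1)) _; rewrite ler_wpM2l ?mulr_ge0//.
    by rewrite lerD2r.
  have -> : F v - F u = (S (a v) - S (a u) - (a v - a u) / sigma (a u)) + (int0 G v - int0 G u - 0 * (v - u)).
    by rewrite /F !GE// !aE'//; ring.
  rewrite [X in _ <= X]mulrDl; apply: le_trans (ler_normD _ _) _; apply: lerD.
    apply: le_trans h1 _; rewrite -mulrA ler_wpM2l// -(real_normK (num_real (a v - _))) -exprMn.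
    by rewrite lerXn2r ?nnegrE ?alip ?mulr_ge0 ?subr_ge0.
  apply: le_trans h2 _; rewrite le_eqVlt; apply/orP; left; apply/eqP; ring.
move=> t t0 t1; have := main _ t0 t1.
have a0 : a 0 = xi by rewrite aE' // int00 addr0.
rewrite /F a0 int00 Sx /= ?in_itv/= ?t0// => h; lra.
Qed.

End flow.

(** * A criterion for the symmetric integral *)

Lemma powR_le {R : realType} (p x y : R) : 0 <= p -> 0 <= x -> x <= y -> x `^ p <= y `^ p.
Proof. by move=> p0 x0 xy; apply: ge0_ler_powR => //; rewrite nnegrE// (le_trans x0). Qed.

Lemma within_continuous_comp {R : realType} (A : set R) (f m : R -> R) :
  {within A, continuous f} -> continuous m -> (forall u, A (m u)) ->
  continuous (fun u => f (m u)).
Proof.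
move=> /subspace_continuousP cf cm Am x.
apply: (cvg_comp m f _ (cf _ (Am x))) => P hP.
exact: (filterS (fun t (h : A (m t) -> P (m t)) => h (Am t)) (cm x _ hP)).
Qed.

Lemma int0_shift {R : realType} (h : R -> R) (s t : R) : continuous h -> 0 <= s -> 0 <= t ->
  int0 (fun u => h (u + s)) t = int0 h (t + s) - int0 h s.
Proof.
move=> ch s0 t0; rewrite /int0 t0 s0 addr_ge0// Rintegral_itv_split//; first last.
- by apply: continuous_compact_integrable; [exact: segment_compact | exact: continuous_subspaceT].
- by rewrite lerDr.
pose F (u : R) := u + s.
have dF (x : R) : is_derive x 1 F 1.
  rewrite -[X in is_derive _ _ _ X]addr0; apply: is_deriveD.
have F'E : derive1 F = cst (1 : R) by apply/funext => x; rewrite derive1E derive_val.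
have cF : continuous F.
  by move=> x; apply: cvgD; [exact: cvg_id | exact: cvg_cst].
have := @integration_by_substitution_increasing R F h 0 t t0.
rewrite /Rintegral F'E /F add0r => ->//.
- by congr fine; apply: eq_integral => x _ /=; rewrite mulr1.
- by move=> x y _ _ /= xy; rewrite ltrD2r.
- by move=> x _; exact: cvg_cst.
- exact: is_cvg_cst.
- exact: is_cvg_cst.
- split.
  + by move=> x _; have [] := dF x.
  + by apply: cvg_at_right_filter; exact: cF.
  + by apply: cvg_at_left_filter; exact: cF.
- exact: continuous_subspaceT.
Qed.

Lemma eq_int0 {R : realType} (f h : R -> R) (t : R) : 0 <= t ->
  (forall u, 0 <= u -> u <= t -> f u = h u) -> int0 f t = int0 h t.
Proof.
move=> t0 fh; rewrite /int0 t0; apply: eq_Rintegral => u.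
by rewrite inE/= in_itv/= => /andP[]; exact: fh.
Qed.

(** The integrand of the approximation is [(F (min (u + eps) t) - F u) / eps] up to [C eps^p]. The
    integral of this quotient telescopes to a mean of [F] over a window beyond [t], where it is
    frozen at [F t], minus its mean over [[0, eps]], which is close to [F 0]. *)
Lemma symint_of_trapezoid_increments {R : realType} (f g F : R -> R) (C p t : R) :
  0 < p -> 0 <= t -> t <= 1 ->
  {within `[0, 1], continuous f} -> {within `[0, 1], continuous g} ->
  {within `[0, 1], continuous F} ->
  (forall r, 0 <= r -> r <= t -> `|F r - F 0| <= C * r `^ p) ->
  (forall u v, 0 <= u -> u <= v -> v <= t ->
    `|(f v + f u) / 2 * (g v - g u) - (F v - F u)| <= C * (v - u) `^ p * (v - u)) ->
  symint f g t = F t - F 0.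
Proof.
move=> p0 t0 t1 cf cg cF Fp trap.
(* For [t = 0] the hypotheses leave the sign of [C] open, but then both sides of the conclusion are
   0. *)
have C0 : 0 <= C \/ t = 0.
  have [->|tn0] := eqVneq t 0; [by right | left].
  have t0' : 0 < t by rewrite lt_neqAle eq_sym tn0.
  have := Fp t t0 (lexx _); rewrite -(pmulr_lge0 C (powR_gt0 p t0')); apply: le_trans.
  exact: normr_ge0.
pose I eps := int0 (fun u => (f (Num.min (u + eps) t) + f u) / 2 *
                       ((g (Num.min (u + eps) t) - g u) / eps)) t.
have main eps : 0 < eps -> eps <= t -> `|F t - F 0 - I eps| <= 2 * C * eps `^ p.
  move=> e0 et; have {}C0 : 0 <= C.
    by case: C0 => // tz; move: et; rewrite tz leNgt e0.
  (* Clamping time to [[0, t]] makes the functions continuous on the whole line and turns [u + eps]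
     into [min (u + eps) t]. *)
  pose m (u : R) : R := Num.max 0 (Num.min u t).
  have cm : continuous m.
    have ci : continuous (fun u : R => u) by move=> x; exact: cvg_id.
    have cc (k : R) : continuous ((fun=> k) : R -> R) by move=> x; exact: cvg_cst.
    have cmin : continuous (fun u : R => Num.min u t).
      by move=> x; exact: (continuous_min (f := fun u : R => u) (g := fun=> t) (ci x) (cc t x)).
    by move=> x; exact: (continuous_max (f := fun=> 0) (cc 0 x) (cmin x)).
  have m01 u : `[0, 1]%classic (m u).
    by rewrite /= in_itv/= /m le_max lexx/= ge_max ler01/= ge_min t1 orbT.
  have mE u : 0 <= u -> u <= t -> m u = u.
    by move=> u0 ut; rewrite /m min_l// max_r.
  have mS u : 0 <= u -> m (u + eps) = Num.min (u + eps) t.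
    by move=> u0; rewrite /m max_r// le_min t0 andbT addr_ge0// ltW.
  have mt u : t <= u -> m u = t by move=> tu; rewrite /m min_r// max_r.
  have cm1 : continuous (fun u => m (u + eps)).
    move=> x; apply: (@continuous_comp _ _ _ (fun u => u + eps) m); last exact: cm.
    by apply: cvgD; [exact: cvg_id | exact: cvg_cst].
  have m101 u : `[0, 1]%classic (m (u + eps)) := m01 _.
  pose f0 u := f (m u); pose f1 u := f (m (u + eps)).
  pose g0 u := g (m u); pose g1 u := g (m (u + eps)).
  pose F0 u := F (m u); pose F1 u := F (m (u + eps)).
  have cf0 : continuous f0 := within_continuous_comp cf cm m01.
  have cg0 : continuous g0 := within_continuous_comp cg cm m01.
  have cF0 : continuous F0 := within_continuous_comp cF cm m01.
  have cf1 : continuous f1 := within_continuous_comp cf cm1 m101.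
  have cg1 : continuous g1 := within_continuous_comp cg cm1 m101.
  have cF1 : continuous F1 := within_continuous_comp cF cm1 m101.
  pose G u := (f1 u + f0 u) / 2 * ((g1 u - g0 u) / eps).
  have IG : I eps = int0 G t.
    by apply: eq_int0 => // u u0 ut; rewrite /G /f1 /f0 /g1 /g0 mS// mE.
  have cG : continuous G.
    move=> x; apply: cvgM; apply: cvgMr_tmp.
      by apply: cvgD; [exact: cf1 | exact: cf0].
    by apply: cvgB; [exact: cg1 | exact: cg0].
  (* The factor 1 gives the shape that [int0_lin01] expects. *)
  pose D u := 1 * F1 u - F0 u.
  have cD : continuous D.
    by move=> x; apply: cvgB; [apply: cvgMl_tmp; exact: cF1 | exact: cF0].
  have intD : int0 D t = int0 F1 t - int0 F0 t.
    by rewrite int0_lin01 ?mul1r//; exact: continuous_subspaceT.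
  pose A := int0 F0.
  have A0 : A 0 = 0 by rewrite /A int00.
  have intF1 : int0 F1 t = A (t + eps) - A eps by rewrite -int0_shift// ltW.
  have Aend : A (t + eps) - A t = eps * F t.
    have te : t <= t + eps by rewrite lerDl ltW.
    have := int0_increment_continuous cF0 te (c := F t) (L := 0).
    rewrite mul0r normr_le0 subr_eq0 => h; rewrite (eqP (h _)) ?[t + eps]addrC ?addrK 1?mulrC//.
    by move=> r tr _; rewrite /F0 mt// subrr normr0.
  have Abeg : `|A eps - A 0 - F 0 * (eps - 0)| <= C * eps `^ p * (eps - 0).
    apply: int0_increment_continuous => //; first exact: ltW.
    move=> r r0 re; rewrite /F0 mE ?(le_trans re)//.
    apply: le_trans (Fp _ r0 (le_trans re et)) _.
    by rewrite ler_wpM2l// powR_le// ltW.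
  pose E u := eps^-1 * D u - G u.
  have cE : continuous E.
    by move=> x; apply: cvgB; [apply: cvgMl_tmp; exact: cD | exact: cG].
  have intE : int0 E t = eps^-1 * int0 D t - int0 G t.
    by rewrite int0_lin01//; exact: continuous_subspaceT.
  have Eb : `|int0 E t - int0 E 0 - 0 * (t - 0)| <= C * eps `^ p * (t - 0).
    apply: int0_increment_continuous => // r r0 rt; rewrite subr0 /E /D /G.
    rewrite /F1 /F0 /f1 /f0 /g1 /g0 mS// mE//.
    have r1 : r <= Num.min (r + eps) t by rewrite le_min rt lerDl ltW.
    have r2 : Num.min (r + eps) t <= t by rewrite ge_min lexx orbT.
    have r3 : Num.min (r + eps) t - r <= eps.
      by rewrite lerBlDr (addrC eps) ge_min lexx.
    set r' := Num.min (r + eps) t in r1 r2 r3 *.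
    have -> : eps^-1 * (1 * F r' - F r) - (f r' + f r) / 2 * ((g r' - g r) / eps) =
      - (eps^-1 * ((f r' + f r) / 2 * (g r' - g r) - (F r' - F r))).
      by field; rewrite gt_eqF.
    rewrite normrN normrM gtr0_norm ?invr_gt0// ler_pdivrMl//.
    apply: le_trans (trap _ _ r0 r1 r2) _; rewrite mulrC; apply: ler_pM => //.
    - by rewrite subr_ge0.
    - by rewrite mulr_ge0// powR_ge0.
    - by rewrite ler_wpM2l// powR_le// ?subr_ge0// ltW.
  have -> : F t - F 0 - I eps = (int0 E t - int0 E 0 - 0 * (t - 0)) + eps^-1 * (A eps - A 0 - F 0 * (eps - 0)).
    have -> : F t = eps^-1 * (A (t + eps) - A t) by rewrite Aend mulKf// gt_eqF.
    rewrite IG intE intD intF1 int00 A0 /A; field; by rewrite gt_eqF.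
  apply: le_trans (ler_normD _ _) _.
  have -> : 2 * C * eps `^ p = C * eps `^ p * 1 + C * eps `^ p by ring.
  apply: lerD.
    by apply: le_trans Eb _; rewrite ler_wpM2l ?subr0// mulr_ge0// powR_ge0.
  rewrite normrM gtr0_norm ?invr_gt0// ler_pdivrMl//; apply: le_trans Abeg _.
  by rewrite subr0 mulrC.
rewrite /symint -/I; apply: cvg_lim; first exact: Rhausdorff.
have [tz|tn0] := eqVneq t 0.
  have -> : I = cst 0 by apply/funext => e; rewrite /I tz int00.
  by rewrite tz subrr; exact: cvg_cst.
have t0' : 0 < t by rewrite lt_neqAle eq_sym tn0.
have {}C0 : 0 <= C by case: C0 => // tz; rewrite tz eqxx in tn0.
apply/cvgrPdist_le => e e0.
have h0 : 0 < e / (2 * C + 1) by rewrite divr_gt0// ltr_wpDl// mulr_ge0.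
have /cvgrPdist_le /(_ _ h0) hnear := @powR_cvg0 R p p0.
near=> eps.
have ep : 0 < eps by near: eps; exact: nbhs_right_gt.
apply: le_trans (main eps ep _) _.
  by near: eps; exact: nbhs_right_le.
have hp : eps `^ p <= e / (2 * C + 1).
  have : `|0 - eps `^ p| <= e / (2 * C + 1) by near: eps; exact: hnear.
  by rewrite sub0r normrN ger0_norm// powR_ge0.
have C1 : 0 < 2 * C + 1 by rewrite ltr_wpDl// mulr_ge0.
rewrite ler_pdivlMr// in hp; apply: le_trans hp; rewrite mulrC ler_wpM2l ?powR_ge0//.
by rewrite lerDl.
Unshelve. all: by end_near. Qed.

(** * The limit process in Lamperti coordinates *)

Lemma powR_exp_le {R : realType} (z a b : R) : 0 <= z -> z <= 1 -> 0 < b -> b <= a ->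
  z `^ a <= z `^ b.
Proof.
move=> z0 z1 b0 ba; have [->|zn0] := eqVneq z 0.
  by rewrite !powR0 ?gt_eqF// (lt_le_trans b0).
by apply: ger_powR => //; rewrite z1 lt_neqAle eq_sym zn0 z0.
Qed.

Lemma powR_le1 {R : realType} (z a : R) : 0 <= z -> z <= 1 -> 0 <= a -> z `^ a <= 1.
Proof. by move=> z0 z1 a0; have := powR_le a0 z0 z1; rewrite powR1. Qed.

(* S(x) solves an equation with the additive noise g, so S(x) is as regular as g. *)
Definition lamperti_path {R : realType} (b sigma S : R -> R) (xi K gamma : R)
    (g x : R -> R) : Prop :=
  [/\ {within `[0, 1], continuous g} /\ g 0 = 0,
      {within `[0, 1], continuous (fun t => S (x t))},
      forall t, 0 <= t -> t <= 1 ->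
        S (x t) = S xi + int0 (fun u => b (x u) / sigma (x u)) t + g t,
      forall u v, 0 <= u -> u <= v -> v <= 1 -> `|g v - g u| <= K * (v - u) `^ gamma &
      forall u v, 0 <= u -> u <= v -> v <= 1 ->
        `|S (x v) - S (x u)| <= K * (v - u) `^ gamma].

(** [increment_le_pow] asks for a bound on the ball around [a] of radius [|b - a|], whose points
    have size up to [3 C]. The second estimate applies it twice, hence [9 C]. *)
Lemma expR_taylor {R : realType} (C a b : R) : 0 <= C -> `|a| <= C -> `|b| <= C ->
  `|expR b - expR a| <= expR (9 * C) * `|b - a| /\
  `|expR b - expR a - expR a * (b - a)| <= expR (9 * C) * (b - a) ^+ 2.
Proof.
move=> C0 aC bC.
have lip D p q : 0 <= D -> `|p| <= D -> `|q| <= D -> `|expR q - expR p| <= expR (3 * D) * `|q - p| :> R.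
  move=> D0 pD qD; rewrite -[`|q - p|]expr1.
  apply: (@increment_le_pow _ expR expR); last exact: expR_ge0.
  move=> x xpq; rewrite expr0 mulr1 ger0_norm ?expR_ge0// ler_expR.
  apply: le_trans (ler_norm _) _; rewrite -(subrK p x); apply: le_trans (ler_normD _ _) _.
  have := ler_normB q p; lra.
split.
  apply: le_trans (lip C _ _ _ _ _) _ => //; rewrite ler_wpM2r// ler_expR; lra.
rewrite -(real_normK (num_real (b - a))).
have -> : expR b - expR a - expR a * (b - a) =
  (fun t => expR t - expR a * t) b - (fun t => expR t - expR a * t) a by rewrite /=; ring.
apply: (@increment_le_pow _ (fun t => expR t - expR a * t) (fun t => expR t - expR a) _ _ _ 1).
- move=> t; apply: is_deriveB.
  by rewrite -[X in is_derive _ _ _ X]mulr1; apply: is_deriveZ.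
- move=> x xab; rewrite expr1 (_ : 9 * C = 3 * (3 * C)); last by ring.
  have xC : `|x| <= 3 * C.
    rewrite -(subrK a x); apply: le_trans (ler_normD _ _) _.
    have := ler_normB b a; lra.
  by apply: lip => //; [rewrite mulr_ge0 | lra].
- exact: expR_ge0.
Qed.

Lemma lamperti_path_solution {R : realType} (b sigma S : R -> R) (C xi K gamma : R) (g x : R -> R) :
  lamperti b sigma S C -> 0 < gamma -> gamma <= 1 -> 0 <= K ->
  {within `[0, 1], continuous g} -> g 0 = 0 ->
  (forall u v, 0 <= u -> u <= v -> v <= 1 -> `|g v - g u| <= K * (v - u) `^ gamma) ->
  sde_solution b sigma xi g x -> lamperti_path b sigma S xi (C + K) gamma g x.
Proof.
move=> L gam0 gam1 K0 cg g0 gK sol; have [cSx SxE] := sde_solution_lamperti L cg g0 sol.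
have C0 : 0 <= C := le_trans ler01 (lamp_C1 L).
split=> // u v u0 uv v1.
  by apply: le_trans (gK _ _ u0 uv v1) _; rewrite ler_wpM2r ?powR_ge0// lerDr.
have v0 := le_trans u0 uv; have u1 := le_trans uv v1.
have cc : {within `[0, 1], continuous (fun t => b (x t) / sigma (x t))}.
  by apply: (within_continuous_dominated cSx (C := C)) => p q _ _; exact: (lamp_drift_lip L).
have := int0_increment01 cc u0 uv v1 (c := 0) (L := C).
rewrite mul0r subr0 => h.
have -> : S (x v) - S (x u) = (int0 (fun t => b (x t) / sigma (x t)) v
  - int0 (fun t => b (x t) / sigma (x t)) u) + (g v - g u) by rewrite !SxE//; ring.
rewrite mulrDl; apply: le_trans (ler_normD _ _) _; apply: lerD; last exact: gK.
apply: le_trans (h _) _; first by move=> r _ _; rewrite subr0; exact: (lamp_drift_le L).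
rewrite ler_wpM2l// -[X in X <= _]powRr1 ?subr_ge0//; apply: powR_exp_le => //.
  by rewrite subr_ge0.
by lra.
Qed.

Section path.
Context {R : realType} (b sigma S : R -> R) (C xi K gamma : R) (g x : R -> R).
Context (L : lamperti b sigma S C) (PP : lamperti_path b sigma S xi K gamma g x).
Context (gamma_gt : 1 / 2 < gamma) (gamma_le : gamma <= 1) (K0 : 0 <= K).

Let C0 : 0 <= C := le_trans ler01 (lamp_C1 L).
Let gamma0 : 0 < gamma. Proof. by apply: lt_trans gamma_gt; rewrite divr_gt0. Qed.

Let fx u := derive1 sigma (x u).
Let qx u := wronskian b sigma (x u) / sigma (x u).
Let cx u := b (x u) / sigma (x u).

Lemma path_within_continuous (F : R -> R) :
  (forall u v, `|F v - F u| <= C * `|S v - S u|) -> {within `[0, 1], continuous (fun t => F (x t))}.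
Proof.
move=> FC; case: PP => _ cSx _ _ _.
by apply: (within_continuous_dominated cSx (C := C)) => p q _ _; exact: FC.
Qed.

Lemma path_hoelder (F : R -> R) (u v : R) :
  (forall u v, `|F v - F u| <= C * `|S v - S u|) -> 0 <= u -> u <= v -> v <= 1 ->
  `|F (x v) - F (x u)| <= C * K * (v - u) `^ gamma.
Proof.
case: PP => _ _ _ _ xK FC u0 uv v1; apply: le_trans (FC _ _) _.
by rewrite -mulrA ler_wpM2l// xK.
Qed.

Let cf : {within `[0, 1], continuous fx} := path_within_continuous (lamp_sigma'_lip L).
Let cc : {within `[0, 1], continuous cx} := path_within_continuous (F := fun y => b y / sigma y) (lamp_drift_lip L).
Let cq : {within `[0, 1], continuous qx} :=
  path_within_continuous (F := fun y => wronskian b sigma y / sigma y) (lamp_wronskian_lip L).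

Lemma path_start : x 0 = xi.
Proof.
case: PP => -[_ g0] _ /(_ 0 (lexx _) ler01) h _ _; move: h; rewrite int00 g0 !addr0 => h.
have := lamp_ge L xi (x 0); rewrite h subrr normr0 mulr0 normr_le0 subr_eq0.
by move/eqP.
Qed.

Let int0_lipschitz (f : R -> R) (M u v : R) : {within `[0, 1], continuous f} ->
  (forall r, `|f r| <= M) -> 0 <= u -> u <= v -> v <= 1 ->
  `|int0 f v - int0 f u| <= M * (v - u).
Proof.
move=> ctf fM u0 uv v1; have := int0_increment01 ctf u0 uv v1 (c := 0) (L := M).
by rewrite mul0r subr0; apply => r _ _; rewrite subr0.
Qed.

(** Formally [d ln sigma(x) = sigma'(x) dS(x)], where [dS(x)] is the drift plus [dg]. For the
    increment [D] of [S (x)], the trapezoid product and the increment of [ln sigma (x)] both equal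
    [sigma'(x_u) D] up to a multiple of [(v - u)^(2 gamma)], and [2 gamma > 1]. *)
Lemma symint_path t : 0 <= t -> t <= 1 ->
  symint fx g t = ln (sigma (x t)) - ln (sigma xi) - int0 (fun u => fx u * cx u) t.
Proof.
move=> t0 t1; have [[cg g0] cSx SxE gK xK] := PP.
have gamh := gamma_gt; have gam1 := gamma_le; have gam0 := gamma0.
have cfc : {within `[0, 1], continuous (fun u => fx u * cx u)}.
  by move=> r; apply: cvgM; [exact: cf | exact: cc].
pose N := int0 (fun u => fx u * cx u).
pose F t := ln (sigma (x t)) - N t.
have Nlip u v : 0 <= u -> u <= v -> v <= 1 -> `|N v - N u| <= C * C * (v - u).
  apply: int0_lipschitz => // r; apply: normM_le; [exact: (lamp_sigma'_le L) | exact: (lamp_drift_le L)].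
have lnlip u v : 0 <= u -> u <= v -> v <= 1 ->
    `|ln (sigma (x v)) - ln (sigma (x u))| <= (C * K + C * K ^+ 2) * (v - u) `^ gamma.
  move=> u0 uv v1.
  have -> : ln (sigma (x v)) - ln (sigma (x u)) = fx u * (S (x v) - S (x u)) +
    (ln (sigma (x v)) - ln (sigma (x u)) - fx u * (S (x v) - S (x u))) by ring.
  rewrite mulrDl; apply: le_trans (ler_normD _ _) _; apply: lerD.
    by rewrite -mulrA; apply: normM_le; [exact: (lamp_sigma'_le L) | exact: xK].
  apply: le_trans (lamp_ln_taylor2 L _ _) _; rewrite -mulrA ler_wpM2l//.
  rewrite -(real_normK (num_real (S (x v) - _))) -[X in _ <= X]mulr1.
  apply: (@le_trans _ _ (K ^+ 2 * ((v - u) `^ gamma) ^+ 2)).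
    by rewrite -exprMn lerXn2r ?nnegrE ?xK// mulr_ge0// powR_ge0.
  rewrite mulr1 ler_wpM2l ?sqr_ge0// expr2 ler_piMl ?powR_ge0//.
  by apply: powR_le1; rewrite ?(ltW gamma0)//; lra.
(* The excess of [2 gamma] over 1. As [p <= gamma <= 1], the powers [gamma] and 1 of a length in
   [[0, 1]] are at most its power [p]. *)
pose p := 2 * gamma - 1.
have p0 : 0 < p by rewrite /p; lra.
have dp u v : 0 <= u -> u <= v -> v <= 1 -> (v - u) `^ gamma <= (v - u) `^ p.
  by move=> u0 uv v1; apply: powR_exp_le => //; rewrite /p; lra.
have d1 u v : 0 <= u -> u <= v -> v <= 1 -> v - u <= (v - u) `^ p.
  move=> u0 uv v1; rewrite -[X in X <= _]powRr1; last lra.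
  by apply: powR_exp_le => //; rewrite /p; lra.
have d2 u v : 0 <= u -> u <= v -> v <= 1 -> ((v - u) `^ gamma) ^+ 2 = (v - u) `^ p * (v - u).
  move=> u0 uv v1; rewrite -[X in _ = _ * X]powRr1; last lra.
  rewrite -powRD /p; last by apply/implyP => /eqP; lra.
  by rewrite -powR_mulrn ?powR_ge0// -powRrM; congr (_ `^ _); ring.
pose KK := C * K + C * K ^+ 2 + C * C + C * (C * K) + C * K ^+ 2 + C * K ^+ 2.
rewrite (_ : _ - _ - _ = F t - F 0); last first.
  by rewrite /F path_start /N int00; ring.
have cln : {within `[0, 1], continuous (fun t => ln (sigma (x t)))}.
  have ypos s (s01 : `[0, 1]%classic s) : `|S (x s) - S (x 0)| <= K.
    move: s01; rewrite /= in_itv/= => /andP[s0 s1].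
    apply: le_trans (xK _ _ (lexx _) s0 s1) _; rewrite ler_piMr//.
    by apply: powR_le1; rewrite ?subr0// ltW.
  apply: (within_continuous_dominated cSx (C := C + C * (2 * K))) => u v u01 v01.
  have -> : ln (sigma (x u)) - ln (sigma (x v)) = fx v * (S (x u) - S (x v)) +
    (ln (sigma (x u)) - ln (sigma (x v)) - fx v * (S (x u) - S (x v))) by ring.
  rewrite mulrDl; apply: le_trans (ler_normD _ _) _; apply: lerD.
    by apply: normM_le => //; exact: (lamp_sigma'_le L).
  apply: le_trans (lamp_ln_taylor2 L _ _) _; rewrite -mulrA ler_wpM2l//.
  rewrite -(real_normK (num_real (S (x u) - _))) expr2 ler_wpM2r//.
  have -> : S (x u) - S (x v) = (S (x u) - S (x 0)) - (S (x v) - S (x 0)) by ring.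
  have := ler_normB (S (x u) - S (x 0)) (S (x v) - S (x 0)).
  have := ypos _ u01; have := ypos _ v01; lra.
have cN : {within `[0, 1], continuous N}.
  apply: (within_continuous_dominated (g := fun u => u) (C := C * C)).
    by apply: continuous_subspaceT => r; exact: cvg_id.
  move=> u v; rewrite /= !in_itv/= => /andP[u0 u1] /andP[v0 v1].
  have [uv|/ltW vu] := leP u v.
    by rewrite distrC (distrC u) [X in _ * X]ger0_norm ?subr_ge0// Nlip.
  by rewrite [X in _ * X]ger0_norm ?subr_ge0// Nlip.
have CK0 : 0 <= C * K + C * K ^+ 2 by nonneg.
have CC0 : 0 <= C * C by nonneg.
have CK20 : 0 <= C * K ^+ 2 by nonneg.
have CCK0 : 0 <= C * (C * K) by nonneg.
apply: (@symint_of_trapezoid_increments _ _ _ _ KK p) => //.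
- by move=> r; apply: cvgB; [exact: cln | exact: cN].
- move=> r r0 rt; have r1 := le_trans rt t1.
  have -> : F r - F 0 = (ln (sigma (x r)) - ln (sigma (x 0))) - (N r - N 0) by rewrite /F; ring.
  apply: (@le_trans _ _ ((C * K + C * K ^+ 2 + C * C) * r `^ p)).
    rewrite mulrDl; apply: le_trans (ler_normB _ _) _; apply: lerD.
      apply: le_trans (lnlip _ _ (lexx _) r0 r1) _; rewrite ler_wpM2l//.
      by have := dp _ _ (lexx _) r0 r1; rewrite !subr0.
    apply: le_trans (Nlip _ _ (lexx _) r0 r1) _; rewrite ler_wpM2l//.
    by have := d1 _ _ (lexx _) r0 r1; rewrite !subr0.
  by rewrite ler_wpM2r ?powR_ge0// /KK; lra.
- move=> u v u0 uv vt; have v1 := le_trans vt t1.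
  have v0 := le_trans u0 uv; have u1 := le_trans uv v1.
  set D := S (x v) - S (x u).
  have DK : `|D| <= K * (v - u) `^ gamma by exact: xK.
  have D2 : D ^+ 2 <= K ^+ 2 * ((v - u) `^ p * (v - u)).
    rewrite -d2// -exprMn -(real_normK (num_real D)) lerXn2r ?nnegrE//.
    by rewrite mulr_ge0// powR_ge0.
  (* Rewriting [g] through [S (x)] multiplies the drift by the mean [s] of [sigma'(x)] at the two
     ends, whereas [F] has [sigma'(x)] inside the integral; [G] is the difference. *)
  pose s := (fx v + fx u) / 2.
  pose G r := s * cx r - fx r * cx r.
  have GE r : 0 <= r -> r <= 1 -> int0 G r = s * int0 cx r - N r.
    by move=> r0 r1; apply: int0_lin01.
  have cG : {within `[0, 1], continuous G}.
    by move=> r; apply: cvgB; [apply: cvgMl_tmp; exact: cc | exact: cfc].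
  have Gb : `|int0 G v - int0 G u - 0 * (v - u)| <= C * (C * K) * (v - u) `^ gamma * (v - u).
    apply: int0_increment01 => // r ur rv; rewrite subr0.
    have -> : G r = cx r * ((fx v - fx r) / 2 - (fx r - fx u) / 2) by rewrite /G /s; field.
    rewrite -mulrA; apply: normM_le; first exact: (lamp_drift_le L).
    have h1 : `|fx v - fx r| <= C * K * (v - u) `^ gamma.
      apply: le_trans (path_hoelder (lamp_sigma'_lip L) (le_trans u0 ur) rv v1) _.
      by rewrite ler_wpM2l ?mulr_ge0//; apply: powR_le;
        rewrite ?subr_ge0 ?lerD2r ?lerD2l ?lerN2//; exact: ltW.
    have h2 : `|fx r - fx u| <= C * K * (v - u) `^ gamma.
      apply: le_trans (path_hoelder (lamp_sigma'_lip L) u0 ur (le_trans rv v1)) _.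
      by rewrite ler_wpM2l ?mulr_ge0//; apply: powR_le;
        rewrite ?subr_ge0 ?lerD2r ?lerD2l ?lerN2//; exact: ltW.
    apply: le_trans (ler_normB _ _) _; rewrite !normrM (@ger0_norm _ 2^-1); last lra.
    lra.
  have -> : (fx v + fx u) / 2 * (g v - g u) - (F v - F u) =
    (2^-1 * ((fx v - fx u) * D) - (ln (sigma (x v)) - ln (sigma (x u)) - fx u * D))
     - (int0 G v - int0 G u - 0 * (v - u)).
    by rewrite !GE// /F /D !SxE// /s; field.
  have b1 : `|2^-1 * ((fx v - fx u) * D)| <= C * K ^+ 2 * ((v - u) `^ p * (v - u)).
    have h : `|(fx v - fx u) * D| <= C * K ^+ 2 * ((v - u) `^ p * (v - u)).
      rewrite -d2// (_ : C * K ^+ 2 * _ = C * K * (v - u) `^ gamma * (K * (v - u) `^ gamma)); last ring.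
      by apply: normM_le => //; apply: path_hoelder => //; exact: (lamp_sigma'_lip L).
    rewrite normrM ger0_norm; last lra.
    apply: le_trans h; rewrite ler_piMl//; lra.
  have b2 : `|ln (sigma (x v)) - ln (sigma (x u)) - fx u * D| <= C * K ^+ 2 * ((v - u) `^ p * (v - u)).
    apply: le_trans (lamp_ln_taylor2 L _ _) _; rewrite -mulrA ler_wpM2l//.
  have b3 : `|int0 G v - int0 G u - 0 * (v - u)| <= C * (C * K) * ((v - u) `^ p * (v - u)).
    apply: le_trans Gb _; rewrite -mulrA ler_wpM2l// ler_wpM2r ?subr_ge0// dp//.
  apply: (@le_trans _ _ ((C * K ^+ 2 + C * K ^+ 2 + C * (C * K)) * ((v - u) `^ p * (v - u)))).
    apply: le_trans (ler_normB _ _) _; rewrite [X in _ <= X]mulrDl; apply: lerD => //.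
    by apply: le_trans (ler_normB _ _) _; rewrite [X in _ <= X]mulrDl; apply: lerD.
  rewrite -(mulrA KK) ler_wpM2r ?mulr_ge0 ?powR_ge0 ?subr_ge0// /KK; lra.
Qed.

(* J = sigma(x) E / sigma(xi): the constant factor cancels in J / J_s, and the limit
   process becomes sigma(x) Z with Z as below. *)
Definition Epath t := expR (int0 qx t).

(** Since [b' = w / sigma + sigma' (b / sigma)], the drift correction in [symint_path] cancels part
    of the integral of [b'] and leaves that of [w / sigma]. *)
Lemma Jpath_lamperti t : 0 <= t -> t <= 1 ->
  Jpath b sigma g x t = sigma (x t) / sigma xi * Epath t.
Proof.
move=> t0 t1; rewrite /Jpath symint_path// /Epath.
have cfc : {within `[0, 1], continuous (fun u => fx u * cx u)}.
  by move=> r; apply: cvgM; [exact: cf | exact: cc].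
have -> : int0 (fun u => derive1 b (x u)) t = int0 qx t + int0 (fun u => fx u * cx u) t.
  (* The sum is written as nested differences to match [int0_lin01]. *)
  have -> : int0 qx t + int0 (fun u => fx u * cx u) t =
    1 * int0 qx t - (-1 * int0 (fun u => fx u * cx u) t - int0 (fun=> 0) t).
    suff -> : int0 (fun=> 0 : R) t = 0 by ring.
    by rewrite /int0 t0 Rintegral_cst_itv// mul0r.
  rewrite -!int0_lin01//.
  - apply: eq_int0 => // u u0 ut.
    by rewrite /qx /cx /fx /wronskian; field; rewrite gt_eqF// (lamp_sigma_gt0 L).
  - move=> r; apply: cvgB; last exact: cvg_cst.
    by apply: cvgMl_tmp; exact: cfc.
  - by move=> r; exact: cvg_cst.
have -> : int0 qx t + int0 (fun u => fx u * cx u) t +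
  (ln (sigma (x t)) - ln (sigma xi) - int0 (fun u => fx u * cx u) t) =
  ln (sigma (x t)) - ln (sigma xi) + int0 qx t by ring.
by rewrite !expRD expRN !lnK ?posrE ?(lamp_sigma_gt0 L).
Qed.

End path.

(** Variation of constants for [Z' = (w / sigma)(x) Z + f_2(x)], [Z_0 = 0], after an integration by
    parts that moves the derivative from [U] to the reciprocal of [Epath]. *)
Definition Zpath {R : realType} (b sigma x : R -> R) (t : R) : R :=
  Upath sigma x t + Epath b sigma x t *
    int0 (fun s => (Epath b sigma x s)^-1 * (wronskian b sigma (x s) / sigma (x s))
                   * Upath sigma x s) t.

(** One constant for three bounds on [Z]: the first four summands serve its second-order increment,
    the next one its size, the last one its speed. [W] bounds [Epath] and its reciprocal. *)
Definition Zconst {R : realType} (C K : R) : R :=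
  let W := expR (9 * C) in
  C * K + (W * (C * C) + W * (C * K)) * (W * C * C) + C * W * (W * C * C)
  + W * (W * C * C * C + W * (C * K) * C + W * C * C)
  + (C + W * (W * C * C)) + (C * (C + W * (W * C * C)) + C).

Lemma int0_cst0 {R : realType} (t : R) : int0 (fun=> 0 : R) t = 0.
Proof. by rewrite /int0 /Rintegral !integral0 oppr0 if_same. Qed.

Lemma normD_leM {R : realType} (a b A B d : R) :
  `|a| <= A * d -> `|b| <= B * d -> `|a + b| <= (A + B) * d.
Proof. by move=> aA bB; rewrite mulrDl; apply: le_trans (ler_normD _ _) (lerD aA bB). Qed.

Lemma subM3 {R : realType} (a a' b b' c c' : R) :
  a' * b' * c' - a * b * c = (a' - a) * b' * c' + a * (b' - b) * c' + a * b * (c' - c).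
Proof. ring. Qed.

(** Exact splitting of the one-step error of the linear equation into the second-order remainders of
    [U], of [E] and of the integral [I], and one product of two small quantities. *)
Lemma variation_of_constants_increment {R : realType} (Uu Uv Eu Ev Iu Iv q f d : R) : Eu != 0 ->
  Uv + Ev * Iv - (Uu + Eu * Iu) - (q * (Uu + Eu * Iu) - f / 2) * d =
  (Uv - Uu - (- f / 2) * d) + (Ev - Eu - Eu * (q * d)) * Iv
  + q * Eu * d * (Iv - Iu) + Eu * (Iv - Iu - Eu^-1 * q * Uu * d).
Proof. by move=> E0; field. Qed.

Lemma exp_increment {R : realType} (Eu Ev Qu Qv qd : R) :
  Ev - Eu - Eu * qd = (Ev - Eu - Eu * (Qv - Qu)) + Eu * (Qv - Qu - qd).
Proof. ring. Qed.

(* Conversion would otherwise unfold these while comparing [E u] with [E v]. *)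
Local Opaque int0 expR.

Section Zpath.
Context {R : realType} (b sigma S : R -> R) (C xi K gamma : R) (g x : R -> R).
Context (L : lamperti b sigma S C) (PP : lamperti_path b sigma S xi K gamma g x).
Context (gamma_gt : 1 / 2 < gamma) (gamma_le : gamma <= 1) (K0 : 0 <= K).

Let C0 : 0 <= C := le_trans ler01 (lamp_C1 L).
Let gamma0 : 0 < gamma. Proof. by apply: lt_trans gamma_gt; rewrite divr_gt0. Qed.

Let fx u := derive1 sigma (x u).
Let qx u := wronskian b sigma (x u) / sigma (x u).
Let U := Upath sigma x.
Let E := Epath b sigma x.
Let G s := (E s)^-1 * qx s * U s.
Let Z := Zpath b sigma x.
Let W := expR (9 * C).

Let W0 : 0 <= W. Proof. exact: expR_ge0. Qed.

Let cf2 : {within `[0, 1], continuous (fun u => - fx u / 2)}.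
Proof.
have := path_within_continuous (F := fun y => - derive1 sigma y / 2) PP; apply => u v.
have -> : - derive1 sigma v / 2 - - derive1 sigma u / 2 =
  2^-1 * - (derive1 sigma v - derive1 sigma u) by ring.
rewrite normrM normrN ger0_norm ?invr_ge0//.
apply: le_trans (lamp_sigma'_lip L u v); rewrite ler_piMl//; lra.
Qed.

Let cq : {within `[0, 1], continuous qx} :=
  path_within_continuous PP (F := fun y => wronskian b sigma y / sigma y) (lamp_wronskian_lip L).

Let f2_le r : `|- fx r / 2| <= C.
Proof.
rewrite normrM normrN (@ger0_norm _ 2^-1) ?invr_ge0//.
apply: le_trans (lamp_sigma'_le L (x r)); rewrite ler_piMr//; lra.
Qed.

Let int0_lipschitz (f : R -> R) (M u v : R) : {within `[0, 1], continuous f} ->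
  (forall r, 0 <= r -> r <= 1 -> `|f r| <= M) -> 0 <= u -> u <= v -> v <= 1 ->
  `|int0 f v - int0 f u| <= M * (v - u).
Proof.
move=> ctf fM u0 uv v1; have := int0_increment01 ctf u0 uv v1 (c := 0) (L := M).
rewrite mul0r subr0; apply => r ur rv; rewrite subr0 fM ?(le_trans u0)//.
exact: le_trans v1.
Qed.

Let bounded_from_lipschitz (F : R -> R) (M t : R) : F 0 = 0 -> 0 <= M ->
  (forall u v, 0 <= u -> u <= v -> v <= 1 -> `|F v - F u| <= M * (v - u)) ->
  0 <= t -> t <= 1 -> `|F t| <= M.
Proof.
move=> F0 M0 FM t0 t1; have := FM _ _ (lexx _) t0 t1; rewrite F0 !subr0 => /le_trans; apply.
by rewrite ler_piMr.
Qed.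

Let Ulip u v : 0 <= u -> u <= v -> v <= 1 -> `|U v - U u| <= C * (v - u).
Proof. by apply: int0_lipschitz => // r _ _; exact: f2_le. Qed.

Let U0 : U 0 = 0. Proof. exact: int00. Qed.

Let Ule t : 0 <= t -> t <= 1 -> `|U t| <= C.
Proof. by apply: bounded_from_lipschitz. Qed.

Let Qlip u v : 0 <= u -> u <= v -> v <= 1 -> `|int0 qx v - int0 qx u| <= C * (v - u).
Proof. by apply: int0_lipschitz => // r _ _; exact: (lamp_wronskian_le L). Qed.

Let Qle t : 0 <= t -> t <= 1 -> `|int0 qx t| <= C.
Proof. by apply: bounded_from_lipschitz => //; exact: int00. Qed.

Let Egt0 t : 0 < E t. Proof. exact: expR_gt0. Qed.

Let expR_le_W (r : R) : `|r| <= C -> expR r <= W.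
Proof.
move=> rC; rewrite ler_expR; apply: le_trans (ler_norm _) _; apply: le_trans rC _.
by rewrite ler_peMl//; lra.
Qed.

Let Ele t : 0 <= t -> t <= 1 -> `|E t| <= W.
Proof. by move=> t0 t1; rewrite gtr0_norm// expR_le_W// Qle. Qed.

Let EVE t : (E t)^-1 = expR (- int0 qx t).
Proof. by rewrite expRN. Qed.

Let EVle t : 0 <= t -> t <= 1 -> `|(E t)^-1| <= W.
Proof.
by move=> t0 t1; rewrite gtr0_norm ?invr_gt0// EVE expR_le_W// normrN Qle.
Qed.

Let Elip u v : 0 <= u -> u <= v -> v <= 1 -> `|E v - E u| <= W * C * (v - u).
Proof.
move=> u0 uv v1; have v0 := le_trans u0 uv; have u1 := le_trans uv v1.
have [h _] := expR_taylor C0 (Qle u0 u1) (Qle v0 v1).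
by apply: le_trans h _; rewrite -mulrA ler_wpM2l// Qlip.
Qed.

Let EVlip u v : 0 <= u -> u <= v -> v <= 1 -> `|(E v)^-1 - (E u)^-1| <= W * C * (v - u).
Proof.
move=> u0 uv v1; have v0 := le_trans u0 uv; have u1 := le_trans uv v1.
have -> : (E v)^-1 - (E u)^-1 = expR (- int0 qx v) - expR (- int0 qx u) by rewrite !expRN.
have NQ t : 0 <= t -> t <= 1 -> `|- int0 qx t| <= C by move=> t0 t1; rewrite normrN Qle.
have [h _] := expR_taylor C0 (NQ _ u0 u1) (NQ _ v0 v1).
apply: le_trans h _; rewrite -mulrA ler_wpM2l// -opprD normrN.
by rewrite Qlip.
Qed.

Let Gle t : 0 <= t -> t <= 1 -> `|G t| <= W * C * C.
Proof.
move=> t0 t1; apply: normM_le; last exact: Ule.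
by apply: normM_le; [exact: EVle | exact: (lamp_wronskian_le L)].
Qed.

Let dle u v : 0 <= u -> u <= v -> v <= 1 -> v - u <= (v - u) `^ gamma.
Proof.
move=> u0 uv v1; rewrite -[X in X <= _]powRr1 ?subr_ge0//.
apply: powR_exp_le => //; first by rewrite subr_ge0.
by rewrite lerBlDr (le_trans v1)// lerDl.
Qed.

Let Ghoelder u v : 0 <= u -> u <= v -> v <= 1 ->
  `|G v - G u| <= (W * C * C * C + W * (C * K) * C + W * C * C) * (v - u) `^ gamma.
Proof.
move=> u0 uv v1; have v0 := le_trans u0 uv; have u1 := le_trans uv v1.
have d0 : 0 <= (v - u) `^ gamma := powR_ge0 _ _.
rewrite /G subM3.
apply: normD_leM.
  apply: normD_leM.
    rewrite (_ : W * C * C * C * _ = W * C * (v - u) `^ gamma * C * C); last ring.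
    apply: normM_le; last exact: Ule.
    apply: normM_le; last exact: (lamp_wronskian_le L).
    by apply: le_trans (Elip u0 uv v1) _ || apply: le_trans (EVlip u0 uv v1) _; rewrite ler_wpM2l ?mulr_ge0// dle.
  rewrite (_ : W * (C * K) * C * _ = W * (C * K * (v - u) `^ gamma) * C); last ring.
  apply: normM_le; last exact: Ule.
  apply: normM_le; first exact: EVle.
  exact: (path_hoelder L PP (F := fun y => wronskian b sigma y / sigma y) (lamp_wronskian_lip L)).
rewrite (_ : W * C * C * _ = W * C * (C * (v - u) `^ gamma)); last ring.
apply: normM_le.
  by apply: normM_le; [exact: EVle | exact: (lamp_wronskian_le L)].
by apply: le_trans (Ulip u0 uv v1) _; rewrite ler_wpM2l// dle.
Qed.

Let cont_lip (F : R -> R) (M : R) :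
  (forall u v, 0 <= u -> u <= v -> v <= 1 -> `|F v - F u| <= M * (v - u)) ->
  {within `[0, 1], continuous F}.
Proof.
move=> FM; apply: (within_continuous_dominated (g := fun u => u) (C := M)).
  by apply: continuous_subspaceT => r; exact: cvg_id.
move=> u v; rewrite /= !in_itv/= => /andP[u0 u1] /andP[v0 v1].
have [uv|/ltW vu] := leP u v.
  by rewrite distrC (distrC u) [X in _ * X]ger0_norm ?subr_ge0// FM.
by rewrite [X in _ * X]ger0_norm ?subr_ge0// FM.
Qed.

Let cG : {within `[0, 1], continuous G}.
Proof.
move=> r; apply: cvgM; last exact: (cont_lip Ulip).
by apply: cvgM; [exact: (cont_lip EVlip) | exact: cq].
Qed.

Let I t := int0 G t.

Let Ilip u v : 0 <= u -> u <= v -> v <= 1 -> `|I v - I u| <= W * C * C * (v - u).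
Proof. by apply: int0_lipschitz => // r; exact: Gle. Qed.

Let Ile t : 0 <= t -> t <= 1 -> `|I t| <= W * C * C.
Proof. by apply: bounded_from_lipschitz => //; [exact: int00 | rewrite !mulr_ge0]. Qed.

Lemma Zpath0 : Z 0 = 0.
Proof. by rewrite /Z /Zpath -/U U0 int00 mulr0 addr0. Qed.

Let Zbound t : 0 <= t -> t <= 1 -> `|Z t| <= C + W * (W * C * C).
Proof.
move=> t0 t1; apply: le_trans (ler_normD _ _) _; apply: lerD; first exact: Ule.
by apply: normM_le; [exact: Ele | exact: Ile].
Qed.

(** Each of the four terms of the splitting has a factor of order [v - u] and another of order at
    most [(v - u)^gamma], which comes from a frozen coefficient or from a further increment. *)
Let Zincr u v : 0 <= u -> u <= v -> v <= 1 ->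
  `|Z v - Z u - (qx u * Z u - fx u / 2) * (v - u)| <=
  (C * K + (W * (C * C) + W * (C * K)) * (W * C * C) + C * W * (W * C * C)
  + W * (W * C * C * C + W * (C * K) * C + W * C * C)) * (v - u) `^ gamma * (v - u).
Proof.
move=> u0 uv v1; have v0 := le_trans u0 uv; have u1 := le_trans uv v1.
set d := v - u; have d0 : 0 <= d by rewrite subr_ge0.
set e := d `^ gamma; have e0 : 0 <= e := powR_ge0 _ _.
have de : d <= e := dle u0 uv v1.
have ef r : u <= r -> r <= v -> (r - u) `^ gamma <= e.
  by move=> ur rv; apply: powR_le; rewrite ?subr_ge0 ?lerD2r//; exact: ltW.
rewrite /Z /Zpath -/U -/E -/(I v) -/(I u) variation_of_constants_increment ?gt_eqF//.
rewrite -[X in _ <= X]mulrA; apply: normD_leM; last first.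
  rewrite -[X in _ <= X]mulrA; apply: normM_le; first exact: Ele.
  rewrite [X in _ <= X]mulrA; apply: int0_increment01 => // r ur rv.
  apply: le_trans (Ghoelder u0 ur (le_trans rv v1)) _; rewrite ler_wpM2l ?ef//.
  by rewrite !addr_ge0// !mulr_ge0.
apply: normD_leM; last first.
  rewrite (_ : C * W * (W * C * C) * (e * d) = C * W * d * (W * C * C * e)); last ring.
  apply: normM_le.
    apply: normM_le; last by rewrite ger0_norm.
    by apply: normM_le; [exact: (lamp_wronskian_le L) | exact: Ele].
  apply: le_trans (Ilip u0 uv v1) _; rewrite ler_wpM2l// !mulr_ge0//.
apply: normD_leM.
  rewrite [X in _ <= X]mulrA; apply: int0_increment01 => // r ur rv.
  have -> : - derive1 sigma (x r) / 2 - - fx u / 2 = - (2^-1 * (derive1 sigma (x r) - derive1 sigma (x u))).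
    by rewrite /fx; ring.
  have h := path_hoelder L PP (lamp_sigma'_lip L) u0 ur (le_trans rv v1).
  rewrite normrN normrM ger0_norm ?invr_ge0//.
  apply: (@le_trans _ _ (C * K * (r - u) `^ gamma)).
    by apply: le_trans h; rewrite ler_piMl//; lra.
  by rewrite ler_wpM2l ?mulr_ge0// ef.
rewrite (_ : _ * _ * (e * d) = (W * (C * C) + W * (C * K)) * (e * d) * (W * C * C)); last ring.
apply: normM_le; last exact: Ile.
rewrite (exp_increment _ _ (int0 qx u) (int0 qx v)).
apply: normD_leM.
  have [_ h] := expR_taylor C0 (Qle u0 u1) (Qle v0 v1).
  apply: le_trans h _; rewrite -mulrA ler_wpM2l//.
  rewrite -(real_normK (num_real (int0 qx v - _))) expr2.
  rewrite (_ : C * C * (e * d) = C * e * (C * d)); last ring.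
  apply: ler_pM => //; last exact: Qlip.
  by apply: le_trans (Qlip u0 uv v1) _; rewrite ler_wpM2l.
rewrite -[X in _ <= X]mulrA; apply: normM_le; first exact: Ele.
rewrite [X in _ <= X]mulrA; apply: int0_increment01 => // r ur rv.
apply: le_trans (path_hoelder L PP (F := fun y => wronskian b sigma y / sigma y) (lamp_wronskian_lip L) u0 ur (le_trans rv v1)) _.
by rewrite ler_wpM2l ?mulr_ge0// ef.
Qed.

Let Zparts : [/\ 0 <= C * K + (W * (C * C) + W * (C * K)) * (W * C * C) + C * W * (W * C * C)
    + W * (W * C * C * C + W * (C * K) * C + W * C * C),
    0 <= C + W * (W * C * C) & 0 <= C * (C + W * (W * C * C)) + C].
Proof. by split; nonneg. Qed.

Lemma Zconst_ge0 : 0 <= Zconst C K.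
Proof. by case: Zparts => *; rewrite /Zconst -/W; lra. Qed.

Lemma Zpath_increment u v : 0 <= u -> u <= v -> v <= 1 ->
  `|Z v - Z u - (qx u * Z u - fx u / 2) * (v - u)| <= Zconst C K * (v - u) `^ gamma * (v - u).
Proof.
move=> u0 uv v1; apply: le_trans (Zincr u0 uv v1) _; rewrite ler_wpM2r ?subr_ge0//.
by rewrite ler_wpM2r ?powR_ge0//; case: Zparts => *; rewrite /Zconst -/W; lra.
Qed.

Lemma Zpath_lipschitz u v : 0 <= u -> u <= v -> v <= 1 ->
  `|Z v - Z u| <= Zconst C K * (v - u).
Proof.
move=> u0 uv v1; have v0 := le_trans u0 uv; have u1 := le_trans uv v1.
have d0 : 0 <= v - u by rewrite subr_ge0.
have -> : Z v - Z u = (Z v - Z u - (qx u * Z u - fx u / 2) * (v - u))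
  + (qx u * Z u + - fx u / 2) * (v - u) by ring.
apply: le_trans (ler_normD _ _) _.
have h2 : `|(qx u * Z u + - fx u / 2) * (v - u)| <= (C * (C + W * (W * C * C)) + C) * (v - u).
  apply: normM_le; last by rewrite ger0_norm.
  apply: le_trans (ler_normD _ _) _; apply: lerD; last exact: f2_le.
  by apply: normM_le; [exact: (lamp_wronskian_le L) | exact: Zbound].
apply: le_trans (lerD (Zincr u0 uv v1) h2) _; rewrite -mulrDl ler_wpM2r//.
case: Zparts => h1 *; apply: (@le_trans _ _ (C * K + (W * (C * C) + W * (C * K)) * (W * C * C) + C * W * (W * C * C)
    + W * (W * C * C * C + W * (C * K) * C + W * C * C) + (C * (C + W * (W * C * C)) + C))).
  rewrite lerD2r ler_piMr// powR_le1//; last exact: ltW.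
  by rewrite lerBlDr (le_trans v1)// lerDl.
by rewrite /Zconst -/W; lra.
Qed.

(** In [J_t / J_s] the factor [1 / sigma (x s)] turns the Wronskian into the coefficient of the
    linear equation, and [sigma (x t)] comes out of the integral. *)
Lemma limit_path_lamperti t : 0 <= t -> t <= 1 ->
  limit_path b sigma g x t = sigma (x t) * Z t.
Proof.
move=> t0 t1; rewrite /limit_path (Jpath_lamperti L PP) // /Z /Zpath -/U -/E mulrDr.
congr (_ + _).
have -> : int0 (fun s => (Jpath b sigma g x s)^-1 * wronskian b sigma (x s) * Upath sigma x s) t
   = sigma xi * int0 G t - int0 (fun=> 0) t.
  rewrite -int0_lin01//; last by move=> r; exact: cvg_cst.
  apply: eq_int0 => // s s0 st; rewrite (Jpath_lamperti L PP) ?(le_trans st)//.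
  rewrite /G -/E -/U /qx; field.
  by rewrite !gt_eqF// (lamp_sigma_gt0 L).
rewrite int0_cst0.
rewrite /E; field; rewrite gt_eqF// ?(lamp_sigma_gt0 L)//.
Qed.

End Zpath.

Local Transparent int0 expR.

(** * The error recursion of the Euler scheme *)

(** By induction the right-hand side of the recursion is at most [B (1 + c h)^k], and
    [(1 + c h)^k <= exp (c N h) <= exp c]. *)
Lemma gronwall_sum {R : realType} (a : nat -> R) (B c h : R) (N : nat) :
  0 <= c -> 0 <= h -> 0 <= B -> N%:R * h <= 1 -> (forall k, 0 <= a k) ->
  (forall k, (k <= N)%N -> a k <= B + c * h * \sum_(0 <= j < k) a j) ->
  forall k, (k <= N)%N -> a k <= B * expR c.
Proof.
move=> c0 h0 B0 Nh a0 aB k kN.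
have ch0 : 0 <= c * h by rewrite mulr_ge0.
have main : B + c * h * \sum_(0 <= j < k) a j <= B * (1 + c * h) ^+ k.
  elim: k kN => [|k IH] kN; first by rewrite big_geq// mulr0 addr0 expr0 mulr1.
  have {}IH := IH (ltnW kN).
  rewrite big_nat_recr//= mulrDr addrA exprSr mulrA [X in _ <= X]mulrDr mulr1.
  apply: lerD => //; rewrite [X in _ <= X]mulrC ler_wpM2l//.
  by apply: le_trans (aB _ (ltnW kN)) _.
apply: le_trans (aB _ kN) _; apply: le_trans main _; rewrite ler_wpM2l//.
apply: (@le_trans _ _ (expR (c * h) ^+ k)).
  by rewrite lerXn2r ?nnegrE ?expR_ge0 ?addr_ge0// expR_ge1Dx.
rewrite -expRM_natl ler_expR -[X in _ <= X]mulr1 mulrCA ler_wpM2l//.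
by apply: le_trans Nh; rewrite ler_wpM2r// ler_nat.
Qed.

Lemma dyadicS {R : realType} (m k : nat) : dyadic R m k.+1 = dyadic R m k + 2 ^- m.
Proof. by rewrite /dyadic -natr1 mulrDl mul1r. Qed.

Lemma dyadic_ge0 {R : realType} (m k : nat) : 0 <= dyadic R m k.
Proof. by rewrite mulr_ge0// invr_ge0 exprn_ge0. Qed.

Lemma dyadic_top {R : realType} (m : nat) : dyadic R m (2 ^ m) = 1.
Proof. by rewrite /dyadic natrX divff// expf_neq0. Qed.

Lemma dyadic_le {R : realType} (m j k : nat) : (j <= k)%N -> dyadic R m j <= dyadic R m k.
Proof. by move=> jk; rewrite ler_wpM2r ?ler_nat// invr_ge0 exprn_ge0. Qed.

Lemma dyadic_le1 {R : realType} (m k : nat) : (k <= 2 ^ m)%N -> dyadic R m k <= 1.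
Proof. by move=> kN; rewrite -(@dyadic_top R m) dyadic_le. Qed.

Lemma dyadic_cover {R : realType} (m : nat) (t : R) : 0 <= t -> t <= 1 ->
  exists2 k, (k < 2 ^ m)%N & dyadic R m k <= t <= dyadic R m k.+1.
Proof.
move=> t0 t1.
have h0 : 0 < 2 ^- m :> R by rewrite invr_gt0 exprn_gt0.
have [->|tn0] := eqVneq t 0.
  by exists 0%N; rewrite ?expn_gt0// dyadic_ge0 /dyadic mul0r lexx.
have ex : exists k, t <= dyadic R m k by exists (2 ^ m)%N; rewrite dyadic_top.
case: (ex_minnP ex) => -[|k] tk kmin.
  by move: tk; rewrite /dyadic mul0r leNgt lt_neqAle eq_sym tn0 t0.
exists k; last first.
  rewrite tk andbT leNgt; apply/negP => /ltW /kmin; by rewrite ltnn.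
by apply: kmin; rewrite dyadic_top.
Qed.

(** In the third-order expansion of [S] the square of [b ta + s D] is multiplied out. Its [D^2] part
    is kept; the mixed term and the [ta^2] term move to the remainder. *)
Lemma step_algebra {R : realType} (b s Sy Sa ta D s' : R) : s != 0 ->
  Sy - Sa - (b / s * ta + D) + s' / 2 * D ^+ 2 =
  (Sy - Sa - (b * ta + s * D) / s + s' / (2 * s ^+ 2) * (b * ta + s * D) ^+ 2)
  - s' * (b / s) * (ta * D) - s' / 2 * (b / s) ^+ 2 * ta ^+ 2.
Proof. by move=> s0; field. Qed.

(** [d] stands for [h^gamma]. The Taylor remainder is of order [d^3], the mixed term of order [h d],
    and [ta^2] is absorbed into the latter because [h <= d]. *)
Lemma lamperti_euler_step {R : realType} (b sigma S : R -> R) (C K a ta D h d : R) :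
  lamperti b sigma S C -> 0 <= K -> 0 <= ta -> ta <= h -> h <= d -> `|D| <= K * d ->
  `|S (a + b a * ta + sigma a * D) - S a - (b a / sigma a * ta + D) + derive1 sigma a / 2 * D ^+ 2|
  <= (C ^+ 2 * K + C ^+ 3 + C ^+ 4 * (1 + K) ^+ 3) * (h * d + d ^+ 3).
Proof.
move=> L K0 ta0 tah hd DK.
have C0 : 0 <= C := le_trans ler01 (lamp_C1 L).
have h0 := le_trans ta0 tah; have d0 := le_trans h0 hd.
have sp : 0 < sigma a := lamp_sigma_gt0 L a.
rewrite step_algebra ?gt_eqF//.
have cC := lamp_drift_le L a; have s'C := lamp_sigma'_le L a.
have h3 := lamp_taylor3 L a (a + b a * ta + sigma a * D).
have ye : a + b a * ta + sigma a * D - a = b a * ta + sigma a * D by ring.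
rewrite ye in h3.
have y3 : `|b a * ta + sigma a * D| <= C * (1 + K) * d.
  rewrite (_ : C * (1 + K) * d = C * d + C * (K * d)); last ring.
  apply: le_trans (ler_normD _ _) _; apply: lerD; apply: normM_le => //.
  - exact: (lamp_b_le L).
  - by rewrite ger0_norm// (le_trans tah).
  - by rewrite gtr0_norm// (lamp_sigma_le L).
have t3 : `|S (a + b a * ta + sigma a * D) - S a - (b a * ta + sigma a * D) / sigma a
    + derive1 sigma a / (2 * sigma a ^+ 2) * (b a * ta + sigma a * D) ^+ 2|
    <= C ^+ 4 * (1 + K) ^+ 3 * d ^+ 3.
  apply: le_trans h3 _; rewrite (_ : C ^+ 4 * _ * _ = C * (C * (1 + K) * d) ^+ 3); last ring.
  by rewrite ler_wpM2l// lerXn2r ?nnegrE// !mulr_ge0// addr_ge0.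
have t1 : `|derive1 sigma a * (b a / sigma a) * (ta * D)| <= C ^+ 2 * K * (h * d).
  rewrite (_ : C ^+ 2 * K * (h * d) = C * C * (h * (K * d))); last ring.
  by apply: normM_le; apply: normM_le => //; rewrite ger0_norm.
have t2 : `|derive1 sigma a / 2 * (b a / sigma a) ^+ 2 * ta ^+ 2| <= C ^+ 3 * (h * d).
  rewrite (_ : C ^+ 3 * (h * d) = C * C ^+ 2 * (h * d)); last ring.
  have sq_le (u v : R) : `|u| <= v -> `|u ^+ 2| <= v ^+ 2.
    by move=> uv; rewrite normrX lerXn2r ?nnegrE// (le_trans _ uv).
  apply: normM_le; last first.
    by rewrite expr2; apply: normM_le; rewrite ger0_norm// (le_trans tah).
  apply: normM_le; last exact: sq_le.
  rewrite normrM (@ger0_norm _ 2^-1) ?invr_ge0//; apply: le_trans s'C.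
  by rewrite ler_piMr//; lra.
apply: le_trans (ler_normB _ _) _; apply: le_trans (lerD (ler_normB _ _) (lexx _)) _.
apply: le_trans (lerD (lerD t3 t1) t2) _.
have hd0 : 0 <= h * d by rewrite mulr_ge0.
have d30 : 0 <= d ^+ 3 by rewrite exprn_ge0.
have k1 : 0 <= C ^+ 2 * K by nonneg.
have k2 : 0 <= C ^+ 3 by nonneg.
have k3 : 0 <= C ^+ 4 * (1 + K) ^+ 3 by nonneg.
rewrite (mulrDr (_ + _ + _)) !(mulrDl _ _ (h * d)) !(mulrDl _ _ (d ^+ 3)).
have := mulr_ge0 k1 d30; have := mulr_ge0 k2 d30; have := mulr_ge0 k3 hd0.
by set A1 := _ * (h * d); set A2 := _ * d ^+ 3; set A3 := _ * d ^+ 3;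
   set A4 := _ * (h * d); set A5 := _ * (h * d); set A6 := _ * d ^+ 3; lra.
Qed.

(** This constant and those built on it depend on [C] and [K] alone, which makes the error bound
    uniform over [m] and over all paths with Hölder constant [K]. The last summand pays for freezing
    the drift of [x] during a step. *)
Definition step_const {R : realType} (C K : R) : R :=
  C ^+ 2 * K + C ^+ 3 + C ^+ 4 * (1 + K) ^+ 3 + C * K.

(** The Gronwall bound: the scaled squared increments sum to at most 2 and have the coefficient
    [C / 2], which gives [C]; the rest are step remainders. *)
Definition scaled_error_const {R : realType} (C K : R) : R :=
  (C + 2 * step_const C K) * expR C.

Definition remainder_const {R : realType} (C K : R) : R :=
  C * scaled_error_const C K ^+ 2 + C * scaled_error_const C K
  + 2 * step_const C K + Zconst C K.

Definition within_step_const {R : realType} (C K : R) : R :=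
  C * scaled_error_const C K + C * K ^+ 2 + 2 * step_const C K.

Definition euler_const {R : realType} (C K : R) : R :=
  C * (scaled_error_const C K + within_step_const C K) ^+ 2
  + C * ((1 + remainder_const C K) * expR C + within_step_const C K + Zconst C K).

Section euler_error.
Context {R : realType} (b sigma S : R -> R) (C xi K gamma : R) (g x : R -> R).
Context (L : lamperti b sigma S C) (PP : lamperti_path b sigma S xi K gamma g x).
Context (gamma_gt : 1 / 2 < gamma) (gamma_le : gamma <= 1) (K0 : 0 <= K).
Context (m : nat) (xbar : R -> R) (EU : euler_scheme b sigma xi g m xbar).
Context (lam s theta : R).

Let N := (2 ^ m)%N.
Let h : R := 2 ^- m.
Let d : R := h `^ gamma.
Let tk k := dyadic R m k.
Let Dl k := g (tk k.+1) - g (tk k).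
Let Z := Zpath b sigma x.

(* lam stands for 2^(m(2H - 1)), s for a quantity that tends to 0 with m, and theta for
   the error in the weighted quadratic variation. *)
Context (lam0 : 0 < lam) (s1 : s <= 1) (ds : d <= s) (lamVs : lam^-1 <= s)
  (lamd : lam * d <= s) (lamd3 : lam * d ^+ 3 <= s * h)
  (lamQ : \sum_(0 <= j < N) lam * Dl j ^+ 2 <= 2)
  (lamW : forall k, (k <= N)%N ->
     `|\sum_(0 <= j < k) derive1 sigma (x (tk j)) * (lam * Dl j ^+ 2 - h)| <= theta).

Let C0 : 0 <= C := le_trans ler01 (lamp_C1 L).
Let gamma0 : 0 < gamma. Proof. by apply: lt_trans gamma_gt; rewrite divr_gt0. Qed.
Let h_gt0 : 0 < h. Proof. by rewrite invr_gt0 exprn_gt0. Qed.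
Let h1 : h <= 1. Proof. by rewrite invf_le1 ?exprn_gt0// exprn_ege1// ler1n. Qed.
Let hd : h <= d.
Proof.
rewrite -[X in X <= _]powRr1 ?(ltW h_gt0)//; apply: powR_exp_le => //; exact: ltW.
Qed.
Let d0 : 0 <= d. Proof. exact: powR_ge0. Qed.
Let s0 : 0 <= s. Proof. exact: le_trans ds. Qed.
Let hs : h <= s. Proof. exact: le_trans ds. Qed.
Let Nh : N%:R * h = 1. Proof. exact: dyadic_top. Qed.
Let theta0 : 0 <= theta.
Proof. by apply: le_trans (lamW (leq0n _)); rewrite normr_ge0. Qed.

Let tkS k : tk k.+1 = tk k + h. Proof. exact: dyadicS. Qed.
Let tk0 k : 0 <= tk k. Proof. exact: dyadic_ge0. Qed.
Let tk1 k : (k <= N)%N -> tk k <= 1. Proof. exact: dyadic_le1. Qed.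

Let et t := S (xbar t) - S (x t).
Let K2 := step_const C K.
Let K3 := scaled_error_const C K.
Let KZ := Zconst C K.

Let K20 : 0 <= K2. Proof. by rewrite /K2 /step_const; nonneg. Qed.
Let K30 : 0 <= K3.
Proof. by rewrite /K3 /scaled_error_const mulr_ge0 ?expR_ge0 ?addr_ge0 ?mulr_ge0. Qed.
Let KZ0 : 0 <= KZ. Proof. exact: (@Zconst_ge0 R b sigma S C K L K0). Qed.

Lemma euler_stepE k t : (k < N)%N -> tk k <= t -> t <= tk k.+1 ->
  xbar t = xbar (tk k) + b (xbar (tk k)) * (t - tk k) + sigma (xbar (tk k)) * (g t - g (tk k)).
Proof.
move=> kN kt tk'; have [->|tn] := eqVneq t (tk k); first by rewrite !subrr !mulr0 !addr0.
by apply: (EU.2 k t kN); rewrite tk' andbT lt_neqAle eq_sym tn.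
Qed.

Let time_in k t : (k < N)%N -> tk k <= t -> t <= tk k.+1 -> [/\ 0 <= t, t <= 1, 0 <= t - tk k & t - tk k <= h].
Proof.
move=> kN kt tk'; split.
- exact: le_trans kt.
- by apply: le_trans tk' _; apply: tk1.
- by rewrite subr_ge0.
- by rewrite lerBlDr addrC -tkS.
Qed.

Let g_incr k t : (k < N)%N -> tk k <= t -> t <= tk k.+1 -> `|g t - g (tk k)| <= K * d.
Proof.
move=> kN kt tk'; have [t0 t1 dt0 dth] := time_in kN kt tk'.
case: PP => _ _ _ gK _; apply: le_trans (gK _ _ (tk0 k) kt t1) _.
by rewrite ler_wpM2l// powR_le// ltW.
Qed.

(** The increment of [g] enters [S (xbar)] and [S (x)] with the same coefficient 1 and cancels: this
    is the gain from additive noise. *)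
Lemma lamperti_error_step k t : (k < N)%N -> tk k <= t -> t <= tk k.+1 ->
  `|et t - et (tk k) - (b (xbar (tk k)) / sigma (xbar (tk k)) - b (x (tk k)) / sigma (x (tk k))) * (t - tk k)
    + derive1 sigma (xbar (tk k)) / 2 * (g t - g (tk k)) ^+ 2| <= K2 * (h * d + d ^+ 3).
Proof.
move=> kN kt tk'; have [t0 t1 dt0 dth] := time_in kN kt tk'.
have st := lamperti_euler_step (xbar (tk k)) L K0 dt0 dth hd (g_incr kN kt tk').
rewrite -(euler_stepE kN kt tk') in st.
case: PP => _ _ SxE _ _.
pose I := int0 (fun u => b (x u) / sigma (x u)).
have hI : `|I t - I (tk k) - b (x (tk k)) / sigma (x (tk k)) * (t - tk k)| <= C * K * (h * d).
  rewrite (_ : C * K * (h * d) = C * K * d * h); last ring.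
  apply: (@le_trans _ _ (C * K * d * (t - tk k))); last by rewrite ler_wpM2l// !mulr_ge0.
  apply: int0_increment01 => //.
    exact: (path_within_continuous PP (F := fun y => b y / sigma y) (lamp_drift_lip L)).
  move=> r kr rt.
  apply: le_trans (path_hoelder L PP (F := fun y => b y / sigma y) (lamp_drift_lip L) (tk0 k) kr (le_trans rt t1)) _.
  rewrite ler_wpM2l ?mulr_ge0// powR_le ?(ltW gamma0)// ?subr_ge0//.
  by apply: le_trans dth; rewrite lerD2r.
have -> : et t - et (tk k) - (b (xbar (tk k)) / sigma (xbar (tk k)) - b (x (tk k)) / sigma (x (tk k))) * (t - tk k)
    + derive1 sigma (xbar (tk k)) / 2 * (g t - g (tk k)) ^+ 2 =
  (S (xbar t) - S (xbar (tk k)) - (b (xbar (tk k)) / sigma (xbar (tk k)) * (t - tk k) + (g t - g (tk k)))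
    + derive1 sigma (xbar (tk k)) / 2 * (g t - g (tk k)) ^+ 2)
  - (I t - I (tk k) - b (x (tk k)) / sigma (x (tk k)) * (t - tk k)).
  by rewrite /et (SxE t)// (SxE (tk k)) ?tk1// 1?ltnW// -/I; ring.
apply: le_trans (ler_normB _ _) _; apply: le_trans (lerD st hI) _.
rewrite /K2 /step_const [X in _ <= X]mulrDl lerD2l ler_wpM2l ?mulr_ge0//.
by rewrite lerDl exprn_ge0.
Qed.

Let lamrho : lam * (h * d + d ^+ 3) <= 2 * s * h.
Proof.
rewrite mulrDr (_ : 2 * s * h = s * h + s * h); last ring.
by apply: lerD => //; rewrite mulrCA (mulrC s) ler_wpM2l// ltW.
Qed.

Let e0 : et (tk 0) = 0.
Proof.
have t00 : tk 0 = 0 by rewrite /tk /dyadic mul0r.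
by rewrite /et t00 EU.1 (path_start L PP) subrr.
Qed.

Let sum_h k : (k <= N)%N -> \sum_(0 <= j < k) h <= 1.
Proof.
move=> kN; rewrite sumr_const_nat subn0 -mulr_natl; apply: (@le_trans _ _ (N%:R * h)).
  by rewrite ler_wpM2r ?ler_nat// ltW.
by rewrite Nh.
Qed.

Let sum_Q k : (k <= N)%N -> \sum_(0 <= j < k) lam * Dl j ^+ 2 <= 2.
Proof.
move=> kN; apply: le_trans lamQ; rewrite (big_cat_nat (n := k) (p := N))//= lerDl.
by apply: sumr_ge0 => j _; rewrite mulr_ge0 ?sqr_ge0// ltW.
Qed.

(** A crude form in absolute values, without cancellation in the source. It determines the size of
    the error and its variation inside a step. *)
Let scaled_step k t : (k < N)%N -> tk k <= t -> t <= tk k.+1 ->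
  lam * `|et t - et (tk k)| <= C * h * (lam * `|et (tk k)|) + C / 2 * (lam * (g t - g (tk k)) ^+ 2)
    + 2 * K2 * s * h.
Proof.
move=> kN kt tk'; have [t0 t1 dt0 dth] := time_in kN kt tk'.
have hh := lamperti_error_step kN kt tk'.
set cc := b (xbar _) / _ - _ in hh.
have hc : `|cc * (t - tk k)| <= C * `|et (tk k)| * h.
  by apply: normM_le; [exact: (lamp_drift_lip L) | rewrite ger0_norm].
have hs' : `|derive1 sigma (xbar (tk k)) / 2 * (g t - g (tk k)) ^+ 2| <= C / 2 * (g t - g (tk k)) ^+ 2.
  apply: normM_le; last by rewrite ger0_norm ?sqr_ge0.
  by rewrite normrM (@ger0_norm _ 2^-1) ?invr_ge0// ler_wpM2r ?invr_ge0// (lamp_sigma'_le L).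
have h3 : `|et t - et (tk k)| <= C * `|et (tk k)| * h + C / 2 * (g t - g (tk k)) ^+ 2 + K2 * (h * d + d ^+ 3).
  move: hh hc hs'; set A1 := cc * _; set A2 := derive1 sigma (xbar (tk k)) / 2 * (g t - g (tk k)) ^+ 2; set A0 := et t - et (tk k) => hh hc hs'.
  have -> : A0 = A1 - A2 + (A0 - A1 + A2) by ring.
  apply: le_trans (ler_normD _ _) _; apply: lerD => //.
  by apply: le_trans (ler_normB _ _) _; apply: lerD.
apply: le_trans (ler_wpM2l (ltW lam0) h3) _; rewrite 2!(mulrDr lam); apply: lerD; first apply: lerD.
- by rewrite le_eqVlt; apply/orP; left; apply/eqP; ring.
- by rewrite mulrCA.
- rewrite mulrCA (_ : 2 * K2 * s * h = K2 * (2 * s * h)); last ring.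
  by rewrite ler_wpM2l.
Qed.

(** The source terms have a bounded sum, so Gronwall applies. This a priori bound makes quadratic
    terms negligible: [lam] times the squared error is of order [lam^-1 <= s]. *)
Lemma scaled_error_le k : (k <= N)%N -> lam * `|et (tk k)| <= K3.
Proof.
apply: (gronwall_sum (h := h) (B := C + 2 * K2) (c := C) (N := N) (a := fun j => lam * `|et (tk j)|)) => //.
- exact: ltW.
- by rewrite addr_ge0// mulr_ge0.
- by rewrite Nh.
- by move=> j; rewrite mulr_ge0// ltW.
move=> {}k kN.
have -> : et (tk k) = \sum_(0 <= j < k) (et (tk j.+1) - et (tk j)).
  by rewrite (telescope_sumr (fun j => et (tk j)))// e0 subr0.
apply: (@le_trans _ _ (\sum_(0 <= j < k) lam * `|et (tk j.+1) - et (tk j)|)).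
  by rewrite -big_distrr/= ler_wpM2l ?(ltW lam0)// ler_norm_sum.
apply: (@le_trans _ _ (\sum_(0 <= j < k) (C * h * (lam * `|et (tk j)|) + C / 2 * (lam * Dl j ^+ 2) + 2 * K2 * s * h))).
  rewrite !big_nat; apply: ler_sum => j /= jk; apply: scaled_step => //.
    exact: leq_trans kN.
  by rewrite tkS lerDl ltW.
rewrite !big_split/= -big_distrr/= -addrA [X in _ <= X]addrC lerD2l; apply: lerD.
  have hC2 : 0 <= C / 2 by rewrite divr_ge0.
  rewrite -big_distrr/=; apply: le_trans (ler_wpM2l hC2 (sum_Q kN)) _.
  by rewrite divfK.
rewrite -big_distrr/= -[X in _ <= X]mulr1; apply: ler_pM => //.
- by rewrite !mulr_ge0.
- by apply: sumr_ge0 => j _; exact: ltW.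
- by rewrite ler_piMr// mulr_ge0.
- exact: sum_h.
Qed.

Let error_le k : (k <= N)%N -> `|et (tk k)| <= K3 * s.
Proof.
move=> kN; apply: (@le_trans _ _ (K3 * lam^-1)); last by rewrite ler_wpM2l.
by rewrite ler_pdivlMr// mulrC scaled_error_le.
Qed.

(** Four errors separate the two recursions: the step remainder, the linearized drift, [sigma']
    taken at [xbar] in place of [x], and the discretization of [Z]. All carry a factor [s]. The term
    with [lam D^2 - h] keeps its sign, since only its sums are small. *)
Let scaled_remainder k : (k < N)%N ->
  let y k := lam * et (tk k) - Z (tk k) in
  `|y k.+1 - y k - h * (wronskian b sigma (x (tk k)) / sigma (x (tk k))) * y k
    + 2^-1 * (derive1 sigma (x (tk k)) * (lam * Dl k ^+ 2 - h))|
  <= s * ((C * K3 ^+ 2 + 2 * K2 + KZ) * h) + s * (C * K3 / 2 * (lam * Dl k ^+ 2)).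
Proof.
move=> kN; rewrite /=; have kN' := ltnW kN.
have ktk : tk k <= tk k.+1 by rewrite tkS lerDl ltW.
have hh := lamperti_error_step kN ktk (lexx _).
have dtE : tk k.+1 - tk k = h by rewrite tkS; ring.
rewrite dtE -/(Dl k) in hh.
have hz := Zpath_increment L PP gamma_gt gamma_le K0 (tk0 k) ktk (tk1 kN).
rewrite dtE -/Z -/d -/KZ in hz.
have ht := lamp_drift_taylor2 L (x (tk k)) (xbar (tk k)).
have hs' := lamp_sigma'_lip L (x (tk k)) (xbar (tk k)).
rewrite -/(et (tk k)) in ht hs'.
have eK := scaled_error_le kN'; have es := error_le kN'.
move: hh hz ht hs' eK es.
set e := et (tk k); set e' := et (tk k.+1); set z := Z (tk k); set z' := Z (tk k.+1).
set q := wronskian _ _ _ / _; set f := derive1 sigma (x _); set fb := derive1 sigma (xbar _).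
set D := Dl k; set cb := b (xbar _) / _; set c := b (x _) / _.
move=> hh hz ht hs' eK es.
have D2 : 0 <= lam * D ^+ 2 by rewrite mulr_ge0 ?sqr_ge0// ltW.
have -> : lam * e' - z' - (lam * e - z) - h * q * (lam * e - z) + 2^-1 * (f * (lam * D ^+ 2 - h)) =
  lam * (e' - e - (cb - c) * h + fb / 2 * D ^+ 2) + h * (lam * (cb - c - q * e))
  - (fb - f) * (2^-1 * (lam * D ^+ 2)) - (z' - z - (q * z - f / 2) * h) by field.
have b1 : `|lam * (e' - e - (cb - c) * h + fb / 2 * D ^+ 2)| <= 2 * K2 * s * h.
  rewrite normrM gtr0_norm//; apply: le_trans (ler_wpM2l (ltW lam0) hh) _.
  rewrite mulrCA (_ : 2 * K2 * s * h = K2 * (2 * s * h)); last ring.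
  by rewrite ler_wpM2l.
have b2 : `|h * (lam * (cb - c - q * e))| <= h * (C * (K3 * (K3 * s))).
  rewrite normrM gtr0_norm// ler_wpM2l ?(ltW h_gt0)// normrM gtr0_norm//.
  apply: le_trans (ler_wpM2l (ltW lam0) ht) _; rewrite mulrCA ler_wpM2l//.
  rewrite -(real_normK (num_real e)) expr2 [X in X <= _]mulrA; apply: ler_pM => //.
  by rewrite mulr_ge0// ltW.
have b3 : `|(fb - f) * (2^-1 * (lam * D ^+ 2))| <= C * (K3 * s) * (2^-1 * (lam * D ^+ 2)).
  apply: normM_le; last by rewrite ger0_norm// mulr_ge0// invr_ge0.
  by apply: le_trans hs' _; rewrite ler_wpM2l.
have b4 : `|z' - z - (q * z - f / 2) * h| <= KZ * s * h.
  by apply: le_trans hz _; rewrite ler_wpM2r ?(ltW h_gt0)// ler_wpM2l.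
apply: le_trans (ler_normB _ _) _; apply: le_trans (lerD (ler_normB _ _) b4) _.
apply: le_trans (lerD (lerD (ler_normD _ _) b3) (lexx _)) _.
apply: le_trans (lerD (lerD (lerD b1 b2) (lexx _)) (lexx _)) _.
by rewrite le_eqVlt; apply/orP; left; apply/eqP; field.
Qed.

(** Gronwall for [y]. The weighted sum of [lam D^2 - h] is bounded as a whole by [theta], before any
    absolute value is taken inside it. *)
Lemma scaled_error_close k : (k <= N)%N ->
  `|lam * et (tk k) - Z (tk k)| <= (2^-1 * theta + s * remainder_const C K) * expR C.
Proof.
have KR0 : 0 <= remainder_const C K.
  by rewrite /remainder_const -/K2 -/K3 -/KZ; nonneg.
pose y j := lam * et (tk j) - Z (tk j); rewrite -/(y k).
apply: (gronwall_sum (h := h) (a := fun j => `|y j|)) => //.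
- exact: ltW.
- by rewrite addr_ge0// mulr_ge0// invr_ge0.
- by rewrite Nh.
move=> {}k kN.
pose q j := wronskian b sigma (x (tk j)) / sigma (x (tk j)).
pose f j := derive1 sigma (x (tk j)) * (lam * Dl j ^+ 2 - h).
pose r j := y j.+1 - y j - h * q j * y j + 2^-1 * f j.
have t00 : tk 0 = 0 by rewrite /tk /dyadic mul0r.
have y0 : y 0%N = 0.
  by rewrite /y e0 t00 mulr0 sub0r /Z (Zpath0 b sigma x) oppr0.
have -> : y k = \sum_(0 <= j < k) (h * q j * y j) - 2^-1 * \sum_(0 <= j < k) f j + \sum_(0 <= j < k) r j.
  rewrite big_distrr/= -sumrB -big_split/=.
  rewrite (eq_bigr (fun j => y j.+1 - y j)); first by rewrite (telescope_sumr y)// y0 subr0.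
  by move=> j _; rewrite /r; ring.
have kjN j : (j < k)%N -> (j < N)%N by move=> jk; exact: leq_trans kN.
rewrite addrC addrA (addrC (2^-1 * theta)) [X in _ <= X]addrC addrA.
apply: le_trans (ler_normB _ _) _; apply: lerD; last first.
  by rewrite normrM (@ger0_norm _ 2^-1) ?invr_ge0// ler_wpM2l ?invr_ge0// lamW.
rewrite addrC; apply: le_trans (ler_normD _ _) _; apply: lerD.
  apply: le_trans (ler_norm_sum _ _ _) _; rewrite big_distrr/=; apply: ler_sum => j _.
  rewrite normrM ler_wpM2r// mulrC; apply: normM_le; first exact: (lamp_wronskian_le L).
  by rewrite ger0_norm// ltW.
apply: le_trans (ler_norm_sum _ _ _) _.
apply: (@le_trans _ _ (\sum_(0 <= j < k) (s * ((C * K3 ^+ 2 + 2 * K2 + KZ) * h) + s * (C * K3 / 2 * (lam * Dl j ^+ 2))))).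
  by rewrite !big_nat; apply: ler_sum => j /= jk; apply: scaled_remainder; exact: kjN.
rewrite big_split/= -!big_distrr/= -mulrDr ler_wpM2l//.
have cK : 0 <= C * K3 ^+ 2 + 2 * K2 + KZ by nonneg.
have cK3 : 0 <= C * K3 / 2 by rewrite divr_ge0// mulr_ge0.
have S1 := ler_wpM2l cK (sum_h kN); have S2 := ler_wpM2l cK3 (sum_Q kN).
rewrite -big_distrr/= in S2; apply: le_trans (lerD S1 S2) _.
by rewrite /remainder_const -/K2 -/K3 -/KZ divfK// mulr1 le_eqVlt; apply/orP; left; apply/eqP; ring.
Qed.

(** Between grid points [lam et] and [Z] move by a multiple of [s]. Then [lamp_inv_taylor2] returns
    to the original coordinate at the cost of [lam] times the squared error. *)
Lemma euler_error_le t : 0 <= t -> t <= 1 ->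
  `|lam * (xbar t - x t) - sigma (x t) * Z t| <= euler_const C K * (s + theta).
Proof.
move=> t0 t1; have [k kN /andP[kt tk']] := dyadic_cover m t0 t1.
have kN' := ltnW kN.
set K4 := within_step_const C K; set KR := remainder_const C K.
have KR0 : 0 <= KR by rewrite /KR /remainder_const -/K2 -/K3 -/KZ; nonneg.
have K40 : 0 <= K4 by rewrite /K4 /within_step_const -/K2 -/K3; nonneg.
have eC0 : 0 <= expR C by exact: expR_ge0.
have step : lam * `|et t - et (tk k)| <= K4 * s.
  apply: le_trans (scaled_step kN kt tk') _.
  rewrite /K4 /within_step_const -/K2 -/K3 [X in _ <= X]mulrDl [X in _ <= X + _]mulrDl.
  apply: lerD; first apply: lerD.
  - by rewrite -mulrA -[X in _ <= X]mulrA ler_wpM2l// mulrC ler_pM// ?scaled_error_le// ?mulr_ge0// ltW.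
  - have g2 : (g t - g (tk k)) ^+ 2 <= K ^+ 2 * d ^+ 2.
      by rewrite -exprMn -(real_normK (num_real (g t - _))) lerXn2r ?nnegrE ?g_incr// mulr_ge0.
    have ld2 : lam * d ^+ 2 <= s.
      rewrite expr2 mulrA; apply: le_trans (ler_pM _ _ lamd ds) _ => //.
        by rewrite mulr_ge0// ltW.
      by rewrite ler_piMr.
    rewrite -(mulrA C) -(mulrA C (K ^+ 2)) ler_wpM2l//.
    apply: (@le_trans _ _ (lam * (g t - g (tk k)) ^+ 2)).
      by apply: ler_piMl; [rewrite mulr_ge0 ?sqr_ge0// ltW | rewrite invf_le1// ler1n].
    apply: le_trans (ler_wpM2l (ltW lam0) g2) _; rewrite mulrCA ler_wpM2l ?sqr_ge0//.
  - by rewrite ler_piMr// !mulr_ge0.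
have zstep : `|Z t - Z (tk k)| <= KZ * s.
  have [_ _ dt0 dth] := time_in kN kt tk'.
  apply: le_trans (Zpath_lipschitz L PP gamma_gt gamma_le K0 (tk0 k) kt t1) _.
  by rewrite ler_wpM2l// (le_trans dth).
have close := scaled_error_close kN'; rewrite -/KR in close.
have yt : `|lam * et t - Z t| <= ((1 + KR) * expR C + K4 + KZ) * (s + theta).
  have -> : lam * et t - Z t = (lam * et (tk k) - Z (tk k)) + lam * (et t - et (tk k)) - (Z t - Z (tk k)) by ring.
  apply: le_trans (ler_normB _ _) _; rewrite mulrDl; apply: lerD; last first.
    by apply: le_trans zstep _; rewrite ler_wpM2l// lerDl.
  apply: le_trans (ler_normD _ _) _; rewrite mulrDl; apply: lerD; last first.
    rewrite normrM gtr0_norm//; apply: le_trans step _; rewrite ler_wpM2l// lerDl//.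
  apply: le_trans close _; rewrite mulrAC ler_wpM2r//.
  have p1 : 0 <= KR * theta by rewrite mulr_ge0.
  rewrite (mulrC s KR) [X in _ <= X]mulrDl mul1r (mulrDr KR).
  move: p1; set A := KR * theta; set B := KR * s; have := theta0; have := s0; lra.
have et_le : lam * `|et t| <= K3 + K4.
  apply: (@le_trans _ _ (lam * `|et (tk k)| + lam * `|et t - et (tk k)|)).
    rewrite -mulrDr ler_wpM2l ?(ltW lam0)// -{1}(subrK (et (tk k)) (et t)) addrC.
    exact: ler_normD.
  apply: lerD; first exact: scaled_error_le.
  by apply: le_trans step _; rewrite ler_piMr.
(* The square of the bounded quantity [lam |et t|], times [lam^-1 <= s]. *)
have et2 : lam * et t ^+ 2 <= (K3 + K4) ^+ 2 * s.
  have -> : lam * et t ^+ 2 = (lam * `|et t|) ^+ 2 * lam^-1.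
    by rewrite exprMn real_normK ?num_real//; field; rewrite gt_eqF.
  apply: ler_pM => //.
  - by rewrite sqr_ge0.
  - by rewrite invr_ge0 ltW.
  - have p1 : 0 <= lam * `|et t| := mulr_ge0 (ltW lam0) (normr_ge0 _).
    have p2 : 0 <= K3 + K4 := addr_ge0 K30 K40.
    exact: (lerXn2r 2 p1 p2 et_le).
have -> : lam * (xbar t - x t) - sigma (x t) * Z t =
  lam * (xbar t - x t - sigma (x t) * et t) + sigma (x t) * (lam * et t - Z t) by ring.
rewrite /euler_const -/K3 -/K4 -/KR -/KZ.
apply: le_trans (ler_normD _ _) _; rewrite [X in _ <= X]mulrDl; apply: lerD.
  rewrite normrM gtr0_norm//; apply: le_trans (ler_wpM2l (ltW lam0) (lamp_inv_taylor2 L _ _)) _.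
  rewrite -/(et t) mulrCA -mulrA ler_wpM2l//; apply: le_trans et2 _.
  by rewrite ler_wpM2l ?sqr_ge0// lerDl.
rewrite -mulrA; apply: normM_le => //.
by rewrite gtr0_norm ?(lamp_sigma_gt0 L)// (lamp_sigma_le L).
Qed.

End euler_error.

(** * Weighted block sums, and convergence along a single path *)

Lemma sum_nat_sub {V : zmodType} (f : nat -> V) (a b : nat) : (a <= b)%N ->
  \sum_(a <= j < b) f j = \sum_(0 <= j < b) f j - \sum_(0 <= j < a) f j.
Proof.
by move=> ab; rewrite [in RHS](big_cat_nat (n := a))//= [RHS]addrC addKr.
Qed.

(* u is frozen at the beginning of each block of length L. *)
Lemma block_sum_bound {R : realType} (u v w : nat -> R) (P L : nat) (C omega delta kappa mass : R) :
  (0 < L)%N -> 0 <= C -> 0 <= omega -> 0 <= delta -> 0 <= kappa ->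
  (forall j, `|u j| <= C) ->
  (forall j, (j < P * L)%N -> `|u j - u (j %/ L * L)%N| <= omega) ->
  (forall j, `|v j| <= w j) ->
  \sum_(0 <= j < P * L) w j <= mass ->
  (forall i, (i <= P)%N -> `|\sum_(0 <= j < i * L) v j| <= delta) ->
  (forall i, (i < P)%N -> \sum_(i * L <= j < i.+1 * L) w j <= kappa) ->
  forall k, (k <= P * L)%N ->
  `|\sum_(0 <= j < k) u j * v j| <= omega * mass + P%:R * (2 * C * delta) + C * kappa.
Proof.
move=> L0 C0 om0 de0 ka0 uC uom vw wm vd wk k kN.
have w0 j : 0 <= w j by apply: le_trans (vw j).
pose u' j := u (j %/ L * L)%N.
have blk i j : (i * L <= j < i.+1 * L)%N -> u' j = u (i * L)%N.
  move=> /andP[h1 h2]; rewrite /u'; congr (u (_ * L)%N).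
  apply/eqP; rewrite eqn_leq -ltnS ltn_divLR// h2/=.
  by rewrite leq_divRL.
have -> : \sum_(0 <= j < k) u j * v j = \sum_(0 <= j < k) (u j - u' j) * v j + \sum_(0 <= j < k) u' j * v j.
  by rewrite -big_split/=; apply: eq_bigr => j _; ring.
rewrite -addrA; apply: le_trans (ler_normD _ _) _; apply: lerD.
  apply: le_trans (ler_norm_sum _ _ _) _.
  apply: (@le_trans _ _ (\sum_(0 <= j < k) omega * w j)).
    rewrite !big_nat; apply: ler_sum => j /= jk; apply: normM_le => //.
    by apply: uom; exact: leq_trans kN.
  rewrite -big_distrr/= ler_wpM2l//; apply: le_trans wm.
  by rewrite (big_cat_nat (n := k) (p := (P * L)%N))//= lerDl sumr_ge0.
(* The sum of [v] over a full block is a difference of two initial sums, each at most [delta]. *)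
have full i : (i <= P)%N -> `|\sum_(0 <= j < i * L) u' j * v j| <= i%:R * (2 * C * delta).
  elim: i => [|i IH] iP; first by rewrite mul0n big_geq// normr0 mul0r.
  have iL : (i * L <= i.+1 * L)%N by rewrite leq_mul2r leqnSn orbT.
  rewrite (big_cat_nat (n := (i * L)%N))//= -natr1 [X in _ <= X]mulrDl mul1r.
  apply: le_trans (ler_normD _ _) _; apply: lerD; first exact: IH (ltnW iP).
  have -> : \sum_(i * L <= j < i.+1 * L) u' j * v j = u (i * L)%N * \sum_(i * L <= j < i.+1 * L) v j.
    by rewrite big_distrr/= !big_nat; apply: eq_bigr => j hj; rewrite (blk i).
  rewrite (_ : 2 * C * delta = C * (delta + delta)); last ring.
  apply: normM_le => //.
  rewrite sum_nat_sub//.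
  apply: le_trans (ler_normB _ _) _; apply: lerD; apply: vd => //; exact: ltnW.
have kP : (k %/ L <= P)%N by rewrite -(mulnK P L0) leq_div2r.
have kL : (k %/ L * L <= k)%N := leq_trunc_div k L.
rewrite (big_cat_nat (n := (k %/ L * L)%N))//=.
apply: le_trans (ler_normD _ _) _; apply: lerD.
  apply: le_trans (full _ kP) _; rewrite ler_wpM2r ?ler_nat//.
  by rewrite !mulr_ge0.
(* The block that contains [k] is incomplete, so its sum of [v] is not controlled by [delta]; it is
   bounded by the mass [kappa] of [w]. At the end of the last block nothing remains. *)
move: kP; rewrite leq_eqVlt => /orP[/eqP kP|kP].
  have -> : (k %/ L * L)%N = k by apply/eqP; rewrite eqn_leq kL kP kN.
  by rewrite big_geq// normr0 mulr_ge0.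
apply: le_trans (ler_norm_sum _ _ _) _.
apply: (@le_trans _ _ (\sum_(k %/ L * L <= j < k) C * w j)).
  by apply: ler_sum => j _; apply: normM_le; [exact: uC | exact: vw].
rewrite -big_distrr/= ler_wpM2l//; apply: le_trans (wk _ kP).
have kL' : (k <= (k %/ L).+1 * L)%N by rewrite ltnW// ltn_ceil.
by rewrite [X in _ <= X](big_cat_nat (n := k))//= lerDl sumr_ge0.
Qed.

Lemma powR2_pow {R : realType} (a : R) (m : nat) : 2 `^ (m%:R * a) = (2 `^ a) ^+ m.
Proof. by rewrite mulrC powRrM powR_mulrn// powR_ge0. Qed.

Lemma powR2_small {R : realType} (a e : R) : a < 0 -> 0 < e ->
  exists M, forall m, (M <= m)%N -> 2 `^ (m%:R * a) <= e.
Proof.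
move=> a0 e0.
have r1 : `|2 `^ a| < 1 :> R.
  rewrite ger0_norm ?powR_ge0// /powR pnatr_eq0/= expR_lt1 nmulr_rlt0//.
  by rewrite ln_gt0// ltr1n.
have := cvg_geometric 1 r1 => /cvgrPdist_le /(_ e e0) [M _ hM].
exists M => m Mm; have := hM m Mm; rewrite /geometric/= mul1r sub0r normrN powR2_pow.
by apply: le_trans; exact: ler_norm.
Qed.

Lemma powR2_dyadic {R : realType} (a : R) (m : nat) : (2 ^- m) `^ a = 2 `^ (m%:R * - a) :> R.
Proof. by rewrite -powR_mulrn// -powRN -powRrM mulNr mulrN. Qed.

(** [p] makes the oscillation of [sigma'(x)] inside a block small, [delta] is then small compared
    with [2^(-p)], and [M] finally takes care of the mesh. Only [2^p + 1] initial sums are left to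
    probability, a number independent of [m]. *)
Lemma euler_convergence {R : realType} (b sigma S : R -> R) (C xi K gamma H eps : R) :
  lamperti b sigma S C -> 1 / 2 < H -> 1 / 2 < gamma -> gamma <= 1 -> 2 * H - 1 < gamma ->
  2 * H < 3 * gamma -> 0 <= K -> 0 < eps ->
  exists p delta M, [/\ 0 < delta, (p <= M)%N &
    forall m g x xbar, (M <= m)%N ->
      lamperti_path b sigma S xi K gamma g x -> euler_scheme b sigma xi g m xbar ->
      (forall i, (i <= 2 ^ p)%N ->
        `|\sum_(0 <= j < i * 2 ^ (m - p))
            (2 `^ (m%:R * (2 * H - 1)) * (g (dyadic R m j.+1) - g (dyadic R m j)) ^+ 2 - 2 ^- m)|
        <= delta) ->
      forall t, 0 <= t -> t <= 1 ->
        `|2 `^ (m%:R * (2 * H - 1)) * (xbar t - x t) - limit_path b sigma g x t| <= eps].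
Proof.
move=> L H1 gam12 gam1 gamH gamH3 K0 eps0.
have C0 : 0 <= C := le_trans ler01 (lamp_C1 L).
have gam0 : 0 < gamma by lra.
set A := `|euler_const C K| + 1.
have A0 : 0 < A by rewrite ltr_wpDl.
have AE : euler_const C K <= A by rewrite /A; apply: le_trans (ler_norm _) _; rewrite lerDl.
(* The coefficient of [2^(-p gamma)] in the final bound: [3 C K] from the oscillation against a
   total mass 3, [2 C] from the incomplete block, and 1 for positivity. *)
pose c1 := 3 * (C * K) + 2 * C + 1.
have c10 : 0 < c1 by rewrite /c1 ltr_wpDl// addr_ge0// !mulr_ge0.
have e1 : 0 < eps / (3 * A * c1) by rewrite divr_gt0// !mulr_gt0.
have Ngam0 : - gamma < 0 by rewrite oppr_lt0.
have [p hp] := powR2_small Ngam0 e1.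
have {}hp : 2 `^ (p%:R * - gamma) <= eps / (3 * A * c1) by apply: hp.
(* The coefficient of [delta]: [2 C] for each of the [2^p] blocks, [2 C] for the incomplete one, and
   1 for positivity. *)
pose c2 := (2 ^ p)%:R * (2 * C) + 2 * C + 1.
have c20 : 0 < c2 by rewrite /c2 ltr_wpDl// addr_ge0// !mulr_ge0.
have e2 : 0 < eps / (3 * A * c2) by rewrite divr_gt0// !mulr_gt0.
pose delta := Num.min 1 (eps / (3 * A * c2)).
have d0 : 0 < delta by rewrite /delta lt_min ltr01 e2.
have e3 : 0 < eps / (3 * A) by rewrite divr_gt0// !mulr_gt0.
pose s := Num.min 1 (eps / (3 * A)).
have s0 : 0 < s by rewrite /s lt_min ltr01 e3.
(* With [h = 2^(-m)] and [d = h^gamma], these are the exponents of [lam^-1], [lam d] and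
   [lam d^3 / h] as powers of [2^m]. *)
have a2 : - (2 * H - 1) < 0 by lra.
have a3 : 2 * H - 1 - gamma < 0 by lra.
have a4 : 2 * H - 3 * gamma < 0 by lra.
have [M1 hM1] := powR2_small Ngam0 s0.
have [M2 hM2] := powR2_small a2 s0.
have [M3 hM3] := powR2_small a3 s0.
have [M4 hM4] := powR2_small a4 s0.
exists p, delta, (p + M1 + M2 + M3 + M4)%N; split => //; first by rewrite -!addnA leq_addr.
move=> m g x xbar Mm PP EU QV t t0 t1.
have pm : (p <= m)%N by apply: leq_trans Mm; rewrite -!addnA leq_addr.
set lam := 2 `^ (m%:R * (2 * H - 1)) in QV *.
pose h : R := 2 ^- m.
have h0 : 0 < h by rewrite invr_gt0 exprn_gt0.
have lam0 : 0 < lam by rewrite powR_gt0.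
have hE : h = 2 `^ (m%:R * - 1) by rewrite -powR2_dyadic powRr1// ltW.
have two0 : (2 : R) != 0 by [].
have powD (y z : R) : 2 `^ y * 2 `^ z = 2 `^ (y + z) :> R.
  by rewrite powRD//; apply/implyP.
have S1 : h `^ gamma <= s.
  rewrite powR2_dyadic; apply: hM1; apply: leq_trans Mm.
  by rewrite -!addnA addnCA leq_addr.
have S2 : lam^-1 <= s.
  rewrite /lam -powRN -mulrN; apply: hM2; apply: leq_trans Mm.
  by rewrite (addnC _ M4) addnA (addnC _ M3) !addnA leq_addl.
have S3 : lam * h `^ gamma <= s.
  rewrite powR2_dyadic powD -mulrDr; apply: hM3; apply: leq_trans Mm.
  by rewrite addnAC leq_addl.
have S4 : lam * (h `^ gamma) ^+ 3 <= s * h.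
  rewrite -ler_pdivrMr// powR2_dyadic -powR_mulrn ?powR_ge0// -powRrM powD.
  rewrite hE -powRN powD; apply: le_trans (hM4 m _); last by apply: leq_trans Mm; rewrite leq_addl.
  by rewrite le_eqVlt; apply/orP; left; apply/eqP; congr (_ `^ _); ring.
pose tk k := dyadic R m k.
pose Dl k := g (tk k.+1) - g (tk k).
pose l := (2 ^ (m - p))%N.
have l0 : (0 < l)%N by rewrite expn_gt0.
have Nl : (2 ^ p * l)%N = (2 ^ m)%N by rewrite -expnD subnKC.
have Nh : (2 ^ m)%:R * h = 1 by exact: dyadic_top.
have lh : l%:R * h = 2 ^- p.
  by apply: (mulfI (x := (2 ^ p)%:R)); [rewrite pnatr_eq0 -lt0n expn_gt0 | rewrite mulrA -natrM Nl Nh natrX mulfV// expf_neq0].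
have d1 : delta <= 1 by rewrite /delta ge_min lexx.
have sum_h i j : (i <= j)%N -> \sum_(i <= k < j) h = (j - i)%:R * h.
  by move=> _; rewrite sumr_const_nat mulr_natl.
have QVb i : (i <= 2 ^ p)%N -> `|\sum_(0 <= j < i * l) (lam * Dl j ^+ 2 - h)| <= delta by exact: QV.
(* The sum over all blocks is within [delta <= 1] of [2^m h = 1]. *)
have lamQ2 : \sum_(0 <= j < 2 ^ m) lam * Dl j ^+ 2 <= 2.
  have := QVb _ (leqnn _); rewrite Nl sumrB sum_h// subn0 Nh => /(le_trans (ler_norm _)).
  by rewrite lerBlDl => /le_trans; apply; rewrite -[X in _ <= X]natr1 lerD2l.
have twop0 : 0 <= 2 ^- p :> R by rewrite invr_ge0 exprn_ge0.
pose om := C * K * (2 ^- p) `^ gamma.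
have om0 : 0 <= om by rewrite !mulr_ge0// powR_ge0.
pose kap := 2 * delta + 2 * 2 ^- p.
have kap0 : 0 <= kap by rewrite addr_ge0// mulr_ge0// ltW.
pose theta := om * 3 + (2 ^ p)%:R * (2 * C * delta) + C * kap.
have W k : (k <= 2 ^ m)%N ->
    `|\sum_(0 <= j < k) derive1 sigma (x (tk j)) * (lam * Dl j ^+ 2 - h)| <= theta.
  move=> kN.
  (* The total mass 3 is [2 + 1]. On one block [lam D^2 + h] is [lam D^2 - h] plus [2 h], which
     explains [kap]. *)
  apply: (@block_sum_bound _ (fun j => derive1 sigma (x (tk j))) (fun j => lam * Dl j ^+ 2 - h)
    (fun j => lam * Dl j ^+ 2 + h) (2 ^ p) l) => //; last by rewrite Nl.
  - exact: ltW.
  - by move=> j; exact: (lamp_sigma'_le L).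
  - move=> j; rewrite Nl => jN.
    have jl : (j %/ l * l <= j)%N := leq_trunc_div j l.
    apply: le_trans (path_hoelder L PP (lamp_sigma'_lip L) (dyadic_ge0 m _) (dyadic_le m jl) (dyadic_le1 (ltnW jN))) _.
    rewrite ler_wpM2l ?mulr_ge0// powR_le ?(ltW gam0)// ?subr_ge0 ?dyadic_le//.
    rewrite -lh /dyadic -mulrBl ler_wpM2r ?(ltW h0)// -natrB// ler_nat.
    by rewrite leq_subLR {1}(divn_eq j l) leq_add2l ltnW// ltn_pmod.
  - move=> j; have l2 : 0 <= lam * Dl j ^+ 2 by rewrite mulr_ge0 ?sqr_ge0// ltW.
    apply: le_trans (ler_normB _ _) _; rewrite (ger0_norm l2) ger0_norm//; exact: ltW.
  - by rewrite Nl big_split/= sum_h// subn0 Nh -[X in _ <= X]natr1 lerD2r.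
  - move=> i iP; have il : (i * l <= i.+1 * l)%N by rewrite leq_mul2r leqnSn orbT.
    have sB : \sum_(i * l <= j < i.+1 * l) (lam * Dl j ^+ 2 - h) =
       \sum_(0 <= j < i.+1 * l) (lam * Dl j ^+ 2 - h) - \sum_(0 <= j < i * l) (lam * Dl j ^+ 2 - h).
      exact: sum_nat_sub.
    have -> : \sum_(i * l <= j < i.+1 * l) (lam * Dl j ^+ 2 + h) =
        \sum_(i * l <= j < i.+1 * l) (lam * Dl j ^+ 2 - h) + 2 * 2 ^- p.
      rewrite (eq_bigr (fun j => (lam * Dl j ^+ 2 - h) + (h + h))); last by move=> j _; ring.
      by rewrite big_split/= sumr_const_nat -[X in _ + X = _]mulr_natl mulSn addnK mulrDr lh; ring.
    rewrite /kap sB lerD2r; apply: le_trans (ler_norm _) _; apply: le_trans (ler_normB _ _) _.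
    by rewrite mulrDl mul1r; apply: lerD; [exact: QVb _ iP | exact: QVb _ (ltnW iP)].
have s1 : s <= 1 by rewrite /s ge_min lexx.
rewrite (limit_path_lamperti L PP gam12 gam1 K0 t0 t1).
have := euler_error_le L PP gam12 gam1 K0 EU lam0 s1 S1 S2 S3 S4 lamQ2 W t0 t1.
move=> /le_trans; apply.
have th0 : 0 <= theta by apply: le_trans (W 0%N (leq0n _)); rewrite normr_ge0.
have sth : 0 <= s + theta by rewrite addr_ge0// ltW.
apply: le_trans (ler_wpM2r sth AE) _.
have As : A * s <= eps / 3.
  have : s <= eps / (3 * A) by rewrite /s ge_min lexx orbT.
  by rewrite ler_pdivlMr ?mulr_gt0//; lra.
have Ad : A * (c2 * delta) <= eps / 3.
  have : delta <= eps / (3 * A * c2) by rewrite /delta ge_min lexx orbT.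
  rewrite ler_pdivlMr ?mulr_gt0// (_ : delta * (3 * A * c2) = 3 * (A * (c2 * delta))); last ring.
  by lra.
pose P2 : R := (2 ^- p) `^ gamma.
have Ap : A * (c1 * P2) <= eps / 3.
  move: hp; rewrite -powR2_dyadic -/P2 ler_pdivlMr ?mulr_gt0//.
  rewrite (_ : P2 * (3 * A * c1) = 3 * (A * (c1 * P2))); last ring.
  by lra.
have P2le : 2 ^- p <= P2.
  rewrite -[X in X <= _]powRr1//; apply: powR_exp_le => //.
  by rewrite invf_le1 ?exprn_gt0// exprn_ege1// ler1n.
apply: (@le_trans _ _ (A * s + (A * (c2 * delta) + A * (c1 * P2)))); last by lra.
rewrite -!mulrDr ler_wpM2l ?(ltW A0)// lerD2l /theta /om -/P2 /kap.
have q1 := ltW d0; have q2 : 0 <= P2 by exact: powR_ge0.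
have q3 : C * 2 ^- p <= C * P2 by rewrite ler_wpM2l.
have -> : c2 * delta + c1 * P2 = C * K * P2 * 3 + (2 ^ p)%:R * (2 * C * delta) + (2 * (C * delta) + 2 * (C * P2)) + (delta + P2).
  by rewrite /c1 /c2; ring.
rewrite (_ : C * (2 * delta + 2 * 2 ^- p) = 2 * (C * delta) + 2 * (C * 2 ^- p)); last ring.
rewrite -[X in _ <= X]addrA -!(addrA (C * K * P2 * 3)) lerD2l lerD2l.
by lra.
Qed.

(** * Hölder continuity from dyadic increments *)

(** [K / (1 - 2^(-gamma))] sums the increments over all finer levels and is paid at both end points;
    the single [K] is one step at the coarse level; the outer 2 compares the coarse mesh with the
    distance. *)
Definition chaining_const {R : realType} (K gamma : R) : R :=
  2 * (2 * (K * (1 - 2 `^ (- gamma))^-1) + K).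

Lemma chaining_const_ge0 {R : realType} (K gamma : R) : 0 < gamma -> 0 <= K ->
  0 <= chaining_const K gamma.
Proof.
move=> g0 K0; have h : 2 `^ (- gamma) <= 1 :> R.
  by rewrite -[X in _ <= X](powRr0 (2 : R)); apply: ler_powR; rewrite ?ler1n// oppr_le0 ltW.
by rewrite mulr_ge0// addr_ge0// !mulr_ge0// invr_ge0 subr_ge0.
Qed.

Lemma dyadic_double {R : realType} (m k : nat) : dyadic R m.+1 k.*2 = dyadic R m k.
Proof.
by rewrite /dyadic -muln2 natrM exprS invfM -mulrA mulVKf.
Qed.

Section chaining.
Context {R : realType} (g : R -> R) (K gamma : R).
Context (gamma0 : 0 < gamma) (gamma1 : gamma <= 1) (K0 : 0 <= K).
Context (gK : forall n k, (k < 2 ^ n)%N ->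
  `|g (dyadic R n k.+1) - g (dyadic R n k)| <= K * (2 ^- n) `^ gamma).

Let r : R := 2 `^ (- gamma).
Let c := K * (1 - r)^-1.

Let r0 : 0 <= r. Proof. exact: powR_ge0. Qed.
Let r1 : r < 1.
Proof.
by rewrite /r /powR pnatr_eq0/= expR_lt1 nmulr_rlt0 ?oppr_lt0// ln_gt0// ltr1n.
Qed.
Let rE n : (2 ^- n) `^ gamma = r ^+ n.
Proof. by rewrite powR2_dyadic powR2_pow. Qed.
Let rn0 n : 0 <= r ^+ n. Proof. exact: exprn_ge0. Qed.
Let c0 : 0 <= c. Proof. by rewrite mulr_ge0// invr_ge0 subr_ge0 ltW. Qed.

(** Halving the index leads to the parent one level up: the same point for an even index, the left
    neighbour for an odd one. Each level costs at most one increment. *)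
Lemma chaining_ancestor j n l : (l < 2 ^ (n + j))%N ->
  `|g (dyadic R (n + j) l) - g (dyadic R n (l %/ 2 ^ j))| <= K * \sum_(0 <= i < j) r ^+ (n + i.+1).
Proof.
elim: j l => [|j IH] l; first by rewrite addn0 expn0 divn1 big_geq// subrr normr0 mulr0.
rewrite addnS => lN.
have l2N : (l./2 < 2 ^ (n + j))%N by rewrite ltn_half_double -mul2n -expnS.
have -> : (l %/ 2 ^ j.+1 = l./2 %/ 2 ^ j)%N by rewrite expnS divnMA divn2.
rewrite big_nat_recr//= mulrDr [X in _ <= X]addrC.
have -> : g (dyadic R (n + j).+1 l) - g (dyadic R n (l./2 %/ 2 ^ j)) =
  (g (dyadic R (n + j).+1 l) - g (dyadic R (n + j).+1 l./2.*2)) +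
  (g (dyadic R (n + j) l./2) - g (dyadic R n (l./2 %/ 2 ^ j))) by rewrite dyadic_double; ring.
apply: le_trans (ler_normD _ _) _; apply: lerD; last exact: IH.
rewrite -{1}(odd_double_half l); case: (odd l) => /=.
  rewrite add1n addnS -rE; apply: gK; rewrite -(odd_double_half l) in lN.
  by apply: leq_ltn_trans lN; rewrite leq_addl.
by rewrite add0n subrr normr0 mulr_ge0.
Qed.

Let chaining_ancestor_le j n l : (l <= 2 ^ (n + j))%N ->
  `|g (dyadic R (n + j) l) - g (dyadic R n (l %/ 2 ^ j))| <= c * r ^+ n.
Proof.
(* The end point 1 is its own ancestor; it is not the left end of a cell, so it is treated apart. *)
rewrite leq_eqVlt => /orP[/eqP ->|lN].
  rewrite expnD mulnK ?expn_gt0// -expnD !dyadic_top subrr normr0 mulr_ge0//.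
apply: le_trans (chaining_ancestor lN) _; rewrite /c -mulrA ler_wpM2l//.
rewrite (eq_bigr (fun i => r ^+ n * r ^+ i.+1)); last by move=> i _; rewrite exprD.
rewrite -big_distrr/= mulrC ler_wpM2r// -[X in _ <= X]mul1r ler_pdivlMr ?subr_gt0//.
have main k : (\sum_(0 <= i < k) r ^+ i.+1) * (1 - r) = r - r ^+ k.+1.
  elim: k => [|k IH]; first by rewrite big_geq// mul0r expr1 subrr.
  by rewrite big_nat_recr//= mulrDl IH !exprS; ring.
rewrite main; apply: le_trans (ltW r1); by rewrite gerBl.
Qed.

Lemma dyadic_increment_le N l1 l2 : (l1 <= l2)%N -> (l2 <= 2 ^ N)%N ->
  `|g (dyadic R N l2) - g (dyadic R N l1)|
    <= chaining_const K gamma * (dyadic R N l2 - dyadic R N l1) `^ gamma.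
Proof.
rewrite leq_eqVlt => /orP[/eqP ->|l12] l2N.
  by rewrite subrr normr0 mulr_ge0 ?powR_ge0// mulr_ge0// addr_ge0// mulr_ge0.
(* The mesh of the coarse level [n = N - j] lies between the distance and twice the distance, so the
   ancestors of the two points are equal or neighbours. *)
pose D := (l2 - l1)%N; pose j := up_log 2 D.
have D0 : (0 < D)%N by rewrite subn_gt0.
have Dj : (D <= 2 ^ j)%N by apply: up_logP.
have Dj2 : (2 ^ j <= 2 * D)%N.
  have [D1|D1] := leqP D 1; first by rewrite /j (_ : D = 1%N) ?up_log1//; apply/eqP; rewrite eqn_leq D1.
  have h : (2 ^ j.-1 < D)%N by apply: up_log_gtn.
  have j0 : (0 < j)%N by rewrite up_log_gt0.
  by rewrite -(prednK j0) expnS leq_mul2l/= ltnW.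
have jN : (j <= N)%N.
  apply: up_log_min => //; apply: leq_trans l2N; exact: leq_subr.
pose n := (N - j)%N; have nj : (n + j)%N = N by rewrite subnK.
have hk1 : (l1 %/ 2 ^ j <= l2 %/ 2 ^ j)%N by rewrite leq_div2r// ltnW.
have hk2 : (l2 %/ 2 ^ j <= (l1 %/ 2 ^ j).+1)%N.
  have -> : l2 = (l1 + D)%N by rewrite subnKC// ltnW.
  apply: (@leq_trans ((l1 + 2 ^ j) %/ 2 ^ j)%N); first by rewrite leq_div2r// leq_add2l.
  by rewrite divnDr ?dvdnn// divnn expn_gt0/= addn1.
have h1 : `|g (dyadic R N l1) - g (dyadic R n (l1 %/ 2 ^ j))| <= c * r ^+ n.
  by rewrite -{1}nj; apply: chaining_ancestor_le; rewrite nj (leq_trans (ltnW l12)).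
have h2 : `|g (dyadic R N l2) - g (dyadic R n (l2 %/ 2 ^ j))| <= c * r ^+ n.
  by rewrite -{1}nj; apply: chaining_ancestor_le; rewrite nj.
have h3 : `|g (dyadic R n (l2 %/ 2 ^ j)) - g (dyadic R n (l1 %/ 2 ^ j))| <= K * r ^+ n.
  have [e|ne] := eqVneq (l2 %/ 2 ^ j)%N (l1 %/ 2 ^ j)%N.
    by rewrite e subrr normr0 mulr_ge0.
  have e : (l2 %/ 2 ^ j)%N = (l1 %/ 2 ^ j).+1.
    by apply/eqP; rewrite eqn_leq hk2 ltn_neqAle eq_sym ne.
  rewrite e -rE; apply: gK; rewrite ltn_divLR ?expn_gt0// -expnD nj.
  exact: leq_trans l12 l2N.
have rD : r ^+ n <= 2 * (dyadic R N l2 - dyadic R N l1) `^ gamma.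
  have Dist : dyadic R N l2 - dyadic R N l1 = D%:R * 2 ^- N.
    by rewrite /dyadic -mulrBl natrB// ltnW.
  rewrite -rE; apply: (@le_trans _ _ ((2 * (D%:R * 2 ^- N)) `^ gamma)).
    apply: powR_le; rewrite ?(ltW gamma0) ?invr_ge0 ?exprn_ge0//.
    rewrite mulrA ler_pdivlMr ?exprn_gt0// -{1}nj exprD mulKf ?expf_neq0//.
    by rewrite -natrX -natrM ler_nat.
  rewrite Dist powRM ?mulr_ge0 ?invr_ge0 ?exprn_ge0// ler_wpM2r ?powR_ge0//.
  by rewrite -[X in _ <= X]powRr1// ler_powR// ler1n.
have -> : g (dyadic R N l2) - g (dyadic R N l1) =
  (g (dyadic R N l2) - g (dyadic R n (l2 %/ 2 ^ j))) - (g (dyadic R N l1) - g (dyadic R n (l1 %/ 2 ^ j)))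
  + (g (dyadic R n (l2 %/ 2 ^ j)) - g (dyadic R n (l1 %/ 2 ^ j))) by ring.
have A0 : 0 <= 2 * c + K by rewrite addr_ge0// mulr_ge0.
apply: (@le_trans _ _ ((2 * c + K) * r ^+ n)).
  apply: le_trans (ler_normD _ _) _; rewrite mulrDl; apply: lerD => //.
  by apply: le_trans (ler_normB _ _) _; rewrite -mulrA mulrDl mul1r; exact: lerD.
apply: le_trans (ler_wpM2l A0 rD) _.
by rewrite mulrA /chaining_const -/r -/c (mulrC _ 2).
Qed.

Lemma dyadic_hoelder : {within `[0, 1], continuous g} ->
  forall u v, 0 <= u -> u <= v -> v <= 1 ->
  `|g v - g u| <= chaining_const K gamma * (v - u) `^ gamma.
Proof.
move=> cg u v u0 uv v1; have v0 := le_trans u0 uv; have u1 := le_trans uv v1.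
have KK0 : 0 <= chaining_const K gamma by rewrite mulr_ge0// addr_ge0// mulr_ge0.
move: uv; rewrite le_eqVlt => /orP[/eqP ->|uv].
  by rewrite subrr normr0 mulr_ge0 ?powR_ge0.
apply/ler_addgt0Pr => e e0.
have near_pt t : 0 <= t -> t <= 1 -> exists2 d0 : R, 0 < d0 &
    forall y, 0 <= y -> y <= 1 -> `|t - y| < d0 -> `|g t - g y| <= e / 2.
  move=> t0 t1; move/subspace_continuousP: cg => /(_ t).
  rewrite /= in_itv/= t0 t1 => /(_ isT) /cvgrPdist_le /(_ (e / 2)).
  rewrite divr_gt0// => /(_ isT); rewrite near_withinE => -[d0 /= d00 hd].
  by exists d0 => // y y0 y1 ty; apply: hd => //=; rewrite in_itv/= y0 y1.
have [d1 d10 hu] := near_pt u u0 u1; have [d2 d20 hv] := near_pt v v0 v1.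
have Nm1 : - 1 < 0 :> R by rewrite oppr_lt0.
pose dd := Num.min (Num.min (d1 / 2) (d2 / 2)) ((v - u) / 2).
have dd0 : 0 < dd by rewrite /dd !lt_min !divr_gt0// subr_gt0.
have [N hN] := powR2_small Nm1 dd0.
have {hN} := hN N (leqnn _); rewrite -powR2_dyadic powRr1 ?invr_ge0 ?exprn_ge0// => hN.
have N1 : 2 ^- N <= d1 / 2 by apply: le_trans hN _; rewrite /dd !ge_min lexx.
have N2 : 2 ^- N <= d2 / 2 by apply: le_trans hN _; rewrite /dd !ge_min lexx orbT.
have N3 : 2 ^- N <= (v - u) / 2 by apply: le_trans hN _; rewrite /dd ge_min lexx orbT.
have h0 : 0 < 2 ^- N :> R by rewrite invr_gt0 exprn_gt0.
have [k1 k1N /andP[ku1 ku2]] := dyadic_cover N u0 u1.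
have [k2 k2N /andP[kv1 kv2]] := dyadic_cover N v0 v1.
have us := dyadicS (R := R) N k1; have vs := dyadicS (R := R) N k2.
(* [p] is a grid point after [u] and [q] one before [v]. Both lie in [[u, v]], so the bound for them
   transfers without loss in the constant. *)
set p := dyadic R N k1.+1 in us ku2 *; set q := dyadic R N k2 in vs kv1 *.
have pq : p <= q by lra.
have kk : (k1.+1 <= k2)%N.
  by move: pq; rewrite /p /q /dyadic ler_pM2r// ler_nat.
have main : `|g q - g p| <= chaining_const K gamma * (v - u) `^ gamma.
  apply: le_trans (dyadic_increment_le kk (ltnW k2N)) _.
  by rewrite ler_wpM2l// powR_le ?(ltW gamma0) ?subr_ge0// lerB.
have p0 : 0 <= p by exact: dyadic_ge0.
have q1 : q <= 1 by apply: dyadic_le1; exact: ltnW.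
have gu : `|g u - g p| <= e / 2.
  apply: hu => //; first exact: le_trans q1.
  rewrite ler0_norm ?subr_le0//; lra.
have gv : `|g v - g q| <= e / 2.
  apply: hv => //; first exact: le_trans pq.
  rewrite ger0_norm ?subr_ge0//; lra.
have -> : g v - g u = (g v - g q) - (g u - g p) + (g q - g p) by ring.
rewrite [X in _ <= X]addrC [e]splitr.
apply: le_trans (ler_normD _ _) _; apply: lerD => //.
by apply: le_trans (ler_normB _ _) _; apply: lerD.
Qed.

End chaining.

(** * Moments and tails of Gaussian laws *)

Local Opaque expR.

(** The Radon-Nikodym derivative of [normal_prob] agrees almost everywhere with [normal_pdf];
    boundedness of [f] gives the integrability that the change of variables requires. *)
Lemma integral_normal_prob_bounded {R : realType} (m s B : R) (f : R -> R) (U : set R) :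
  measurable U -> measurable_fun U f -> (forall x, U x -> `|f x| <= B) ->
  (\int[normal_prob m s]_(x in U) (f x)%:E =
   \int[lebesgue_measure]_(x in U) (f x * normal_pdf m s x)%:E)%E.
Proof.
move=> mU mf fB; pose dom := normal_prob_dominates m s.
have intf : (normal_prob m s).-integrable U (EFin \o f).
  apply: measurable_bounded_integrable => //.
    by rewrite (le_lt_trans (@probability_le1 _ _ _ (normal_prob m s) _ mU)) ?ltry.
  exists B; split; first exact: num_real.
  by move=> y By x Ux; exact: le_trans (fB x Ux) (ltW By).
rewrite -(Radon_Nikodym_change_of_variables dom mU intf).
under [RHS]eq_integral do rewrite EFinM.
apply: ae_eq_integral => //.
- apply: emeasurable_funM; first exact/measurable_EFinP.
  apply: measurable_funTS; apply: (measurable_int lebesgue_measure).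
  exact: Radon_Nikodym_integrable.
- apply: emeasurable_funM; first exact/measurable_EFinP.
  by apply: measurable_funTS; apply/measurable_EFinP; exact: measurable_normal_pdf.
apply: ae_eqe_mul2l => /=; rewrite Radon_NikodymE.
case: cid => /= h [_ inth hE]; apply: integral_ae_eq => //.
- exact: integrableS inth.
- by apply: measurable_funTS; apply/measurable_EFinP; exact: measurable_normal_pdf.
- by move=> E _ mE; rewrite -hE.
Qed.

Section normal_moments.
Context {R : realType} (m s : R) (s0 : s != 0).
Let mu := @lebesgue_measure R.
Let phi := normal_pdf m s.

Let s2 : 0 < s ^+ 2. Proof. by rewrite exprn_even_gt0. Qed.

Let phiE x : phi x = normal_peak s * expR (- (x - m) ^+ 2 / (s ^+ 2 *+ 2)).
Proof. by rewrite /phi normal_pdfE. Qed.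

Let phi_ge0 x : 0 <= phi x. Proof. exact: normal_pdf_ge0. Qed.

Let cphi : continuous phi. Proof. exact: continuous_normal_pdf. Qed.

Lemma is_derive_normal_pdf (x : R) : is_derive x 1 (phi : R -> R) (- ((x - m) / s ^+ 2 * phi x)).
Proof.
have -> : phi = (fun x => normal_peak s * expR (- (x - m) ^+ 2 / (s ^+ 2 *+ 2))).
  by apply/funext => y; rewrite phiE.
pose q (x : R) := (x - m) ^+ 2 * (- (s ^+ 2 *+ 2)^-1).
have dq : is_derive x 1 q (- ((x - m) / s ^+ 2)).
  apply: (@is_derive_quadratic _ _ _ _ `|(s ^+ 2 *+ 2)^-1|) => y.
  rewrite -[X in _ <= _ * X](ger0_norm (sqr_ge0 (y - x))) -normrM /q.
  rewrite le_eqVlt; apply/orP; left; apply/eqP; rewrite -normrN; congr (`| _ |).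
  by rewrite -mulr_natr; field.
have -> : (fun x => normal_peak s * expR (- (x - m) ^+ 2 / (s ^+ 2 *+ 2))) =
    (fun x => normal_peak s * (expR \o q) x).
  by apply/funext => y /=; congr (_ * expR _); rewrite /q mulNr mulrN.
have de : is_derive x 1 (expR \o q) (- ((x - m) / s ^+ 2) * expR (q x)).
  by have := @is_derive1_comp _ _ _ x _ _ (is_derive_expR (q x)) dq; rewrite mulrC.
rewrite [X in is_derive _ _ _ X](_ : _ = normal_peak s *: (- ((x - m) / s ^+ 2) * expR (q x))).
  exact: is_deriveZ.
rewrite /GRing.scale/= (_ : - (x - m) ^+ 2 / _ = q x); last by rewrite /q mulNr mulrN.
ring.
Qed.

(** Integrated over an interval, this becomes the recursion from the central moment of order [k - 1]
    to that of order [k + 1], with boundary values. For [k = 0] the truncated [k.-1] has the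
    coefficient 0. *)
Lemma is_derive_normal_pdf_pow (k : nat) (x : R) :
  is_derive x 1 (fun y => - s ^+ 2 * ((y - m) ^+ k * phi y))
    ((x - m) ^+ k.+1 * phi x - s ^+ 2 * (k%:R * (x - m) ^+ k.-1 * phi x)).
Proof.
have dp : is_derive x 1 (fun y : R => (y - m) ^+ k) (k%:R * (x - m) ^+ k.-1).
  have d1 : is_derive x 1 (fun y : R => y - m) 1.
    by rewrite -[X in is_derive _ _ _ X]subr0; apply: is_deriveB.
  have -> : (fun y : R => (y - m) ^+ k) = (fun y : R => y - m) ^+ k.
    by apply/funext => y; rewrite exprfctE.
  have := @is_deriveX _ _ (fun y : R => y - m) k x 1 1 d1.
  by rewrite /GRing.scale/= mulr1.
have := is_deriveZ (- s ^+ 2) (is_deriveM dp (is_derive_normal_pdf x)).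
rewrite /GRing.scale/= => h.
have -> : (x - m) ^+ k.+1 * phi x - s ^+ 2 * (k%:R * (x - m) ^+ k.-1 * phi x) =
  - s ^+ 2 * ((x - m) ^+ k * - ((x - m) / s ^+ 2 * phi x) + phi x * (k%:R * (x - m) ^+ k.-1)).
  by rewrite exprS; field.
exact: h.
Qed.

Let pm (k : nat) (x : R) := (x - m) ^+ k * phi x.

Let cpm k : continuous (pm k).
Proof.
move=> x; apply: cvgM; last exact: cphi.
apply: (@cvg_comp _ _ _ (fun x : R => x - m) (fun y => y ^+ k) _ (nbhs (x - m))); last exact: exprn_continuous.
by apply: cvgB; [exact: cvg_id | exact: cvg_cst].
Qed.

Let M k n := \int[mu]_(x in `[m - n, m + n]) pm k x.

Let FTC k n : 0 < n ->
  M k.+1 n = s ^+ 2 * (k%:R * M k.-1 n) - s ^+ 2 * (n ^+ k * phi (m + n) - (- n) ^+ k * phi (m - n)).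
Proof.
move=> n0; have mn : m - n < m + n by rewrite ltrD2l -subr_gt0 opprK addr_gt0.
pose F y := - s ^+ 2 * pm k y.
pose f y := pm k.+1 y - s ^+ 2 * k%:R * pm k.-1 y.
have dF (x : R) : is_derive x 1 F (f x).
  rewrite /f -mulrA; have := is_derive_normal_pdf_pow k x; rewrite -(mulrA k%:R); exact.
have cF : continuous F.
  by move=> x; apply: differentiable_continuous; apply/derivable1_diffP; have [] := dF x.
have cf : continuous f.
  by move=> x; apply: cvgB; [exact: cpm | apply: cvgMl_tmp; exact: cpm].
have int (h : R -> R) : continuous h -> mu.-integrable `[m - n, m + n] (EFin \o h).
  by move=> ch; apply: continuous_compact_integrable; [exact: segment_compact | exact: continuous_subspaceT].
have : \int[mu]_(x in `[m - n, m + n]) f x = F (m + n) - F (m - n).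
  rewrite /Rintegral (@continuous_FTC2 _ f F)//.
  - exact: continuous_subspaceT.
  - split.
    + by move=> x _; have [] := dF x.
    + by apply: cvg_at_right_filter; exact: cF.
    + by apply: cvg_at_left_filter; exact: cF.
  - by move=> x _; rewrite derive1E derive_val.
rewrite RintegralB//; [| exact: int | by apply: int => x; apply: cvgMl_tmp; exact: cpm].
rewrite RintegralZl//; last exact: int.
rewrite -/(M k.+1 n) -/(M k.-1 n) /F /pm.
have -> : m + n - m = n by ring.
have -> : m - n - m = - n by ring.
move=> h; have -> : M k.+1 n = (M k.+1 n - s ^+ 2 * k%:R * M k.-1 n) + s ^+ 2 * k%:R * M k.-1 n by ring.
by rewrite h; ring.
Qed.

Let phi_sym n : phi (m - n) = phi (m + n).
Proof.
have e1 : m + n - m = n by ring.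
have e2 : m - n - m = - n by ring.
by rewrite (phiE (m - n)) (phiE (m + n)) e1 e2 sqrrN.
Qed.

(** The recursion at [k = 0, 1, 3]. As the density is symmetric about [m], the boundary values
    cancel for even [k] and double for odd [k]. *)
Lemma truncated_moments n : 0 < n ->
  [/\ M 1 n = 0, M 2 n = s ^+ 2 * M 0 n - 2 * s ^+ 2 * (n * phi (m + n)) &
      M 4 n = 3 * s ^+ 2 * M 2 n - 2 * s ^+ 2 * (n ^+ 3 * phi (m + n))].
Proof.
move=> n0; have := FTC 0 n0; have := FTC 1 n0; have := FTC 3 n0.
rewrite phi_sym/= => -> -> ->; move: (M 0 n) (M 2 n) (phi (m + n)) => M0 M2 p.
by split; ring.
Qed.

Let phi_tail (n : nat) : n.+1%:R ^+ 3 * phi (m + n.+1%:R) <= normal_peak s * 16 * s ^+ 4 * n.+1%:R^-1.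
Proof.
set x : R := n.+1%:R; have x0 : 0 < x by rewrite ltr0n.
rewrite phiE; have -> : m + x - m = x by ring.
set u := x ^+ 2 / (s ^+ 2 *+ 2).
have u0 : 0 < u by rewrite divr_gt0 ?exprn_gt0// mulrn_wgt0.
(* From [u / 2 <= exp (u / 2)]. As [u] is a multiple of [x^2], its square dominates [x^3]. *)
have eu : u ^+ 2 / 4 <= expR u.
  have -> : u = u / 2 + u / 2 by field.
  rewrite expRD -expr2; have h := expR_ge1Dx (u / 2).
  have -> : (u / 2 + u / 2) ^+ 2 / 4 = (u / 2) ^+ 2 by field.
  have u20 : 0 <= u / 2 := divr_ge0 (ltW u0) (ler0n _ 2).
  have h4 : u / 2 <= expR (u / 2) by apply: le_trans h; rewrite lerDr.
  exact: (lerXn2r 2 u20 (expR_ge0 _) h4).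
rewrite mulNr -/u expRN.
apply: (@le_trans _ _ (x ^+ 3 * (normal_peak s * (4 / u ^+ 2)))).
  rewrite ler_wpM2l ?exprn_ge0 ?(ltW x0)// ler_wpM2l ?normal_peak_ge0//.
  have u4 : 0 < u ^+ 2 / 4 by apply: divr_gt0 => //; exact: exprn_gt0.
  by rewrite -invf_div lef_pV2 ?posrE ?expR_gt0.
rewrite le_eqVlt; apply/orP; left; apply/eqP.
by rewrite /u -mulr_natr; field; rewrite gt_eqF// s0.
Qed.

(** For even [k] the integrand is nonnegative, and monotone convergence applies to the growing
    intervals. *)
Let M_cvge k : ~~ odd k -> (M k n.+1%:R)%:E @[n --> \oo] -->
  (\int[normal_prob m s]_x ((x - m) ^+ k)%:E)%E.
Proof.
move=> ek.
pose U (n : nat) : set R := `[m - n.+1%:R, m + n.+1%:R]%classic.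
have mU n : measurable (U n) by exact: measurable_itv.
have mpow : measurable_fun setT (fun x : R => ((x - m) ^+ k)%:E).
  apply/measurable_EFinP; apply: continuous_measurable_fun => x.
  apply: (@cvg_comp _ _ _ (fun x : R => x - m) (fun y => y ^+ k) _ (nbhs (x - m))); last exact: exprn_continuous.
  by apply: cvgB; [exact: cvg_id | exact: cvg_cst].
have U_cover : \bigcup_n U n = setT.
  apply/seteqP; split => // x _.
  have := truncnS_gt `|x - m|; set n := Num.truncn _ => xn.
  exists n => //; rewrite /U /= in_itv/= -ler_distl; exact: ltW.
have h1 : (\int[normal_prob m s]_(x in U n) ((x - m) ^+ k)%:E)%E @[n --> \oo] -->
    (\int[normal_prob m s]_x ((x - m) ^+ k)%:E)%E.
  rewrite -U_cover; apply: ge0_nondecreasing_set_cvg_integral => //.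
  - move=> i j ij; apply/subsetPset; apply: subset_itv; rewrite bnd_simp.
      by rewrite lerD2l lerN2 ler_nat.
    by rewrite lerD2l ler_nat.
  - by move=> n; exact: measurable_funTS.
  - by move=> n x _; rewrite lee_fin exprn_even_ge0.
have h2 n : (\int[normal_prob m s]_(x in U n) ((x - m) ^+ k)%:E)%E = (M k n.+1%:R)%:E.
  have cpow : continuous (fun x : R => (x - m) ^+ k).
    move=> x; apply: (@cvg_comp _ _ _ (fun x : R => x - m) (fun y => y ^+ k) _ (nbhs (x - m))); last exact: exprn_continuous.
    by apply: cvgB; [exact: cvg_id | exact: cvg_cst].
  rewrite (@integral_normal_prob_bounded _ _ _ (n.+1%:R ^+ k) (fun x => (x - m) ^+ k))//.
  - rewrite /M /Rintegral fineK//; apply: integrable_fin_num => //.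
    by apply: continuous_compact_integrable; [exact: segment_compact | apply: continuous_subspaceT; exact: cpm].
  - by apply: measurable_funTS; exact: continuous_measurable_fun.
  - move=> x; rewrite /U /= in_itv/= -ler_distl normrX => xn.
    by apply: lerXn2r => //; rewrite nnegrE.
by under eq_fun do rewrite -h2.
Qed.

Let M_cvg k (l : R) : ~~ odd k -> M k n.+1%:R @[n --> \oo] --> l ->
  (\int[normal_prob m s]_x ((x - m) ^+ k)%:E = l%:E)%E.
Proof.
move=> ek Ml; apply: (cvg_unique _ (M_cvge ek)) => //.
by apply: cvg_EFin; [exact: nearW | exact: Ml].
Qed.

Let cvg_tail k : (k <= 3)%N -> n.+1%:R ^+ k * phi (m + n.+1%:R) @[n --> \oo] --> 0.
Proof.
move=> k3.
have h := @cvgMl_tmp _ _ _ eventually_filter harmonic (normal_peak s * 16 * s ^+ 4) 0 (@cvg_harmonic R).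
rewrite mulr0 in h.
apply: (squeeze_cvgr _ (cvg_cst 0) h); apply: nearW => n.
rewrite mulr_ge0 ?exprn_ge0//= (le_trans _ (phi_tail n))// ler_wpM2r//.
by rewrite ler_weXn2l ?ler1n.
Qed.

(** The starting value of the recursion is the total mass of a probability. *)
Let M0_cvg : M 0 n.+1%:R @[n --> \oo] --> (1 : R).
Proof.
have nu1 : (\int[normal_prob m s]_x ((x - m) ^+ 0)%:E = 1%:E)%E.
  transitivity (\int[normal_prob m s]_x (cst 1%:E x))%E.
    by apply: eq_integral => x _; rewrite expr0.
  rewrite integral_cst// mul1e; exact: (@probability_setT _ _ _ (normal_prob m s)).
by have := M_cvge (isT : ~~ odd 0); rewrite nu1 => /fine_cvg.
Qed.

Let M2_cvg : M 2 n.+1%:R @[n --> \oo] --> s ^+ 2.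
Proof.
have -> : (fun n => M 2 n.+1%:R) =
    (fun n => s ^+ 2 * M 0 n.+1%:R - 2 * s ^+ 2 * (n.+1%:R ^+ 1 * phi (m + n.+1%:R))).
  apply/funext => n; have n0 : 0 < n.+1%:R :> R by rewrite ltr0n.
  by have [_ -> _] := truncated_moments n0; rewrite expr1.
rewrite -[X in _ --> X](_ : s ^+ 2 * 1 - 2 * s ^+ 2 * 0 = s ^+ 2); last ring.
by apply: cvgB; apply: cvgMl_tmp; [exact: M0_cvg | exact: cvg_tail].
Qed.

Let M4_cvg : M 4 n.+1%:R @[n --> \oo] --> 3 * s ^+ 4.
Proof.
have -> : (fun n => M 4 n.+1%:R) =
    (fun n => 3 * s ^+ 2 * M 2 n.+1%:R - 2 * s ^+ 2 * (n.+1%:R ^+ 3 * phi (m + n.+1%:R))).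
  apply/funext => n; have n0 : 0 < n.+1%:R :> R by rewrite ltr0n.
  by have [_ _ ->] := truncated_moments n0.
rewrite -[X in _ --> X](_ : 3 * s ^+ 2 * s ^+ 2 - 2 * s ^+ 2 * 0 = 3 * s ^+ 4); last ring.
by apply: cvgB; apply: cvgMl_tmp; [exact: M2_cvg | exact: cvg_tail].
Qed.

Lemma normal_prob_moment2 : (\int[normal_prob m s]_x ((x - m) ^+ 2)%:E = (s ^+ 2)%:E)%E.
Proof. by apply: M_cvg => //; exact: M2_cvg. Qed.

Lemma normal_prob_moment4 : (\int[normal_prob m s]_x ((x - m) ^+ 4)%:E = (3 * s ^+ 4)%:E)%E.
Proof. by apply: M_cvg => //; exact: M4_cvg. Qed.

End normal_moments.

Local Transparent expR.

(** * Integrability, and the transfer from a law to a random variable *)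

Lemma integrable_domin {d : measure_display} {T : measurableType d} {R : realType}
    (mu : {measure set T -> \bar R}) (f g : T -> R) :
  measurable_fun setT f -> (forall w, `|f w| <= g w) ->
  mu.-integrable setT (EFin \o g) -> mu.-integrable setT (EFin \o f).
Proof.
move=> mf fg; apply: le_integrable => //; first exact/measurable_EFinP.
by move=> w _ /=; rewrite lee_fin (le_trans (fg w))// ler_norm.
Qed.

Lemma ge0_integrable {d : measure_display} {T : measurableType d} {R : realType}
    (mu : {measure set T -> \bar R}) (f : T -> R) (v : R) :
  measurable_fun setT f -> (forall w, 0 <= f w) -> (\int[mu]_w (f w)%:E = v%:E)%E ->
  mu.-integrable setT (EFin \o f) /\ \int[mu]_w f w = v.
Proof.
move=> mf f0 fv; split; last by rewrite /Rintegral fv.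
apply/integrableP; split; first exact/measurable_EFinP.
under eq_integral => w _ do rewrite /= ger0_norm//.
by rewrite fv ltry.
Qed.

Lemma integrable_scale {d : measure_display} {T : measurableType d} {R : realType}
    (mu : {measure set T -> \bar R}) (D : set T) (f : T -> R) (k : R) : measurable D ->
  mu.-integrable D (EFin \o f) -> mu.-integrable D (EFin \o (fun w => k * f w)).
Proof.
by move=> mD intf; have := integrableZl mD k intf; apply: eq_integrable.
Qed.

Lemma integrable_add {d : measure_display} {T : measurableType d} {R : realType}
    (mu : {measure set T -> \bar R}) (D : set T) (f g : T -> R) : measurable D ->
  mu.-integrable D (EFin \o f) -> mu.-integrable D (EFin \o g) ->
  mu.-integrable D (EFin \o (fun w => f w + g w)).
Proof.
by move=> mD intf intg; have := integrableD mD intf intg; apply: eq_integrable.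
Qed.

Lemma measurable_fun_sub_pow {R : realType} (m : R) (k : nat) :
  measurable_fun setT (fun y : R => (y - m) ^+ k).
Proof.
apply: continuous_measurable_fun => x.
apply: (@cvg_comp _ _ _ (fun x : R => x - m) (fun y => y ^+ k) _ (nbhs (x - m))); last exact: exprn_continuous.
by apply: cvgB; [exact: cvg_id | exact: cvg_cst].
Qed.

(** The first moment has no sign, so monotone convergence does not apply. Integrability follows from
    [|x| <= 1 + x^2]. The part within distance [n + 1] of [m] vanishes by symmetry, and the rest is
    at most [s^2 / (n + 1)]. *)
Lemma normal_prob_mean {R : realType} (m s : R) : s != 0 ->
  (normal_prob m s).-integrable setT (EFin \o (fun y => y - m)) /\
  \int[normal_prob m s]_y (y - m) = 0.
Proof.
move=> s0.
have [i2 I2] : (normal_prob m s).-integrable setT (EFin \o (fun y => (y - m) ^+ 2)) /\ \int[normal_prob m s]_y (y - m) ^+ 2 = s ^+ 2.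
  apply: ge0_integrable; [exact: measurable_fun_sub_pow | by move=> w; exact: sqr_ge0 |].
  exact: normal_prob_moment2.
have m1 : measurable_fun setT (fun y : R => y - m).
  by have := measurable_fun_sub_pow m 1; under eq_fun do rewrite expr1.
have i1 : (normal_prob m s).-integrable setT (EFin \o (fun y => y - m)).
  apply: (@integrable_domin _ _ _ (normal_prob m s) _ (fun y => 1 + (y - m) ^+ 2)) => //.
    move=> w; rewrite -(real_normK (num_real (w - m))).
    have := sqr_ge0 (`|w - m| - 1); have := normr_ge0 (w - m); set x := `|w - m|.
    rewrite sqrrB1 => h1 h2; lra.
  have ic : (normal_prob m s).-integrable setT (EFin \o cst (1 : R)).
    exact: finite_measure_integrable_cst.
  exact: (@integrable_add _ _ _ (normal_prob m s) setT (cst 1) (fun y => (y - m) ^+ 2)).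
split=> //.
have bound (n : nat) : `|\int[normal_prob m s]_y (y - m)| <= s ^+ 2 * n.+1%:R^-1.
  have n0 : 0 < n.+1%:R :> R by rewrite ltr0n.
  pose U : set R := `[m - n.+1%:R, m + n.+1%:R]%classic.
  have mU : measurable U by exact: measurable_itv.
  have mUC : measurable (~` U) by exact: measurableC.
  have IU : \int[normal_prob m s]_(y in U) (y - m) = 0.
    rewrite /Rintegral (@integral_normal_prob_bounded _ _ _ n.+1%:R (fun x => x - m))//.
    - have [M1 _ _] := truncated_moments m s0 n0.
      move: M1; rewrite /Rintegral; under eq_integral do rewrite expr1.
      exact.
    - exact: measurable_funTS.
    - by move=> x; rewrite /U /= in_itv/= -ler_distl.
  have -> : \int[normal_prob m s]_y (y - m) = \int[normal_prob m s]_(y in ~` U) (y - m).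
    rewrite -(setUv U) Rintegral_setU//; first by rewrite IU add0r.
      by rewrite setUv.
    by apply/disj_setPCl.
  have iUC : (normal_prob m s).-integrable (~` U) (EFin \o (fun y => y - m)) by exact: integrableS i1.
  have iUC2 : (normal_prob m s).-integrable (~` U) (EFin \o (fun y => (y - m) ^+ 2)) by exact: integrableS i2.
  have hn := @le_normr_Rintegral _ _ _ (normal_prob m s) (~` U) (fun y => y - m) mUC iUC.
  apply: le_trans hn _.
  apply: (@le_trans _ _ (\int[normal_prob m s]_(y in ~` U) (n.+1%:R^-1 * (y - m) ^+ 2))).
    apply: le_Rintegral => //.
    - exact: (integrable_norm iUC).
    - exact: integrable_scale.
    - move=> y; rewrite /U /= in_itv/= => /negP; rewrite -ler_distl -ltNge => yn.
      rewrite ler_pdivlMl// -(real_normK (num_real (y - m))) expr2 ler_wpM2r//.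
      exact: ltW.
  rewrite RintegralZl//.
  rewrite mulrC ler_wpM2r ?invr_ge0 ?(ltW n0)// -I2.
  rewrite -[X in _ <= X](_ : \int[normal_prob m s]_(y in U `|` ~` U) (y - m) ^+ 2 = _); last by rewrite setUv.
  rewrite Rintegral_setU ?setUv//; last by apply/disj_setPCl.
  by rewrite lerDr; apply: Rintegral_ge0 => y _; exact: sqr_ge0.
apply/eqP; rewrite -normr_le0.
have h := @cvgMl_tmp _ _ _ eventually_filter harmonic (s ^+ 2) 0 (@cvg_harmonic R).
rewrite mulr0 in h.
rewrite -(cvg_lim (@Rhausdorff R) h); apply: limr_ge; first by apply/cvg_ex; eexists; exact: h.
by near=> n; exact: bound.
Unshelve. all: by end_near. Qed.

Section transfer.
Context {d : measure_display} {T : measurableType d} {R : realType} (P : probability T R).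
Context (Y : T -> R) (mY : measurable_fun setT Y).
Context (nu : {measure set (measurableTypeR R) -> \bar R}).
Context (lawY : forall A : set R, measurable A -> P (Y @^-1` A) = nu A).

Let Y_mfun : {mfun T >-> measurableTypeR R} :=
  HB.pack_for {mfun T >-> measurableTypeR R} Y
    (isMeasurableFun.Build _ _ T (measurableTypeR R) Y mY).

Lemma ge0_integral_law (f : R -> \bar R) : measurable_fun setT f -> (forall y, 0 <= f y)%E ->
  (\int[P]_w f (Y w) = \int[nu]_y f y)%E.
Proof.
move=> mf f0.
transitivity (\int[distribution P Y_mfun]_y f y)%E; first by rewrite ge0_integral_distribution.
by apply: (eq_measure_integral nu) => A mA _; exact: lawY.
Qed.

Lemma Rintegral_law (f : R -> R) : measurable_fun setT f ->
  nu.-integrable setT (EFin \o f) ->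
  P.-integrable setT (EFin \o (fun w => f (Y w))) /\ \int[P]_w f (Y w) = \int[nu]_y f y.
Proof.
move=> mf intf.
have ip : P.-integrable setT (EFin \o (fun w => f (Y w))).
  apply/integrableP; split.
    by apply/measurable_EFinP; apply: measurableT_comp.
  have -> : (\int[P]_x `|(EFin \o (fun w => f (Y w))) x| = \int[nu]_y `|(EFin \o f) y|)%E.
    apply: (@ge0_integral_law (fun y => `|(f y)%:E|)%E) => //.
    by apply: measurableT_comp => //; exact/measurable_EFinP.
  by move/integrableP : intf => [].
split=> //; rewrite /Rintegral; congr fine.
transitivity (\int[distribution P Y_mfun]_y (f y)%:E)%E.
  by rewrite integral_distribution//; exact/measurable_EFinP.
by apply: (eq_measure_integral nu) => A mA _; exact: lawY.
Qed.

End transfer.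

Lemma measurable_abs_gt {d : measure_display} {T : measurableType d} {R : realType}
    (f : T -> R) (a : R) : measurable_fun setT f -> measurable [set w | (a < `|f w|)%R].
Proof.
move=> mf; have -> : [set w | (a < `|f w|)%R] = (fun w => `|f w|) @^-1` `]a, +oo[%classic.
  by apply/seteqP; split=> w; rewrite /= in_itv/= andbT.
rewrite -[X in measurable X]setTI.
have mn : measurable_fun setT (fun w => `|f w|) by apply: (measurableT_comp _ mf).
exact: (mn measurableT _ (measurable_itv _)).
Qed.

Lemma measurable_abs_sub_gt {R : realType} (m a : R) : measurable [set y : R | (a < `|y - m|)%R].
Proof.
apply: measurable_abs_gt; have := measurable_fun_sub_pow m 1.
by under eq_fun do rewrite expr1.
Qed.

(** Compare with the density of variance [2 s^2]: its peak is smaller by a factor [sqrt 2] and its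
    exponent is halved, and on the event the other half of the exponent is at least [x / 4]. The
    product form [s ^+ 2 * x <= a ^+ 2] stays meaningful for the degenerate laws that occur
    later. *)
Lemma normal_prob_tail {R : realType} (m s a x : R) : s != 0 -> s ^+ 2 * x <= a ^+ 2 -> 0 <= a ->
  (normal_prob m s [set y | (a < `|y - m|)%R] <= (Num.sqrt 2 * expR (- x / 4))%:E)%E.
Proof.
move=> s0 sx a0.
have s2 : 0 < s ^+ 2 by rewrite exprn_even_gt0.
have r0 : Num.sqrt 2 * s != 0 :> R by rewrite mulf_neq0// sqrtr_eq0 -ltNge.
have r2 : 0 < Num.sqrt 2 :> R by rewrite sqrtr_gt0.
have r22 : (Num.sqrt 2 * s) ^+ 2 = 2 * s ^+ 2 by rewrite exprMn sqr_sqrtr.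
have peakE : normal_peak s = Num.sqrt 2 * normal_peak (Num.sqrt 2 * s).
  rewrite /normal_peak r22.
  have -> : 2 * s ^+ 2 * pi *+ 2 = 2 * (s ^+ 2 * pi *+ 2) :> R by ring.
  by rewrite (sqrtrM (s ^+ 2 * pi *+ 2))// invfM mulrA mulfV ?mul1r// gt_eqF.
pose A := [set y : R | (a < `|y - m|)%R].
have mA : measurable A by exact: measurable_abs_sub_gt.
pose k := Num.sqrt 2 * expR (- x / 4).
have k0 : 0 <= k by rewrite mulr_ge0 ?expR_ge0// ltW.
have pdf_le y : A y -> normal_pdf m s y <= k * normal_pdf m (Num.sqrt 2 * s) y.
  move=> Ay; rewrite !normal_pdfE// peakE /k /normal_fun.
  set u := expR (- (y - m) ^+ 2 / _); set v := expR (- (y - m) ^+ 2 / _).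
  have uv : u <= expR (- x / 4) * v.
    rewrite /u /v r22 -expRD ler_expR.
    have xy : s ^+ 2 * x <= (y - m) ^+ 2.
      apply: le_trans sx _; rewrite -(real_normK (num_real (y - m))).
      by apply: lerXn2r; rewrite ?nnegrE// ltW.
    set q := (y - m) ^+ 2 in xy *.
    have -> : - q / (s ^+ 2 *+ 2) = (- q / s ^+ 2) / 4 + (- q / s ^+ 2) / 4.
      by field.
    have -> : - q / (2 * s ^+ 2 *+ 2) = (- q / s ^+ 2) / 4 by field.
    rewrite lerD2r ler_wpM2r// mulNr lerN2 ler_pdivlMr// mulrC.
    exact: xy.
  have p0 := normal_peak_ge0 (Num.sqrt 2 * s).
  move: uv; set p := normal_peak _ in p0 *; set e := expR _; set c := Num.sqrt 2 in r2 *.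
  move=> uv; have -> : c * e * (p * v) = c * p * (e * v) by ring.
  by apply: ler_wpM2l => //; apply: mulr_ge0 => //; exact: ltW.
rewrite /normal_prob -/A.
have mpdf D t : measurable D -> measurable_fun D (fun y : R => (normal_pdf m t y)%:E).
  by move=> mD; apply: measurable_funTS; apply/measurable_EFinP; exact: measurable_normal_pdf.
apply: (@le_trans _ _ (\int[lebesgue_measure]_(y in A) (k%:E * (normal_pdf m (Num.sqrt 2 * s) y)%:E))%E).
  apply: ge0_le_integral => //.
  - by move=> y _; rewrite lee_fin normal_pdf_ge0.
  - exact: mpdf.
  - by apply: measurable_funeM; exact: mpdf.
rewrite ge0_integralZl//; last 2 first.
- exact: mpdf.
- by move=> y _; rewrite lee_fin normal_pdf_ge0.
rewrite -[X in (_ <= X)%E]mule1; apply: lee_wpmul2l; first by rewrite lee_fin.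
exact: (@probability_le1 _ _ _ (normal_prob m (Num.sqrt 2 * s)) _ mA).
Qed.

(** The same formulas cover both kinds of Gaussian law: for a Dirac mass [s = 0], the central
    moments vanish and the tail event is null. *)
Lemma gaussian_rv_moments {d : measure_display} {T : measurableType d} {R : realType}
    (P : probability T R) (Y : T -> R) : gaussian_rv P Y ->
  exists m s : R,
  [/\ P.-integrable setT (EFin \o Y) /\ \int[P]_w Y w = m,
      P.-integrable setT (EFin \o (fun w => (Y w - m) ^+ 2)) /\
        \int[P]_w (Y w - m) ^+ 2 = s ^+ 2,
      P.-integrable setT (EFin \o (fun w => (Y w - m) ^+ 4)) /\
        \int[P]_w (Y w - m) ^+ 4 = 3 * s ^+ 4 &
      forall a x, 0 <= a -> s ^+ 2 * x <= a ^+ 2 ->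
        (P [set w | (a < `|Y w - m|)%R] <= (Num.sqrt 2 * expR (- x / 4))%:E)%E].
Proof.
move=> [mY [m [s lawY]]]; exists m, s.
have mA (a : R) : measurable [set y : R | (a < `|y - m|)%R] by exact: measurable_abs_sub_gt.
have mean : P.-integrable setT (EFin \o (fun w => Y w - m)) -> \int[P]_w (Y w - m) = 0 ->
    P.-integrable setT (EFin \o Y) /\ \int[P]_w Y w = m.
  move=> i1 I1; have ic : P.-integrable setT (EFin \o (fun=> m)).
    exact: finite_measure_integrable_cst.
  have iY : P.-integrable setT (EFin \o Y).
    have := integrable_add measurableT i1 ic; apply: eq_integrable => // w _ /=.
    by rewrite subrK.
  have Im : \int[P]_w m = m by rewrite Rintegral_cst// (_ : fine _ = 1) ?mulr1//; rewrite -[RHS]/(fine 1%E) -(@probability_setT _ _ _ P).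
  split=> //; move: I1; rewrite RintegralB// Im.
  by move/eqP; rewrite subr_eq0 => /eqP.
have m1 : measurable_fun setT (fun y : R => y - m) by have := measurable_fun_sub_pow m 1; under eq_fun do rewrite expr1.
have [s0|s0] := eqVneq s 0; move: lawY; rewrite ?s0 ?(negbTE s0) ?eqxx => lawY.
  have dir k : P.-integrable setT (EFin \o (fun w => (Y w - m) ^+ k.+1)) /\
      \int[P]_w (Y w - m) ^+ k.+1 = 0.
    have [] := Rintegral_law mY (nu := @dirac _ (measurableTypeR R) m R) (f := fun y => (y - m) ^+ k.+1) lawY.
    - exact: measurable_fun_sub_pow.
    - apply/integrableP; split.
        by apply/measurable_EFinP; exact: measurable_fun_sub_pow.
      rewrite integral_dirac//; last first.
        by apply: measurableT_comp => //; apply/measurable_EFinP; exact: measurable_fun_sub_pow.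
      by rewrite diracT mul1e /= subrr expr0n normr0 ltry.
    move=> -> ->; split=> //.
    rewrite /Rintegral integral_dirac//; last first.
      by apply/measurable_EFinP; exact: measurable_fun_sub_pow.
    by rewrite diracT mul1e /= subrr expr0n.
  split.
  - have [] := dir 0%N; under eq_Rintegral do rewrite expr1.
    by move=> i1 I1; apply: mean => //; exact: i1.
  - by rewrite expr2 mul0r; exact: dir.
  - by rewrite expr0n mulr0; exact: dir.
  - move=> a x a0 _; rewrite (lawY [set y : R | (a < `|y - m|)%R])// diracE memNset; last first.
      by rewrite /= subrr normr0 => /(le_lt_trans a0); rewrite ltxx.
    by rewrite lee_fin mulr_ge0// expR_ge0.
have law := Rintegral_law mY (nu := normal_prob m s) lawY.
have m0 k : measurable_fun setT (fun y : R => (y - m) ^+ k) := @measurable_fun_sub_pow R m k.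
have nuP k v : (forall y : R, 0 <= (y - m) ^+ k) ->
    (\int[normal_prob m s]_y ((y - m) ^+ k)%:E = v%:E)%E ->
    P.-integrable setT (EFin \o (fun w => (Y w - m) ^+ k)) /\ \int[P]_w (Y w - m) ^+ k = v.
  move=> p0 I; have [i J] := @ge0_integrable _ _ _ (normal_prob m s) _ v (m0 k) p0 I.
  by have [i' I'] := law _ (m0 k) i; split=> //; rewrite I'.
have [i1 I1] := normal_prob_mean m s0.
split.
- by have [i1' I1'] := law _ m1 i1; apply: mean => //; rewrite I1'.
- by apply: nuP; [move=> y; exact: sqr_ge0 | exact: normal_prob_moment2].
- by apply: nuP; [move=> y; rewrite exprn_even_ge0 | exact: normal_prob_moment4].
- move=> a x a0 sx; rewrite (lawY [set y : R | (a < `|y - m|)%R])//.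
  exact: normal_prob_tail.
Qed.

(** * Fractional Brownian motion: quadratic variation and regularity *)

Section random_variables.
Context {d : measure_display} {T : measurableType d} {R : realType} (P : probability T R).
Implicit Types X Y : T -> R.

Definition integ X := P.-integrable setT (EFin \o X).

Lemma integ_add X Y : integ X -> integ Y -> integ (fun w => X w + Y w).
Proof. exact: integrable_add. Qed.

Lemma integ_scale k X : integ X -> integ (fun w => k * X w).
Proof. exact: integrable_scale. Qed.

Lemma integ_cst k : integ (fun=> k).
Proof. exact: finite_measure_integrable_cst. Qed.

Lemma integral_add X Y : integ X -> integ Y ->
  \int[P]_w (X w + Y w) = \int[P]_w X w + \int[P]_w Y w.
Proof. by move=> iX iY; rewrite RintegralD. Qed.

Lemma integral_scale k X : integ X -> \int[P]_w (k * X w) = k * \int[P]_w X w.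
Proof. by move=> iX; rewrite RintegralZl. Qed.

Lemma integral_cst_prob k : \int[P]_w k = k.
Proof.
rewrite Rintegral_cst// (_ : fine _ = 1) ?mulr1//.
by rewrite -[RHS]/(fine 1%E) -(@probability_setT _ _ _ P).
Qed.

Lemma integral_sum n (X : nat -> T -> R) : (forall i, (i < n)%N -> integ (X i)) ->
  integ (fun w => \sum_(0 <= i < n) X i w) /\
  \int[P]_w (\sum_(0 <= i < n) X i w) = \sum_(0 <= i < n) \int[P]_w X i w.
Proof.
elim: n => [|n IH] iX.
  have -> : (fun w => \sum_(0 <= i < 0) X i w) = (fun=> 0).
    by apply/funext => w; rewrite big_nil.
  by rewrite big_nil integral_cst_prob; split=> //; exact: integ_cst.
have [i1 I1] := IH (fun i ilt => iX i (ltnW ilt)).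
have -> : (fun w => \sum_(0 <= i < n.+1) X i w) = (fun w => \sum_(0 <= i < n) X i w + X n w).
  by apply/funext => w; rewrite big_nat_recr.
by rewrite big_nat_recr//= -I1; split; [apply: integ_add | apply: integral_add] => //; exact: iX.
Qed.

(** The trace of Gaussianity in the variance computation is the relation between the fourth and the
    second moment, which holds for degenerate laws as well. *)
Definition centered_gaussian_moments X :=
  [/\ measurable_fun setT X, integ (fun w => X w ^+ 2), integ (fun w => X w ^+ 4) &
      \int[P]_w X w ^+ 4 = 3 * (\int[P]_w X w ^+ 2) ^+ 2].

Lemma integ_mul X Y : measurable_fun setT X -> measurable_fun setT Y ->
  integ (fun w => X w ^+ 2) -> integ (fun w => Y w ^+ 2) -> integ (fun w => X w * Y w).
Proof.
move=> mX mY iX iY.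
apply: (@integrable_domin _ _ _ P _ (fun w => X w ^+ 2 + Y w ^+ 2)); last exact: integ_add.
  exact: measurable_funM.
move=> w; rewrite normrM -(real_normK (num_real (X w))) -(real_normK (num_real (Y w))).
have := sqr_ge0 (`|X w| - `|Y w|); have := sqr_ge0 (`|X w|); have := sqr_ge0 (`|Y w|).
rewrite sqrrB; set x := `|X w|; set y := `|Y w| => h1 h2 h3.
have h : 0 <= x ^+ 2 - x * y *+ 2 + y ^+ 2 by []; lra.
Qed.

(** For two variables of the same second moment [v] this bounds the covariance by [v], as
    Cauchy-Schwarz would. *)
Lemma integral_mul_le X Y : measurable_fun setT X -> measurable_fun setT Y ->
  integ (fun w => X w ^+ 2) -> integ (fun w => Y w ^+ 2) ->
  \int[P]_w (X w * Y w) <= (\int[P]_w X w ^+ 2 + \int[P]_w Y w ^+ 2) / 2.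
Proof.
move=> mX mY iX iY; rewrite ler_pdivlMr// mulrC -integral_scale; last exact: integ_mul.
rewrite -integral_add//; apply: le_Rintegral => //.
- by apply: integ_scale; exact: integ_mul.
- exact: integ_add.
- by move=> w _; have := sqr_ge0 (X w - Y w); rewrite sqrrB => h; lra.
Qed.

(* Polarization: 12 x^2 y^2 = (x + y)^4 + (x - y)^4 - 2 x^4 - 2 y^4. *)
Lemma gaussian_isserlis X Y :
  centered_gaussian_moments X -> centered_gaussian_moments Y ->
  centered_gaussian_moments (fun w => X w + Y w) ->
  centered_gaussian_moments (fun w => X w - Y w) ->
  integ (fun w => X w ^+ 2 * Y w ^+ 2) /\
  \int[P]_w (X w ^+ 2 * Y w ^+ 2) =
    \int[P]_w X w ^+ 2 * \int[P]_w Y w ^+ 2 + 2 * (\int[P]_w (X w * Y w)) ^+ 2.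
Proof.
move=> [mX iX2 iX4 X4] [mY iY2 iY4 Y4] [_ iS2 iS4 S4] [_ iD2 iD4 D4].
have iXY := integ_mul mX mY iX2 iY2.
have sq (e : R) : e ^+ 2 = 1 -> \int[P]_w (X w + e * Y w) ^+ 2 =
    \int[P]_w X w ^+ 2 + (\int[P]_w Y w ^+ 2 + 2 * e * \int[P]_w (X w * Y w)).
  move=> e1; rewrite -integral_scale// -integral_add//; last exact: integ_scale.
  rewrite -integral_add//; last by apply: integ_add => //; exact: integ_scale.
  by apply: eq_Rintegral => w _; rewrite sqrrD exprMn e1 mulr2n; ring.
have S2 : \int[P]_w (X w + Y w) ^+ 2 =
    \int[P]_w X w ^+ 2 + (\int[P]_w Y w ^+ 2 + 2 * \int[P]_w (X w * Y w)).
  have := sq 1 (expr1n _ _); rewrite mulr1 => <-.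
  by apply: eq_Rintegral => w _; rewrite mul1r.
have D2 : \int[P]_w (X w - Y w) ^+ 2 =
    \int[P]_w X w ^+ 2 + (\int[P]_w Y w ^+ 2 + (- 2) * \int[P]_w (X w * Y w)).
  have := sq (-1) (sqrr_sign _ 1); rewrite mulrN1 => <-.
  by apply: eq_Rintegral => w _; rewrite mulN1r.
pose F w := 12^-1 * ((X w + Y w) ^+ 4 + ((X w - Y w) ^+ 4 + ((- 2) * X w ^+ 4 + (- 2) * Y w ^+ 4))).
have FE : (fun w => X w ^+ 2 * Y w ^+ 2) = F.
  by apply/funext => w; rewrite /F; field.
have iX4' := integ_scale (- 2) iX4; have iY4' := integ_scale (- 2) iY4.
have i1 := integ_add iX4' iY4'; have i2 := integ_add iD4 i1; have i3 := integ_add iS4 i2.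
rewrite FE; split; first exact: integ_scale.
rewrite /F integral_scale// integral_add// integral_add// integral_add// !integral_scale//.
by rewrite S4 D4 X4 Y4 S2 D2; field.
Qed.

Section quadratic_variation.
Context (n : nat) (D : nat -> T -> R) (v : R) (v0 : 0 <= v).
Context (Dgauss : forall i, (i < n)%N -> centered_gaussian_moments (D i)).
Context (DDgauss : forall i j, (i < n)%N -> (j < n)%N ->
  centered_gaussian_moments (fun w => D i w + D j w)).
Context (DBgauss : forall i j, (i < n)%N -> (j < n)%N ->
  centered_gaussian_moments (fun w => D i w - D j w)).
Context (D2 : forall i, (i < n)%N -> \int[P]_w D i w ^+ 2 = v).
Context (Dcov : forall i j, (i < n)%N -> (j < n)%N -> 0 <= \int[P]_w (D i w * D j w)).

(** By [gaussian_isserlis] the covariance of two squared increments is twice the squared covariance.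
    Since [0 <= cov <= v], one has [cov^2 <= v cov], and the covariances add up to the second moment
    of the sum of the increments, which is at most [A]. *)
Lemma quadratic_variation_variance (k : nat) (l A : R) : (k <= n)%N ->
  \int[P]_w (\sum_(0 <= j < k) D j w) ^+ 2 <= A ->
  integ (fun w => (\sum_(0 <= j < k) (l * D j w ^+ 2 - l * v)) ^+ 2) /\
  \int[P]_w (\sum_(0 <= j < k) (l * D j w ^+ 2 - l * v)) ^+ 2 <= 2 * l ^+ 2 * v * A.
Proof.
move=> kn sumA.
have lt i : (i < k)%N -> (i < n)%N by move=> ik; exact: leq_trans kn.
have prod2 (f g : nat -> R) : (\sum_(0 <= i < k) f i) * (\sum_(0 <= j < k) g j) =
    \sum_(0 <= i < k) \sum_(0 <= j < k) f i * g j.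
  by rewrite mulr_suml; apply: eq_bigr => i _; rewrite mulr_sumr.
have iDD i j : (i < k)%N -> (j < k)%N -> integ (fun w => D i w * D j w).
  move=> /lt ik /lt jk; have [mi i2 _ _] := Dgauss ik; have [mj j2 _ _] := Dgauss jk.
  exact: integ_mul.
pose G i j w := (l * D i w ^+ 2 - l * v) * (l * D j w ^+ 2 - l * v).
have GI i j : (i < k)%N -> (j < k)%N ->
    integ (G i j) /\ \int[P]_w G i j w = 2 * l ^+ 2 * (\int[P]_w (D i w * D j w)) ^+ 2.
  move=> /lt ik /lt jk.
  have [iD I] := gaussian_isserlis (Dgauss ik) (Dgauss jk) (DDgauss ik jk) (DBgauss ik jk).
  have [_ i2 _ _] := Dgauss ik; have [_ j2 _ _] := Dgauss jk.
  pose F w := l ^+ 2 * (D i w ^+ 2 * D j w ^+ 2 + ((- v) * D i w ^+ 2 + ((- v) * D j w ^+ 2 + v ^+ 2))).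
  have -> : G i j = F by apply/funext => w; rewrite /G /F; ring.
  have i2' := integ_scale (- v) i2; have j2' := integ_scale (- v) j2.
  have h1 := integ_add j2' (integ_cst (v ^+ 2)); have h2 := integ_add i2' h1.
  have h3 := integ_add iD h2; split; first exact: integ_scale.
  rewrite /F integral_scale// integral_add// integral_add// integral_add//; last exact: integ_cst.
  by rewrite (integral_cst_prob (v ^+ 2)) (integral_scale _ i2) (integral_scale _ j2) I !D2//; ring.
have GE : (fun w => (\sum_(0 <= j < k) (l * D j w ^+ 2 - l * v)) ^+ 2) =
    (fun w => \sum_(0 <= i < k) \sum_(0 <= j < k) G i j w).
  by apply/funext => w; rewrite expr2 prod2.
have GS i : (i < k)%N -> integ (fun w => \sum_(0 <= j < k) G i j w) /\
    \int[P]_w (\sum_(0 <= j < k) G i j w) =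
      \sum_(0 <= j < k) 2 * l ^+ 2 * (\int[P]_w (D i w * D j w)) ^+ 2.
  move=> ik; have [i1 I1] := integral_sum (fun j (jk : (j < k)%N) => (GI i j ik jk).1).
  by split=> //; rewrite I1; apply: eq_big_nat => j /andP[_ jk]; exact: (GI i j ik jk).2.
have [iS IS] := integral_sum (fun i (ik : (i < k)%N) => (GS i ik).1).
split; first by rewrite GE.
have -> : \int[P]_w (\sum_(0 <= j < k) (l * D j w ^+ 2 - l * v)) ^+ 2 =
    \int[P]_w (\sum_(0 <= i < k) \sum_(0 <= j < k) G i j w).
  by congr (Rintegral _ _ _); exact: GE.
rewrite IS.
have [iC IC] : integ (fun w => (\sum_(0 <= j < k) D j w) ^+ 2) /\
    \int[P]_w (\sum_(0 <= j < k) D j w) ^+ 2 =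
      \sum_(0 <= i < k) \sum_(0 <= j < k) \int[P]_w (D i w * D j w).
  have E : (fun w => (\sum_(0 <= j < k) D j w) ^+ 2) =
      (fun w => \sum_(0 <= i < k) \sum_(0 <= j < k) D i w * D j w).
    by apply/funext => w; rewrite expr2 prod2.
  have S i : (i < k)%N -> integ (fun w => \sum_(0 <= j < k) D i w * D j w) /\
      \int[P]_w (\sum_(0 <= j < k) D i w * D j w) = \sum_(0 <= j < k) \int[P]_w (D i w * D j w).
    by move=> ik; apply: integral_sum => j jk; exact: iDD.
  have [i1 I1] := integral_sum (fun i (ik : (i < k)%N) => (S i ik).1).
  split; first by rewrite E.
  transitivity (\int[P]_w (\sum_(0 <= i < k) \sum_(0 <= j < k) D i w * D j w)).
    by congr (Rintegral _ _ _); exact: E.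
  by rewrite I1; apply: eq_big_nat => i /andP[_ ik]; exact: (S i ik).2.
apply: (@le_trans _ _ (2 * l ^+ 2 * v * \sum_(0 <= i < k) \sum_(0 <= j < k) \int[P]_w (D i w * D j w))); last first.
  by rewrite -IC ler_wpM2l// mulr_ge0// mulr_ge0// sqr_ge0.
rewrite mulr_sumr big_nat [X in _ <= X]big_nat; apply: ler_sum => i /andP[_ ik].
rewrite (GS i ik).2 mulr_sumr big_nat [X in _ <= X]big_nat; apply: ler_sum => j /andP[_ jk].
rewrite -[X in _ <= X]mulrA; apply: ler_wpM2l; first by rewrite mulr_ge0// sqr_ge0.
rewrite expr2; apply: ler_wpM2r; first exact: Dcov (lt i ik) (lt j jk).
have [mi i2 _ _] := Dgauss (lt i ik); have [mj j2 _ _] := Dgauss (lt j jk).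
apply: le_trans (integral_mul_le mi mj i2 j2) _.
by rewrite (D2 (lt i ik)) (D2 (lt j jk)); lra.
Qed.

End quadratic_variation.
End random_variables.

Lemma chebyshev_sq {d : measure_display} {T : measurableType d} {R : realType}
    (P : probability T R) (X : T -> R) (a : R) : measurable_fun setT X ->
  integ P (fun w => X w ^+ 2) -> 0 < a ->
  (P [set w | (a < `|X w|)%R] <= ((\int[P]_w X w ^+ 2) / a ^+ 2)%:E)%E.
Proof.
move=> mX iX a0; pose A := [set w | (a < `|X w|)%R].
have mA : measurable A by exact: measurable_abs_gt.
have a2 : 0 < a ^+ 2 by rewrite exprn_gt0.
have mX2 D : measurable_fun D (fun w => (X w ^+ 2)%:E).
  by apply: measurable_funTS; exact: measurable_int iX.
rewrite -/A mulrC EFinM lee_pdivlMl//.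
have -> : ((\int[P]_w X w ^+ 2)%:E = \int[P]_w (X w ^+ 2)%:E)%E.
  by rewrite /Rintegral fineK//; exact: integrable_fin_num.
rewrite -(integral_cst P mA); apply: le_trans (_ : (\int[P]_(w in A) (X w ^+ 2)%:E <= _)%E).
  apply: ge0_le_integral => //.
  - by move=> w _; rewrite lee_fin ltW.
  - move=> w Aw; rewrite lee_fin -(real_normK (num_real (X w))).
    by apply: lerXn2r; rewrite ?nnegrE// ltW.
apply: ge0_subset_integral => //.
by move=> w _; rewrite lee_fin sqr_ge0.
Qed.

(** Convexity at the midpoint [x] of [x + h] and [x - h]. With [p = 2 H] it decides the sign of the
    covariances of increments. *)
Lemma powR_abs_midconvex {R : realType} (p x h : R) : 1 <= p ->
  2 * `|x| `^ p <= `|x + h| `^ p + `|x - h| `^ p.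
Proof.
move=> p1; have p0 : 0 <= p by rewrite (le_trans ler01).
have conv := convex_powR p1.
have h12 : `|x| <= 2^-1 * `|x + h| + (1 - 2^-1) * `|x - h|.
  have -> : x = 2^-1 * ((x + h) + (x - h)) by field.
  have -> : 2^-1 * ((x + h) + (x - h)) + h = x + h by field.
  have -> : 2^-1 * ((x + h) + (x - h)) - h = x - h by field.
  by rewrite normrM ger0_norm//; have := ler_normD (x + h) (x - h); lra.
have h3 : `|x| `^ p <= (2^-1 * `|x + h| + (1 - 2^-1) * `|x - h|) `^ p.
  apply: ge0_ler_powR => //; rewrite nnegrE//.
  by have := normr_ge0 (x + h); have := normr_ge0 (x - h); lra.
have t0 : (0 : R) <= 2^-1 by rewrite invr_ge0.
have t1 : (2^-1 : R) <= 1 by rewrite invf_le1// ler1n.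
have := conv (Itv01 t0 t1) `|x + h| `|x - h|.
rewrite !inE /= !in_itv /= !andbT => /(_ (normr_ge0 _) (normr_ge0 _)).
move=> hc; have h4 : (2^-1 * `|x + h| + (1 - 2^-1) * `|x - h|) `^ p <=
  2^-1 * `|x + h| `^ p + (1 - 2^-1) * `|x - h| `^ p := hc.
by have h5 := le_trans h3 h4; lra.
Qed.

Section fractional_brownian_motion.
Context {d : measure_display} {T : measurableType d} {R : realType}
  (P : probability T R) (H : R) (B : R -> T -> R) (fB : fBm P H B).
Implicit Types X Y : T -> R.

Let H0 : 0 < H. Proof. by case: fB => /andP[]. Qed.
Let B_gaussian : gaussian_process P B. Proof. by case: fB. Qed.
Let B_mean (t : R) : t \in `[0, 1] -> ('E_P[B t] = 0)%E. Proof. by case: fB => _ _ h _ _; exact: h. Qed.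

Definition lincomb (s : seq (R * R)) (w : T) : R := \sum_(p <- s) p.1 * B p.2 w.

(** With lists of pairs of a coefficient and a time, sums are concatenations. Increments, and sums
    and differences of increments, are Gaussian as members of this span. *)
Definition gaussian_span X :=
  exists2 s : seq (R * R), (forall p, p \in s -> p.2 \in `[0, 1]) & X = lincomb s.

Lemma gaussian_span_B t : t \in `[0, 1] -> gaussian_span (B t).
Proof.
move=> t01; exists [:: (1, t)]; first by move=> p; rewrite inE => /eqP ->.
by apply/funext => w; rewrite /lincomb big_seq1 mul1r.
Qed.

Lemma gaussian_span_add X Y : gaussian_span X -> gaussian_span Y ->
  gaussian_span (fun w => X w + Y w).
Proof.
move=> [s hs ->] [s' hs' ->]; exists (s ++ s').
  by move=> p; rewrite mem_cat => /orP[/hs|/hs'].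
by apply/funext => w; rewrite /lincomb big_cat.
Qed.

Lemma gaussian_span_sub X Y : gaussian_span X -> gaussian_span Y ->
  gaussian_span (fun w => X w - Y w).
Proof.
move=> hX [s' hs' ->]; apply: (gaussian_span_add hX).
exists [seq (- p.1, p.2) | p <- s']; first by move=> p /mapP[q /hs' h ->].
apply/funext => w; rewrite /lincomb big_map -sumrN.
by apply: eq_bigr => p _; rewrite mulNr.
Qed.

Lemma gaussian_span_rv X : gaussian_span X -> gaussian_rv P X.
Proof.
move=> [s hs ->].
have -> : lincomb s = fun w => \sum_(i < size s) (tnth (in_tuple s) i).1 * B (tnth (in_tuple s) i).2 w.
  by apply/funext => w; rewrite /lincomb big_tnth.
by apply: B_gaussian => i; apply: hs; exact: mem_tnth.
Qed.

Lemma gaussian_span_mean X : gaussian_span X -> integ P X /\ \int[P]_w X w = 0.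
Proof.
move=> [s hs ->]; elim: s hs => [|p s IH] hs.
  have -> : lincomb [::] = fun=> 0 by apply/funext => w; rewrite /lincomb big_nil.
  by rewrite integral_cst_prob; split=> //; exact: integ_cst.
have [is0 Is] : integ P (lincomb s) /\ \int[P]_w lincomb s w = 0.
  by apply: IH => q qs; apply: hs; rewrite inE qs orbT.
have p01 : p.2 \in `[0, 1] by apply: hs; rewrite inE eqxx.
have -> : lincomb (p :: s) = fun w => p.1 * B p.2 w + lincomb s w.
  by apply/funext => w; rewrite /lincomb big_cons.
have [m [s' [[iB _] _ _ _]]] := gaussian_rv_moments (gaussian_span_rv (gaussian_span_B p01)).
split; first by apply: integ_add => //; exact: integ_scale.
rewrite integral_add//; last exact: integ_scale.
rewrite Is addr0 (integral_scale p.1 iB); have := B_mean p01.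
by rewrite unlock /Rintegral => ->; rewrite mulr0.
Qed.

Lemma gaussian_span_moments X : gaussian_span X -> centered_gaussian_moments P X.
Proof.
move=> gX; have [m [s [[_ Im] [i2 I2] [i4 I4] _]]] := gaussian_rv_moments (gaussian_span_rv gX).
have [_ I0] := gaussian_span_mean gX; rewrite I0 in Im; rewrite -Im in i2 I2 i4 I4.
have E k : (fun w => (X w - 0) ^+ k) = fun w => X w ^+ k by apply/funext => w; rewrite subr0.
split.
- by case: (gaussian_span_rv gX).
- by move: i2; rewrite E.
- by move: i4; rewrite E.
- by move: I2 I4; rewrite !E => -> ->; ring.
Qed.

Lemma gaussian_span_tail X a x : gaussian_span X -> 0 <= a ->
  \int[P]_w X w ^+ 2 * x <= a ^+ 2 ->
  (P [set w | (a < `|X w|)%R] <= (Num.sqrt 2 * expR (- x / 4))%:E)%E.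
Proof.
move=> gX; have [m [s [[_ Im] [i2 I2] _ tail]]] := gaussian_rv_moments (gaussian_span_rv gX).
have [_ I0] := gaussian_span_mean gX; rewrite I0 in Im.
move=> a0 h; have := tail a x a0; rewrite -Im.
have -> : [set w | (a < `|X w - 0|)%R] = [set w | (a < `|X w|)%R].
  by apply/seteqP; split=> w /=; rewrite subr0.
apply; rewrite -I2 -Im.
have -> : (fun w => (X w - 0) ^+ 2) = fun w => X w ^+ 2 by apply/funext => w; rewrite subr0.
exact: h.
Qed.

Lemma fBm_cov s t : s \in `[0, 1] -> t \in `[0, 1] ->
  integ P (fun w => B s w * B t w) /\
  \int[P]_w (B s w * B t w) = 2^-1 * (s `^ (2 * H) + t `^ (2 * H) - `|t - s| `^ (2 * H)).
Proof.
move=> s01 t01.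
have [ms is2 _ _] := gaussian_span_moments (gaussian_span_B s01).
have [mt it2 _ _] := gaussian_span_moments (gaussian_span_B t01).
split; first exact: integ_mul.
case: fB => _ _ _ cov _; have := cov _ _ s01 t01.
by rewrite unlock /Rintegral => ->.
Qed.

Lemma fBm_increment_cov u v x y :
  u \in `[0, 1] -> v \in `[0, 1] -> x \in `[0, 1] -> y \in `[0, 1] ->
  \int[P]_w ((B v w - B u w) * (B y w - B x w)) =
    2^-1 * (`|x - v| `^ (2 * H) + `|y - u| `^ (2 * H)
            - `|y - v| `^ (2 * H) - `|x - u| `^ (2 * H)).
Proof.
move=> u01 v01 x01 y01.
have [i1 I1] := fBm_cov v01 y01; have [i2 I2] := fBm_cov v01 x01.
have [i3 I3] := fBm_cov u01 y01; have [i4 I4] := fBm_cov u01 x01.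
have -> : (fun w => (B v w - B u w) * (B y w - B x w)) =
    (fun w => B v w * B y w + ((- 1) * (B v w * B x w) + ((- 1) * (B u w * B y w) + B u w * B x w))).
  by apply/funext => w; ring.
have j2 := integ_scale (- 1) i2; have j3 := integ_scale (- 1) i3.
have k1 := integ_add j3 i4; have k2 := integ_add j2 k1.
rewrite (integral_add i1 k2) (integral_add j2 k1) (integral_add j3 i4).
by rewrite (integral_scale _ i2) (integral_scale _ i3) I1 I2 I3 I4; ring.
Qed.

Lemma fBm_increment_var (u v : R) : u \in `[0, 1] -> v \in `[0, 1] ->
  \int[P]_w (B v w - B u w) ^+ 2 = `|v - u| `^ (2 * H).
Proof.
move=> u01 v01; have := fBm_increment_cov u01 v01 u01 v01.
have p0 : 2 * H != 0 by rewrite mulf_neq0// gt_eqF.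
rewrite !subrr normr0 powR0// !subr0 (distrC u v).
have -> : (fun w => (B v w - B u w) * (B v w - B u w)) = (fun w => (B v w - B u w) ^+ 2).
  by apply/funext => w; rewrite expr2.
by move=> ->; field.
Qed.

Hypothesis H12 : 1 / 2 < H.

(** The covariance is half the second difference of [|.|^(2 H)] at [x - u] with step [h], and
    [2 H >= 1] gives convexity. *)
Lemma fBm_increment_cov_ge0 u x h :
  u \in `[0, 1] -> u + h \in `[0, 1] -> x \in `[0, 1] -> x + h \in `[0, 1] ->
  0 <= \int[P]_w ((B (u + h) w - B u w) * (B (x + h) w - B x w)).
Proof.
move=> u01 uh01 x01 xh01; rewrite fBm_increment_cov//.
have p1 : 1 <= 2 * H by have h12 := H12; lra.
have := powR_abs_midconvex (x - u) h p1.
have -> : x - (u + h) = x - u - h by ring.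
have -> : x + h - u = x - u + h by ring.
have -> : x + h - (u + h) = x - u by ring.
by move=> h1; lra.
Qed.

End fractional_brownian_motion.

Lemma outer_measure_finite_union {T : Type} {R : realType} (Q : {outer_measure set T -> \bar R})
    (A : nat -> set T) (n : nat) (c : R) : (forall k, (k < n)%N -> (Q (A k) <= c%:E)%E) ->
  (Q [set w | exists2 k, (k < n)%N & A k w] <= (n%:R * c)%:E)%E.
Proof.
elim: n => [|n IH] Ac.
  have -> : [set w | exists2 k, (k < 0)%N & A k w] = set0.
    by apply/seteqP; split=> w // -[k].
  by rewrite outer_measure0 mul0r.
have sub : [set w | exists2 k, (k < n.+1)%N & A k w] `<=`
    [set w | exists2 k, (k < n)%N & A k w] `|` A n.
  move=> w [k]; rewrite ltnS leq_eqVlt => /orP[/eqP -> Aw|kn Aw]; first by right.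
  by left; exists k.
apply: le_trans (le_outer_measure Q _ _ sub) _.
apply: le_trans (outer_measureU2 Q _ _) _.
rewrite -natr1 mulrDl mul1r EFinD; apply: leeD; last exact: Ac.
by apply: IH => k kn; apply: Ac; exact: ltnW.
Qed.

(** The bounds form a geometric series with sum [c]. *)
Lemma outer_measure_geometric_union {T : Type} {R : realType}
    (Q : {outer_measure set T -> \bar R}) (A : nat -> set T) (c : R) : 0 <= c ->
  (forall n, (Q (A n) <= (c / (2 ^ n.+1)%:R)%:E)%E) -> (Q (\bigcup_n A n) <= c%:E)%E.
Proof.
move=> c0 Ac; apply: le_trans (outer_measure_sigma_subadditive Q A) _.
apply: le_trans (epsilon_trick0 xpredT c0).
by apply: lee_nneseries => [i _ _|n _]; [exact: outer_measure_ge0 | exact: Ac].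
Qed.

Lemma expRN_le_fact {R : realType} (Q : nat) (u : R) : 0 < u ->
  expR (- u) <= Q.+1`!%:R / u ^+ Q.+1.
Proof.
move=> u0; have f0 : 0 < Q.+1`!%:R :> R by rewrite ltr0n fact_gt0.
rewrite expRN -[X in _ <= X]invrK invf_div lef_pV2 ?posrE ?expR_gt0 ?divr_gt0 ?exprn_gt0//.
by have := expR_ge1Dxn Q (ltW u0); lra.
Qed.

Section fBm_paths.
Context {d : measure_display} {T : measurableType d} {R : realType}
  (P : probability T R) (H : R) (B : R -> T -> R) (fB : fBm P H B) (H12 : 1 / 2 < H).

Local Notation D m k := (fun w => B (dyadic R m k.+1) w - B (dyadic R m k) w).

Lemma dyadic_in01 m k : (k <= 2 ^ m)%N -> dyadic R m k \in `[0, 1].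
Proof. by move=> km; rewrite in_itv/= dyadic_ge0 dyadic_le1. Qed.

Lemma increment_span m k : (k < 2 ^ m)%N -> gaussian_span B (D m k).
Proof.
move=> km; apply: gaussian_span_sub; apply: gaussian_span_B; apply: dyadic_in01 => //.
exact: ltnW.
Qed.

Lemma increment_var m k : (k < 2 ^ m)%N ->
  \int[P]_w (B (dyadic R m k.+1) w - B (dyadic R m k) w) ^+ 2 = (2 ^- m) `^ (2 * H).
Proof.
move=> km; rewrite (fBm_increment_var fB) ?dyadic_in01// 1?ltnW//.
by rewrite dyadicS addrAC subrr add0r ger0_norm// invr_ge0 exprn_ge0.
Qed.

Let gm X : gaussian_span B X -> centered_gaussian_moments P X := @gaussian_span_moments _ _ _ _ _ _ fB X.

(** Chebyshev with the second moment bound [2 l^2 v A]. The scaling of the variance gives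
    [l v = 2^(-m)], hence [l^2 v = 2^(m (2 H - 2))]. One may take [A = 1], because the increments
    telescope to an increment of [B] over a length at most 1. *)
Lemma quadratic_variation_tail m k delta : (k <= 2 ^ m)%N -> 0 < delta ->
  ((P^*)%mu [set w | (delta < `|\sum_(0 <= j < k) (2 `^ (m%:R * (2 * H - 1)) *
       (B (dyadic R m j.+1) w - B (dyadic R m j) w) ^+ 2 - 2 ^- m)|)%R] <=
   (2 * 2 `^ (m%:R * (2 * H - 2)) / delta ^+ 2)%:E)%E.
Proof.
move=> km delta0; set l := 2 `^ (m%:R * (2 * H - 1)).
pose v : R := (2 ^- m) `^ (2 * H).
have lv : l * v = 2 ^- m.
  rewrite /l /v powR2_dyadic -powRD; last by rewrite pnatr_eq0 implybT.
  rewrite (_ : m%:R * _ + m%:R * _ = m%:R * (- 1)); last by ring.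
  by rewrite -powR2_dyadic powRr1// invr_ge0 exprn_ge0.
have p1 : 0 <= 2 * H by have h := H12; lra.
have h0 : 0 <= 2 ^- m :> R by rewrite invr_ge0 exprn_ge0.
have cov i j : (i < 2 ^ m)%N -> (j < 2 ^ m)%N ->
    0 <= \int[P]_w (D m i w * D m j w).
  move=> im jm; have := fBm_increment_cov_ge0 fB H12 (dyadic_in01 (ltnW im)) (h := 2 ^- m).
  by rewrite -!dyadicS; move=> /(_ (dyadic R m j)); rewrite -dyadicS; apply; apply: dyadic_in01 => //; exact: ltnW.
have sum1 : \int[P]_w (\sum_(0 <= j < k) D m j w) ^+ 2 <= 1.
  have -> : (fun w => (\sum_(0 <= j < k) D m j w) ^+ 2) =
      (fun w => (B (dyadic R m k) w - B (dyadic R m 0) w) ^+ 2).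
    by apply/funext => w; rewrite (telescope_sumr (fun j => B (dyadic R m j) w)).
  rewrite (fBm_increment_var fB) ?dyadic_in01//.
  by apply: powR_le1 => //; rewrite /dyadic mul0r subr0 ger0_norm ?dyadic_ge0// dyadic_le1.
have [iV IV] := quadratic_variation_variance (P := P) (n := (2 ^ m)%N) (D := fun k => D m k)
  (v := v) (powR_ge0 _ _)
  (fun i im => gm (increment_span im))
  (fun i j im jm => gm (gaussian_span_add (increment_span im) (increment_span jm)))
  (fun i j im jm => gm (gaussian_span_sub (increment_span im) (increment_span jm)))
  (fun i im => increment_var im) cov l km sum1.
rewrite lv in iV IV.
have mV : measurable_fun setT (fun w => \sum_(0 <= j < k) (l * D m j w ^+ 2 - 2 ^- m)).
  rewrite (_ : (fun w => _) = (fun w => \sum_(j < k) (l * D m j w ^+ 2 - 2 ^- m))); last first.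
    by apply/funext => w; rewrite big_mkord.
  apply: measurable_sum => j; apply: measurable_funB => //.
  apply: measurable_funM => //; apply: measurable_funX.
  by have [] := gaussian_span_rv fB (increment_span (leq_trans (ltn_ord j) km)).
rewrite measurable_mu_extE; last exact: measurable_abs_gt.
apply: le_trans (chebyshev_sq mV iV delta0) _.
rewrite lee_fin ler_wpM2r ?invr_ge0 ?sqr_ge0//; apply: le_trans IV _.
rewrite mulr1 expr2 mulrA -mulrA lv /l -mulrA ler_wpM2l//.
have -> : 2 ^- m = 2 `^ (m%:R * - 1) :> R.
  by rewrite -powR2_dyadic powRr1// invr_ge0 exprn_ge0.
rewrite -powRD; last by rewrite pnatr_eq0 implybT.
by rewrite (_ : m%:R * _ + m%:R * _ = m%:R * (2 * H - 2)); last by ring.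
Qed.

(* P(|D| > K 2^(-n gamma)) <= sqrt 2 exp (- K^2 2^(2n(H - gamma)) / 4), and the
   exponential is compared with the inverse of a large enough power. *)
Lemma hoelder_tail gamma : gamma < H -> exists2 C : R, 0 <= C & forall K, 2 <= K ->
  ((P^*)%mu [set w | exists n k, (k < 2 ^ n)%N /\
      (K * (2 ^- n) `^ gamma < `|B (dyadic R n k.+1) w - B (dyadic R n k) w|)%R] <=
   (C / K)%:E)%E.
Proof.
move=> gH; have gH0 : 0 < H - gamma by rewrite subr_gt0.
(* Large enough for [y^(q + 1) >= 4^n]: one factor [2^n] pays for the number of increments at level
   [n], the other makes the levels summable. *)
pose q := Num.truncn (H - gamma)^-1.
have q1 : 1 <= (H - gamma) * q.+1%:R.
  by rewrite mulrC -ler_pdivrMr// mul1r ltW// truncnS_gt.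
have r2 : 0 <= Num.sqrt 2 :> R by exact: sqrtr_ge0.
pose F : R := q.+1`!%:R; have F0 : 0 <= F by exact: ler0n.
exists (4 * Num.sqrt 2 * F) => [|K K2]; first by rewrite mulr_ge0// mulr_ge0.
have K0 : 0 < K by lra.
pose A n := [set w | exists2 k, (k < 2 ^ n)%N &
  (K * (2 ^- n) `^ gamma < `|B (dyadic R n k.+1) w - B (dyadic R n k) w|)%R].
have -> : [set w | exists n k, (k < 2 ^ n)%N /\
      (K * (2 ^- n) `^ gamma < `|B (dyadic R n k.+1) w - B (dyadic R n k) w|)%R] = \bigcup_n A n.
  apply/seteqP; split=> w; first by move=> [n [k [kn h]]]; exists n => //; exists k.
  by move=> [n _ [k kn h]]; exists n, k.
apply: outer_measure_geometric_union => [|n]; first by apply: divr_ge0; [rewrite !mulr_ge0 | exact: ltW].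
pose y : R := 2 `^ (n%:R * (2 * (H - gamma))).
have y0 : 0 < y by rewrite powR_gt0.
pose u := K ^+ 2 * y / 4.
have u0 : 0 < u by rewrite /u !mulr_gt0// exprn_gt0.
pose c : R := Num.sqrt 2 * (F / (K / 2 * 4 ^+ n)).
have d0 : 0 < K / 2 * 4 ^+ n by rewrite mulr_gt0 ?divr_gt0// exprn_gt0.
have uc : Num.sqrt 2 * expR (- u) <= c.
  rewrite /c ler_wpM2l//; apply: le_trans (expRN_le_fact q u0) _.
  rewrite -/F ler_wpM2l// lef_pV2 ?posrE ?exprn_gt0//.
  have -> : u = (K / 2) ^+ 2 * y by rewrite /u; field.
  (* Here [2 <= K] enters: powers of [K / 2] are at least [K / 2], which leaves the decay
     [1 / K]. *)
  have KK : 1 <= K / 2 by lra.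
  rewrite exprMn; apply: ler_pM.
  - by rewrite ltW// divr_gt0.
  - exact: exprn_ge0.
  - rewrite -exprM mulnC -[X in X <= _]expr1; exact: ler_weXn2l.
  - rewrite /y powR2_pow -exprM mulnC exprM; apply: lerXn2r; rewrite ?nnegrE ?exprn_ge0 ?powR_ge0//.
    rewrite -powR_mulrn ?powR_ge0// -powRrM.
    have -> : 4 = 2 `^ 2%:R :> R by rewrite powR_mulrn//; ring.
    by apply: ler_powR; rewrite ?ler1n//; have := q1; lra.
have -> : 4 * Num.sqrt 2 * F / K / (2 ^ n.+1)%:R = (2 ^ n)%:R * c.
  rewrite /c natrX natrX exprS (_ : 4 ^+ n = 2 ^+ n * 2 ^+ n :> R); last first.
    by rewrite -exprMn; congr (_ ^+ n); ring.
  have : 2 ^+ n != 0 :> R by rewrite expf_neq0.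
  have : K != 0 by rewrite gt_eqF.
  by set e := 2 ^+ n => Kn en; field; rewrite en Kn.
apply: outer_measure_finite_union => k kn.
have gs := increment_span kn.
change ((P^*)%mu [set w | (K * (2 ^- n) `^ gamma < `|D n k w|)%R] <= c%:E)%E.
rewrite measurable_mu_extE; last first.
  by apply: measurable_abs_gt; have [] := gaussian_span_rv fB gs.
(* The tail bound is used at [4 u], chosen so that the variance [2^(-2 n H)] times [4 u] is the
   square of the threshold. *)
apply: (@le_trans _ _ (Num.sqrt 2 * expR (- (4 * u) / 4))%:E); last first.
  by rewrite lee_fin (_ : - (4 * u) / 4 = - u)//; field.
apply: (gaussian_span_tail fB gs); first by rewrite mulr_ge0 ?powR_ge0// ltW.
rewrite increment_var// /u.
have -> : 4 * (K ^+ 2 * y / 4) = K ^+ 2 * y by field.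
rewrite exprMn mulrCA ler_wpM2l ?sqr_ge0//.
rewrite -(powR_mulrn 2 (powR_ge0 _ gamma)) -powRrM !powR2_dyadic /y -powRD; last by rewrite pnatr_eq0 implybT.
by rewrite (_ : n%:R * _ + n%:R * _ = n%:R * - (gamma * 2%:R)); last by ring.
Qed.

End fBm_paths.

(** * Convergence in probability *)

Lemma cvg_ereal0 {R : realType} (u : nat -> \bar R) : (forall m, 0 <= u m)%E ->
  (forall e : R, 0 < e -> exists N, forall m, (N <= m)%N -> (u m <= e%:E)%E) ->
  u m @[m --> \oo] --> 0%E.
Proof.
move=> u0 small; apply/fine_cvgP; split.
  have [N uN] := small 1 ltr01; exists N => // m /= /uN um.
  by rewrite ge0_fin_numE// (le_lt_trans um)// ltry.
apply/cvgrPdist_le => e /small[N uN]; exists N => // m /= /uN um.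
rewrite sub0r normrN ger0_norm ?fine_ge0//.
by rewrite -lee_fin fineK// ge0_fin_numE// (le_lt_trans um)// ltry.
Qed.

(** The thresholds come from the chain rule ([2 gamma > 1]), from [lam d] and from [lam d^3 / h].
    All lie below [H], where [2 H - 1 < H] uses [H < 1]; the midpoint between the largest one and
    [H] is taken. *)
Lemma hoelder_exponent {R : realType} (H : R) : 1 / 2 < H < 1 ->
  exists gamma : R, [/\ gamma < H, 1 / 2 < gamma, gamma <= 1, 2 * H - 1 < gamma & 2 * H < 3 * gamma].
Proof.
move=> /andP[H1 H2].
pose M : R := Num.max (1 / 2) (Num.max (2 * H - 1) (2 * H / 3)).
have MH : M < H by rewrite /M !gt_max; apply/and3P; split; lra.
have M1 : 1 / 2 <= M by rewrite /M le_max lexx.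
have M2 : 2 * H - 1 <= M by rewrite /M !le_max lexx orbT.
have M3 : 2 * H / 3 <= M by rewrite /M !le_max lexx !orbT.
by exists ((M + H) / 2); split; lra.
Qed.

Theorem theorem2p5 (d : measure_display) (T : measurableType d) (R : realType)
    (P : probability T R) (H xi : R) (b sigma : R -> R)
    (B X : R -> T -> R) (Xbar : nat -> R -> T -> R) :
  1 / 2 < H < 1 ->
  Cinf_bdd b -> Cinf_bdd sigma -> 0 < inf (range sigma) ->
  fBm P H B ->
  {ae P, forall w, sde_solution b sigma xi (B ^~ w) (X ^~ w)} ->
  (forall m w, euler_scheme b sigma xi (B ^~ w) m (Xbar m ^~ w)) ->
  cvg_prob_unif P
    (fun m t w => 2 `^ (m%:R * (2 * H - 1)) * (Xbar m t w - X t w))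
    (fun t w => limit_path b sigma (B ^~ w) (X ^~ w) t).
Proof.
move=> H01 Cb Csigma sigma0 fB sde euler eps eps0.
have [S [C lamp]] := lamperti_exists Cb Csigma sigma0.
have [gamma [gH g12 g1 gH1 gH3]] := hoelder_exponent H01.
have /andP[H12 H1] := H01.
have g0 : 0 < gamma by lra.
have C0 : 0 <= C by apply: le_trans (lamp_C1 lamp).
have [A A0 hoelderA] := hoelder_tail fB gH.
apply: cvg_ereal0 => [m|e e0]; first exact: outer_measure_ge0.
(* With this [K] the dyadic increment bound fails with probability at most [A / K <= e / 2]. *)
pose K := 2 + 2 * A / e.
have K2 : 2 <= K by rewrite lerDl divr_ge0 ?mulr_ge0// ltW.
have K0 : 0 <= K by apply: le_trans K2.
have AK : A / K <= e / 2.
  rewrite ler_pdivrMr ?(lt_le_trans _ K2)// /K mulrDr.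
  have -> : e / 2 * (2 * A / e) = A by field; rewrite gt_eqF.
  by rewrite lerDr; lra.
have CK0 : 0 <= C + chaining_const K gamma by rewrite addr_ge0// chaining_const_ge0.
have [p [delta [M [delta0 pM conv]]]] := euler_convergence xi lamp H12 g12 g1 gH1 gH3 CK0 eps0.
(* The number of block ends [i = 0, ..., 2^p]. *)
pose n := (2 ^ p).+1.
(* From solving [2 z / delta^2 <= e / 2 / n] for [z = 2^(m (2 H - 2))]: the [n] Chebyshev bounds
   share the other [e / 2]. *)
have c0 : 0 < e / 2 / n%:R * (delta ^+ 2 / 2) by rewrite !mulr_gt0 ?invr_gt0 ?ltr0n ?exprn_gt0.
have H2 : 2 * H - 2 < 0 by lra.
have [N smallN] := powR2_small H2 c0.
exists (maxn M N) => m; rewrite geq_max => /andP[Mm Nm].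
have pm : (p <= m)%N := leq_trans pM Mm.
pose regular w := [/\ B 0 w = 0, {within `[0, 1], continuous (B ^~ w)} &
  sde_solution b sigma xi (B ^~ w) (X ^~ w)].
have reg : {ae P, forall w, regular w}.
  case: fB => _ _ _ _; apply: filterS2 sde => w sw [B0 cB]; exact: And3.
pose F := [set w | exists n k, (k < 2 ^ n)%N /\
  (K * (2 ^- n) `^ gamma < `|B (dyadic R n k.+1) w - B (dyadic R n k) w|)%R].
pose V i := [set w | (delta < `|\sum_(0 <= j < i * 2 ^ (m - p)) (2 `^ (m%:R * (2 * H - 1)) *
       (B (dyadic R m j.+1) w - B (dyadic R m j) w) ^+ 2 - 2 ^- m)|)%R].
pose W := [set w | exists2 i, (i < n)%N & V i w].
(* Outside the three exceptional sets the path satisfies the hypotheses of the deterministic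
   [euler_convergence]. *)
have sub : [set w | (eps%:E < unif_norm (fun t =>
      2 `^ (m%:R * (2 * H - 1)) * (Xbar m t w - X t w) - limit_path b sigma (B ^~ w) (X ^~ w) t)%R)%E]
    `<=` (~` [set w | regular w] `|` F) `|` W.
  move=> w /= bad; apply: contrapT => /not_orP[/not_orP[/contrapT[B0 cB sw] nF] nW].
  move: bad; apply/negP; rewrite -leNgt; apply: ge_ereal_sup => _ [t t01 <-].
  rewrite lee_fin; move: t01; rewrite /= in_itv/= => /andP[t0 t1].
  apply: (conv m (B ^~ w) (X ^~ w) (Xbar m ^~ w)) => //.
    apply: lamperti_path_solution => //; first exact: chaining_const_ge0.
    apply: (@dyadic_hoelder _ (B ^~ w) K gamma) => // k i ik; rewrite leNgt; apply/negP => h.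
    by apply: nF; exists k, i.
  move=> i ip; rewrite leNgt; apply/negP => h; apply: nW; exists i => //.
apply: le_trans (le_mu_ext P sub) _.
apply: le_trans (outer_measureU2 _ _ _) _.
have -> : e%:E = (e / 2)%:E + (e / 2)%:E :> \bar R by rewrite -EFinD; congr EFin; field.
apply: leeD.
  apply: le_trans (outer_measureU2 _ _ _) _.
  rewrite -[X in (_ <= X)%E]add0e; apply: leeD.
    (* The almost sure property supplies a measurable null set around the complement of [regular],
       and on measurable sets [P^*] is [P]. *)
    have [N' [mN' PN' sN']] := reg; apply: le_trans (le_mu_ext P sN') _.
    have h : ((P^*)%mu N' = P N')%E by apply: measurable_mu_extE; exact: mN'.
    by rewrite h -PN'.
  by apply: le_trans (hoelderA K K2) _; rewrite lee_fin.
have n0 : n%:R != 0 :> R by rewrite pnatr_eq0.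
have -> : e / 2 = n%:R * (e / 2 / n%:R) by field.
apply: outer_measure_finite_union => i; rewrite ltnS => ip.
have im : (i * 2 ^ (m - p) <= 2 ^ m)%N.
  by rewrite -{2}(subnKC pm) expnD leq_mul2r ip orbT.
apply: le_trans (quadratic_variation_tail fB H12 im delta0) _.
rewrite lee_fin ler_pdivrMr ?exprn_gt0//; have := smallN m Nm.
by rewrite mulrA ler_pdivlMr// mulrC.
Qed.
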